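(* Consider the equivalences $D^b_G(\mathrm{Coh}\,X)\cong D^b(\mathrm{mod}\,A_3^{\otimes 5})\cong \mathrm{FS}(F)$ and the heart $\mathrm{mod}\,A_3^{\otimes 5}$. For all $x\neq 0$ sufficiently close to the large complex structure limit $x=0$ (with a fixed branch of $\log x$), there is a stability condition on the heart $\mathrm{mod}\,A_3^{\otimes 5}$ with central charge $Z_x$ (the central charge of quintic periods) such that each stable object is isomorphic, under these equivalences, to a Lagrangian vanishing cycle and to a shift of an equivariant coherent sheaf of the Beilinson basis.
   Context: **Categories.** $X=\{x_1^5+\dots+x_5^5=0\}\subset\mathbb P^4_{\mathbb C}$; $\xi=\exp(2\pi i/5)$; $G\cong\mathbb Z_5^5/\mathbb Z_5$ acts on $\mathbb P^4$ by multiplying coordinates by powers of $\xi$ (modulo common multiplication). $D^b_G(\mathrm{Coh}\,X)$ is the bounded derived category of $G$-equivariant coherent sheaves. In this convention $A_n$ is the type-$A$ Dynkin quiver with $n+1$ vertices and one-way arrows, so $A_3$ is $0\to1\to2\to3$. The quiver $A_3^{\otimes5}$ has vertices $s=\{s_1,\dots,s_5\}$, $0\le s_i\le 3$, an arrow $s\to s'$ whenever $s'$ is obtained from $s$ by raising one $s_i$ by $1$, and the relations that all squares commute; $\mathrm{mod}\,A_3^{\otimes 5}$ is its category of finite-dimensional complex representations, the standard heart of $D^b(\mathrm{mod}\,A_3^{\otimes5})$. The simple representation with $\mathbb C$ at vertex $s$ is also written $s$. $F=x_1^5+\dots+x_5^5:\mathbb C^5\to\mathbb C$, and $\mathrm{FS}(F)$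 is the derived Fukaya–Seidel category defined by Lagrangian vanishing cycles in the regular zero locus of a morsification of $F$ (built from A'Campo's morsifications of the $x_i^5$). The following is known: $D^b_G(\mathrm{Coh}\,X)\cong D^b(\mathrm{mod}\,A_3^{\otimes5})\cong\mathrm{FS}(F)$; the simple representations $s$ correspond to the Lagrangian vanishing cycles in $\mathrm{FS}(F)$; and after forgetting the equivariance $s$ becomes $\tau^{-\sum s_i}(\mathcal O_X)$, where $\tau(E)=\mathcal O(1)\otimes T_{\mathcal O_X}(E)$, $T_{\mathcal O_X}$ is the spherical twist, and $\tau^5\cong[2]$. The Beilinson basis consists of the objects $\tau^i(\mathcal O_X)[-i]$; up to shifts, $\tau^i(\mathcal O_X)$ for $i=0,\dots,4$ are $\mathcal O_X,\mathcal O_X(1),\Omega(2),\Omega^2(3),\Omega^3(4)$, with $\Omega^n$ the restriction to $X$ of the $n$-th exterior power of the cotangent bundle of $\mathbb P^4$. **Central charge.** Let $w(x,p)=\sum_{n\ge0}\frac{\Gamma(1+5(n+p))}{\Gamma(1+(n+p))^5}x^{n+p}$ and let $J\in H^2(X)$ be the hyperplane class (nilpotent). For $E\in D^b(\mathrm{Coh}\,X)$, $Z_x(E)=\int_X \mathrm{ch}(E)\,w\!\left(x,\tfrac{J}{2\pi i}\right)\mathrm{Todd}\,X$. For $E\in D^b_G(\mathrm{Coh}\,X)$, $Z_x(E)$ is defined by forgetting the equivariance; so $Z_x(s)=Z_x(\tau^{-\sum s_i}(\mathcal O_X))$. **Stability condition.** A stability condition on a triangulated category $\mathcal T$ consists of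 a heart $\mathcal A$ of a bounded $t$-structure and a homomorphism $Z:K(\mathcal T)\to\mathbb C$ (central charge), with a family of nonzero semistable objects of $\mathcal A$ such that: (1) each semistable $Q\in\mathcal A$ has $Z(Q)=m(Q)\exp(\phi_Q i)$ with mass $m(Q)>0$ and phase $\phi_Q\in\mathbb R$; (2) if $\mathrm{Ext}^1(Q,Q')\ne0$ for semistable $Q,Q'$, then $|\phi_Q-\phi_{Q'}|<\pi$; (3) if $\phi_{Q'}>\phi_Q$ then $\mathrm{Hom}(Q',Q)=0$; (4) each nonzero $E\in\mathcal A$ has a filtration $0=E_n\subset E_{n-1}\subset\dots\subset E_0=E$ in $\mathcal A$ with semistable quotients $Q_i=E_i/E_{i+1}$ and $\phi_{Q_{i+1}}>\phi_{Q_i}$. A semistable object is stable if it is not a non-trivial extension of semistable objects of its phase. (Central charges of objects of $\mathcal A$ need not lie in a half-plane.) *)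

(* Defs.v *)
From HB Require Import structures.
From mathcomp Require Import all_boot all_order all_algebra.
From mathcomp Require Import complex.
From mathcomp Require Import zify.
From mathcomp Require Import all_classical all_reals all_analysis.

Set Implicit Arguments.
Unset Strict Implicit.
Unset Printing Implicit Defensive.

Import Order.TTheory GRing.Theory Num.Theory.
Import numFieldNormedType.Exports.
Local Open Scope ring_scope.

(* Hom-spaces are setoids: [eqm] is the equality of morphisms.  Verdier's   *)
(* axioms are not part of the structure: it is used for bounded derived     *)
(* categories, built below, and for categories equivalent to one of them by *)
(* an exact functor.                                                        *)
Record tricat (K : fieldType) := Tricat {
  obj :> Type;
  mor : obj -> obj -> Type;
  eqm : forall X Y, mor X Y -> mor X Y -> Prop;
  idm : forall X, mor X X;
  cmp : forall X Y Z, mor Y Z -> mor X Y -> mor X Z;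
  zrm : forall X Y, mor X Y;
  addm : forall X Y, mor X Y -> mor X Y -> mor X Y;
  sclm : forall X Y, K -> mor X Y -> mor X Y;
  sh : obj -> obj;
  shm : forall X Y, mor X Y -> mor (sh X) (sh Y);
  dist : forall X Y Z, mor X Y -> mor Y Z -> mor Z (sh X) -> Prop;
  eqm_refl : forall X Y (f : mor X Y), eqm f f;
  eqm_sym : forall X Y (f g : mor X Y), eqm f g -> eqm g f;
  eqm_trans : forall X Y (f g h : mor X Y), eqm f g -> eqm g h -> eqm f h;
  cmp_eqm : forall X Y Z (g g' : mor Y Z) (f f' : mor X Y),
    eqm g g' -> eqm f f' -> eqm (cmp g f) (cmp g' f');
  addm_eqm : forall X Y (f f' g g' : mor X Y),
    eqm f f' -> eqm g g' -> eqm (addm f g) (addm f' g');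
  sclm_eqm : forall X Y a (f f' : mor X Y),
    eqm f f' -> eqm (sclm a f) (sclm a f');
  shm_eqm : forall X Y (f f' : mor X Y), eqm f f' -> eqm (shm f) (shm f');
  cmpA : forall X Y Z T (h : mor Z T) (g : mor Y Z) (f : mor X Y),
    eqm (cmp h (cmp g f)) (cmp (cmp h g) f);
  cmp1m : forall X Y (f : mor X Y), eqm (cmp (idm Y) f) f;
  cmpm1 : forall X Y (f : mor X Y), eqm (cmp f (idm X)) f;
  addmC : forall X Y (f g : mor X Y), eqm (addm f g) (addm g f);
  addmA : forall X Y (f g h : mor X Y),
    eqm (addm f (addm g h)) (addm (addm f g) h);
  add0m : forall X Y (f : mor X Y), eqm (addm (zrm X Y) f) f;
  scl0m : forall X Y (f : mor X Y), eqm (sclm 0 f) (zrm X Y);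
  scl1m : forall X Y (f : mor X Y), eqm (sclm 1 f) f;
  sclmA : forall X Y a b (f : mor X Y),
    eqm (sclm a (sclm b f)) (sclm (a * b) f);
  sclmDl : forall X Y a b (f : mor X Y),
    eqm (sclm (a + b) f) (addm (sclm a f) (sclm b f));
  sclmDr : forall X Y a (f g : mor X Y),
    eqm (sclm a (addm f g)) (addm (sclm a f) (sclm a g));
  cmpDl : forall X Y Z (g g' : mor Y Z) (f : mor X Y),
    eqm (cmp (addm g g') f) (addm (cmp g f) (cmp g' f));
  cmpDr : forall X Y Z (g : mor Y Z) (f f' : mor X Y),
    eqm (cmp g (addm f f')) (addm (cmp g f) (cmp g f'));
  cmpZl : forall X Y Z a (g : mor Y Z) (f : mor X Y),
    eqm (cmp (sclm a g) f) (sclm a (cmp g f));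
  cmpZr : forall X Y Z a (g : mor Y Z) (f : mor X Y),
    eqm (cmp g (sclm a f)) (sclm a (cmp g f));
  shm1 : forall X, eqm (shm (idm X)) (idm (sh X));
  shmM : forall X Y Z (g : mor Y Z) (f : mor X Y),
    eqm (shm (cmp g f)) (cmp (shm g) (shm f));
  shmD : forall X Y (f g : mor X Y),
    eqm (shm (addm f g)) (addm (shm f) (shm g));
  shmZ : forall X Y a (f : mor X Y), eqm (shm (sclm a f)) (sclm a (shm f))
}.

Arguments eqm {K t X Y}.
Arguments idm {K t} X.
Arguments cmp {K t X Y Z}.
Arguments zrm {K t} X Y.
Arguments addm {K t X Y}.
Arguments sclm {K t X Y}.
Arguments sh {K t}.
Arguments shm {K t X Y}.
Arguments dist {K t X Y Z}.

Definition inverse_mor (K : fieldType) (T : tricat K) (X Y : T)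
    (f : mor X Y) (g : mor Y X) : Prop :=
  eqm (cmp g f) (idm X) /\ eqm (cmp f g) (idm Y).

Definition isom (K : fieldType) (T : tricat K) (X Y : T) : Prop :=
  exists (f : mor X Y) (g : mor Y X), inverse_mor f g.

Record exact_functor (K : fieldType) (S T : tricat K) := ExactFunctor {
  fobj :> S -> T;
  fmor : forall X Y, mor X Y -> mor (fobj X) (fobj Y);
  fsh : forall X, mor (fobj (sh X)) (sh (fobj X));
  fmor_eqm : forall X Y (f g : mor X Y), eqm f g -> eqm (fmor f) (fmor g);
  fmor1 : forall X, eqm (fmor (idm X)) (idm (fobj X));
  fmorM : forall X Y Z (g : mor Y Z) (f : mor X Y),
    eqm (fmor (cmp g f)) (cmp (fmor g) (fmor f));
  fmorD : forall X Y (f g : mor X Y),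
    eqm (fmor (addm f g)) (addm (fmor f) (fmor g));
  fmorZ : forall X Y a (f : mor X Y), eqm (fmor (sclm a f)) (sclm a (fmor f));
  fsh_iso : forall X, exists g, inverse_mor (fsh X) g;
  fsh_nat : forall X Y (f : mor X Y),
    eqm (cmp (fsh Y) (fmor (shm f))) (cmp (shm (fmor f)) (fsh X));
  fdist : forall X Y Z (f : mor X Y) (g : mor Y Z) (h : mor Z (sh X)),
    dist f g h -> dist (fmor f) (fmor g) (cmp (fsh X) (fmor h))
}.

Arguments fmor {K S T} e {X Y}.

Definition is_equivalence (K : fieldType) (S T : tricat K)
    (F : exact_functor S T) : Prop :=
  [/\ forall (X Y : S) (f g : mor X Y), eqm (fmor F f) (fmor F g) -> eqm f g,
      forall (X Y : S) (h : mor (F X) (F Y)),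
        exists f : mor X Y, eqm (fmor F f) h
    & forall Y : T, exists X : S, isom (F X) Y].

(* a homomorphism K(T) -> V *)
Definition K_hom (K : fieldType) (T : tricat K) (V : zmodType)
    (Z : T -> V) : Prop :=
  forall (X Y W : T) (f : mor X Y) (g : mor Y W) (h : mor W (sh X)),
    dist f g h -> Z Y = Z X + Z W.

Definition lin_comb (K : fieldType) (T : tricat K) (X Y : T) (m : nat)
    (c : 'I_m -> K) (f : 'I_m -> mor X Y) : mor X Y :=
  \big[addm/zrm X Y]_(j < m) sclm (c j) (f j).

Definition mor_basis (K : fieldType) (T : tricat K) (X Y : T) (m : nat)
    (f : 'I_m -> mor X Y) : Prop :=
  forall h : mor X Y,
    exists c : 'I_m -> K,
      eqm h (lin_comb c f) /\
      forall c', eqm h (lin_comb c' f) -> forall j, c' j = c j.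

Record quiver := Quiver { vtx : Type; arr : vtx -> vtx -> Type }.

Section Rep.
Variables (K : fieldType) (Q : quiver).

Record rep := Rep {
  rv :> vtx Q -> vectType K;
  rm : forall i j, arr i j -> 'Hom(rv i, rv j)
}.

Record rhom (V W : rep) := RHom {
  rf : forall i, 'Hom(rv V i, rv W i);
  rfP : forall i j (a : arr i j), (rm W a \o rf i = rf j \o rm V a)%VF
}.

Definition rheq (V W : rep) (f g : rhom V W) : Prop :=
  forall i, rf f i = rf g i.

Definition rzero_rep : rep :=
  @Rep (fun=> 'rV[K]_0) (fun i j _ => 0).

Definition is_zero_rep (V : rep) : Prop := forall i (u : rv V i), u = 0.

Lemma rid_proof (V : rep) i j (a : arr i j) :
  (rm V a \o \1 = \1 \o rm V a)%VF.
Proof. by rewrite comp_lfun1r comp_lfun1l. Qed.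
Definition rid V : rhom V V := RHom (@rid_proof V).

Lemma rcomp_proof (U V W : rep) (g : rhom V W) (f : rhom U V) i j
    (a : arr i j) :
  (rm W a \o (rf g i \o rf f i) = (rf g j \o rf f j) \o rm U a)%VF.
Proof. by rewrite comp_lfunA rfP -comp_lfunA rfP comp_lfunA. Qed.
Definition rcomp (U V W : rep) (g : rhom V W) (f : rhom U V) : rhom U W :=
  RHom (rcomp_proof g f).

Lemma rzero_proof (V W : rep) i j (a : arr i j) :
  (rm W a \o (0 : 'Hom(rv V i, rv W i)) = 0 \o rm V a)%VF.
Proof. by rewrite comp_lfun0r comp_lfun0l. Qed.
Definition rzero V W : rhom V W := RHom (@rzero_proof V W).

Lemma radd_proof (V W : rep) (f g : rhom V W) i j (a : arr i j) :
  (rm W a \o (rf f i + rf g i) = (rf f j + rf g j) \o rm V a)%VF.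
Proof. by rewrite comp_lfunDr comp_lfunDl !rfP. Qed.
Definition radd (V W : rep) (f g : rhom V W) : rhom V W :=
  RHom (radd_proof f g).

Lemma rscale_proof (V W : rep) (c : K) (f : rhom V W) i j (a : arr i j) :
  (rm W a \o (c *: rf f i) = (c *: rf f j) \o rm V a)%VF.
Proof. by rewrite -comp_lfunZr -comp_lfunZl !rfP. Qed.
Definition rscale (V W : rep) c (f : rhom V W) : rhom V W :=
  RHom (rscale_proof c f).

End Rep.

Arguments rv {K Q} r i : rename.
Arguments rm {K Q} r {i j} a : rename.
Arguments rf {K Q V W} r i : rename.
Arguments rid {K Q} V.
Arguments rzero {K Q} V W.

(* A category of quiver representations that satisfy the relations [crel].  *)
(* Exactness is tested pointwise on a set of vertices that is [large]: all  *)
(* vertices for modules over a quiver with relations, all degrees d >> 0    *)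
(* for graded modules up to torsion.                                        *)
Record repcat (K : fieldType) := RepCat {
  cquiv : quiver;
  crel : rep K cquiv -> Prop;
  crel0 : crel (rzero_rep K cquiv);
  large : (vtx cquiv -> Prop) -> Prop;
  largeT : large (fun=> True);
  largeW : forall A B : vtx cquiv -> Prop,
    large A -> (forall v, A v -> B v) -> large B
}.

Section Db.
Variables (K : fieldType) (C : repcat K).

Record cobj := CObj { crep :> rep K (cquiv C); crelP : crel crep }.

Definition czero : cobj := CObj (crel0 C).

(* [cd i j] is the differential for j = i + 1 and vanishes otherwise. *)
Record cpx := Cpx {
  cX :> int -> cobj;
  cd : forall i j, rhom (cX i) (cX j);
  cd_shape : forall i j, j != i + 1 -> rheq (cd i j) (rzero _ _);
  cd_cd : forall i j k, rheq (rcomp (cd j k) (cd i j)) (rzero _ _);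
  cd_bounded : exists N : nat,
    forall i : int, (N < `|i|)%N -> is_zero_rep (cX i)
}.

Record cmap (X Y : cpx) := CMap {
  cf : forall i, rhom (X i) (Y i);
  cfP : forall i j, rheq (rcomp (cd Y i j) (cf i)) (rcomp (cf j) (cd X i j))
}.

Definition cmeq (X Y : cpx) (f g : cmap X Y) : Prop :=
  forall i, rheq (cf f i) (cf g i).

Lemma cid_proof (X : cpx) i j :
  rheq (rcomp (cd X i j) (rid (X i))) (rcomp (rid (X j)) (cd X i j)).
Proof. by move=> v /=; rewrite comp_lfun1r comp_lfun1l. Qed.
Definition cid X : cmap X X := CMap (@cid_proof X).

Lemma ccomp_proof (X Y Z : cpx) (g : cmap Y Z) (f : cmap X Y) i j :
  rheq (rcomp (cd Z i j) (rcomp (cf g i) (cf f i)))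
       (rcomp (rcomp (cf g j) (cf f j)) (cd X i j)).
Proof.
move=> v /=; have /= Hg := cfP g i j v; have /= Hf := cfP f i j v.
by rewrite comp_lfunA Hg -comp_lfunA Hf comp_lfunA.
Qed.
Definition ccomp (X Y Z : cpx) (g : cmap Y Z) (f : cmap X Y) : cmap X Z :=
  CMap (ccomp_proof g f).

Lemma c0_proof (X Y : cpx) i j :
  rheq (rcomp (cd Y i j) (rzero (X i) (Y i)))
       (rcomp (rzero (X j) (Y j)) (cd X i j)).
Proof. by move=> v /=; rewrite comp_lfun0r comp_lfun0l. Qed.
Definition c0 X Y : cmap X Y := CMap (@c0_proof X Y).

Lemma cadd_proof (X Y : cpx) (f g : cmap X Y) i j :
  rheq (rcomp (cd Y i j) (radd (cf f i) (cf g i)))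
       (rcomp (radd (cf f j) (cf g j)) (cd X i j)).
Proof.
move=> v /=; have /= Hg := cfP g i j v; have /= Hf := cfP f i j v.
by rewrite comp_lfunDr comp_lfunDl Hf Hg.
Qed.
Definition cadd (X Y : cpx) (f g : cmap X Y) : cmap X Y :=
  CMap (cadd_proof f g).

Lemma cscale_proof (X Y : cpx) a (f : cmap X Y) i j :
  rheq (rcomp (cd Y i j) (rscale a (cf f i)))
       (rcomp (rscale a (cf f j)) (cd X i j)).
Proof.
move=> v /=; have /= Hf := cfP f i j v.
by rewrite -comp_lfunZr -comp_lfunZl Hf.
Qed.
Definition cscale (X Y : cpx) a (f : cmap X Y) : cmap X Y :=
  CMap (cscale_proof a f).

(* X[n]^i = X^(i+n), with differential (-1)^n d *)
Section Shift.
Variables (n : int) (X : cpx).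

Let shd i j : rhom (X (i + n)) (X (j + n)) :=
  rscale ((-1) ^ n) (cd X (i + n) (j + n)).

Lemma csh_shape i j : j != i + 1 -> rheq (shd i j) (rzero _ _).
Proof.
move=> ij v; have ijn : j + n != i + n + 1.
  by apply: contraNneq ij => /(canRL (addrK _)) ->; rewrite addrAC addrK.
by have /= -> := cd_shape X ijn v; rewrite scaler0.
Qed.

Lemma csh_dd i j k : rheq (rcomp (shd j k) (shd i j)) (rzero _ _).
Proof.
move=> v /=; have /= H := cd_cd X (i + n) (j + n) (k + n) v.
by rewrite -comp_lfunZr -comp_lfunZl H !scaler0.
Qed.

Lemma csh_bounded : exists N : nat,
  forall i : int, (N < `|i|)%N -> is_zero_rep (X (i + n)).
Proof.
have [N HN] := cd_bounded X; exists (N + `|n|)%N => i Hi.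
apply: HN; lia.
Qed.

Definition cshift : cpx := Cpx csh_shape csh_dd csh_bounded.

End Shift.

Lemma cshift_map_proof n (X Y : cpx) (f : cmap X Y) i j :
  rheq (rcomp (cd (cshift n Y) i j) (cf f (i + n)))
       (rcomp (cf f (j + n)) (cd (cshift n X) i j)).
Proof.
move=> v /=; have /= Hf := cfP f (i + n) (j + n) v.
by rewrite -comp_lfunZr -comp_lfunZl Hf.
Qed.
Definition cshift_map n (X Y : cpx) (f : cmap X Y) :
    cmap (cshift n X) (cshift n Y) :=
  @CMap (cshift n X) (cshift n Y) (fun i => cf f (i + n))
    (cshift_map_proof n f).

Definition cocycle (X : cpx) (v : vtx (cquiv C)) (i : int) (x : rv (X i) v) :=
  forall k, rf (cd X i k) v x = 0.

(* f induces isomorphisms on the cohomology at the vertex v *)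
Definition qis_at (v : vtx (cquiv C)) (X Y : cpx) (f : cmap X Y) : Prop :=
  forall i j : int, j = i + 1 ->
    (forall x : rv (X j) v, cocycle x ->
      (exists y, rf (cf f j) v x = rf (cd Y i j) v y) ->
      exists x', x = rf (cd X i j) v x') /\
    (forall y : rv (Y j) v, cocycle y ->
      exists x, cocycle x /\
        exists y', y = rf (cf f j) v x + rf (cd Y i j) v y').

Definition qis (X Y : cpx) (f : cmap X Y) : Prop :=
  large (fun v => qis_at v f).

Lemma signz_neq0 n : ((-1) ^ n : K) != 0.
Proof. by rewrite expfz_neq0 // oppr_eq0 oner_eq0. Qed.

Lemma cocycle_shift n X v i (x : rv (cshift n X i) v) :
  cocycle x <-> @cocycle X v (i + n) x.
Proof.
split=> Hx k.
  have := Hx (k - n); rewrite /= /rscale /= lfunE /= => /eqP.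
  by rewrite scaler_eq0 (negPf (signz_neq0 n)) subrK => /eqP.
by rewrite /= lfunE /= Hx scaler0.
Qed.

Lemma qis_shift n (X Y : cpx) (f : cmap X Y) :
  qis f -> qis (cshift_map n f).
Proof.
move=> Hf; apply: largeW Hf _ => v Hf i j ij.
have sgn0 := signz_neq0 n.
have /Hf [Hinj Hsur] : j + n = (i + n) + 1 by rewrite ij addrAC.
split.
- move=> x /cocycle_shift Hx [y /= xy].
  have [|x' ->] := Hinj x Hx.
    by exists ((-1) ^ n *: y); rewrite xy lfunE /= linearZ.
  by exists (((-1) ^ n)^-1 *: x'); rewrite /= lfunE /= linearZ scalerKV.
- move=> y /cocycle_shift Hy; have [x [Hx [y' ->]]] := Hsur y Hy.
  exists x; split; first exact/cocycle_shift.
  by exists (((-1) ^ n)^-1 *: y'); rewrite /= lfunE /= linearZ scalerKV.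
Qed.

(* The K-linear localization of the category of bounded complexes at the    *)
(* quasi-isomorphisms: formal linear combinations of formal composites of   *)
(* chain maps and inverses of quasi-isomorphisms, modulo the congruence     *)
(* generated by the axioms of K-linear categories, functoriality and        *)
(* invertibility.                                                           *)
Inductive Dmor : cpx -> cpx -> Type :=
| Dmap X Y (f : cmap X Y) : Dmor X Y
| Dinv X Y (f : cmap X Y) (Hf : qis f) : Dmor Y X
| Dcomp X Y Z (g : Dmor Y Z) (f : Dmor X Y) : Dmor X Z
| Dadd X Y (f g : Dmor X Y) : Dmor X Y
| Dscale X Y (a : K) (f : Dmor X Y) : Dmor X Y.

Inductive Deq : forall X Y, Dmor X Y -> Dmor X Y -> Prop :=
| Deq_refl X Y (f : Dmor X Y) : Deq f f
| Deq_sym X Y (f g : Dmor X Y) : Deq f g -> Deq g f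
| Deq_trans X Y (f g h : Dmor X Y) : Deq f g -> Deq g h -> Deq f h
| Deq_comp X Y Z (g g' : Dmor Y Z) (f f' : Dmor X Y) :
    Deq g g' -> Deq f f' -> Deq (Dcomp g f) (Dcomp g' f')
| Deq_add X Y (f f' g g' : Dmor X Y) :
    Deq f f' -> Deq g g' -> Deq (Dadd f g) (Dadd f' g')
| Deq_scale X Y a (f f' : Dmor X Y) :
    Deq f f' -> Deq (Dscale a f) (Dscale a f')
| DcompA X Y Z T (h : Dmor Z T) (g : Dmor Y Z) (f : Dmor X Y) :
    Deq (Dcomp h (Dcomp g f)) (Dcomp (Dcomp h g) f)
| Dcomp1m X Y (f : Dmor X Y) : Deq (Dcomp (Dmap (cid Y)) f) f
| Dcompm1 X Y (f : Dmor X Y) : Deq (Dcomp f (Dmap (cid X))) f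
| DaddC X Y (f g : Dmor X Y) : Deq (Dadd f g) (Dadd g f)
| DaddA X Y (f g h : Dmor X Y) : Deq (Dadd f (Dadd g h)) (Dadd (Dadd f g) h)
| Dadd0m X Y (f : Dmor X Y) : Deq (Dadd (Dmap (c0 X Y)) f) f
| Dscale0 X Y (f : Dmor X Y) : Deq (Dscale 0 f) (Dmap (c0 X Y))
| Dscale1 X Y (f : Dmor X Y) : Deq (Dscale 1 f) f
| DscaleA X Y a b (f : Dmor X Y) :
    Deq (Dscale a (Dscale b f)) (Dscale (a * b) f)
| DscaleDl X Y a b (f : Dmor X Y) :
    Deq (Dscale (a + b) f) (Dadd (Dscale a f) (Dscale b f))
| DscaleDr X Y a (f g : Dmor X Y) :
    Deq (Dscale a (Dadd f g)) (Dadd (Dscale a f) (Dscale a g))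
| DcompDl X Y Z (g g' : Dmor Y Z) (f : Dmor X Y) :
    Deq (Dcomp (Dadd g g') f) (Dadd (Dcomp g f) (Dcomp g' f))
| DcompDr X Y Z (g : Dmor Y Z) (f f' : Dmor X Y) :
    Deq (Dcomp g (Dadd f f')) (Dadd (Dcomp g f) (Dcomp g f'))
| DcompZl X Y Z a (g : Dmor Y Z) (f : Dmor X Y) :
    Deq (Dcomp (Dscale a g) f) (Dscale a (Dcomp g f))
| DcompZr X Y Z a (g : Dmor Y Z) (f : Dmor X Y) :
    Deq (Dcomp g (Dscale a f)) (Dscale a (Dcomp g f))
| Dmap_eq X Y (f g : cmap X Y) : cmeq f g -> Deq (Dmap f) (Dmap g)
| DmapM X Y Z (g : cmap Y Z) (f : cmap X Y) :
    Deq (Dmap (ccomp g f)) (Dcomp (Dmap g) (Dmap f))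
| DmapD X Y (f g : cmap X Y) :
    Deq (Dmap (cadd f g)) (Dadd (Dmap f) (Dmap g))
| DmapZ X Y a (f : cmap X Y) : Deq (Dmap (cscale a f)) (Dscale a (Dmap f))
| DinvL X Y (f : cmap X Y) (Hf : qis f) :
    Deq (Dcomp (Dinv Hf) (Dmap f)) (Dmap (cid X))
| DinvR X Y (f : cmap X Y) (Hf : qis f) :
    Deq (Dcomp (Dmap f) (Dinv Hf)) (Dmap (cid Y)).

Fixpoint Dshift (n : int) X Y (f : Dmor X Y) :
    Dmor (cshift n X) (cshift n Y) :=
  match f with
  | Dmap _ _ f => Dmap (cshift_map n f)
  | Dinv _ _ f Hf => Dinv (qis_shift n Hf)
  | Dcomp _ _ _ g f => Dcomp (Dshift n g) (Dshift n f)
  | Dadd _ _ f g => Dadd (Dshift n f) (Dshift n g)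
  | Dscale _ _ a f => Dscale a (Dshift n f)
  end.

Lemma Dshift_eq n X Y (f g : Dmor X Y) :
  Deq f g -> Deq (Dshift n f) (Dshift n g).
Proof.
elim=> {X Y f g} /=.
- by move=> *; exact: Deq_refl.
- by move=> *; exact: Deq_sym.
- by move=> X Y f g h _ H1 _ H2; exact: Deq_trans H1 H2.
- by move=> *; exact: Deq_comp.
- by move=> *; exact: Deq_add.
- by move=> *; exact: Deq_scale.
- by move=> *; exact: DcompA.
- move=> X Y f; apply: Deq_trans (Dcomp1m _).
  by apply: Deq_comp; [exact: Dmap_eq | exact: Deq_refl].
- move=> X Y f; apply: Deq_trans (Dcompm1 _).
  by apply: Deq_comp; [exact: Deq_refl | exact: Dmap_eq].
- by move=> *; exact: DaddC.
- by move=> *; exact: DaddA.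
- move=> X Y f; apply: Deq_trans (Dadd0m _).
  by apply: Deq_add; [exact: Dmap_eq | exact: Deq_refl].
- by move=> X Y f; apply: Deq_trans (Dscale0 _) _; exact: Dmap_eq.
- by move=> *; exact: Dscale1.
- by move=> *; exact: DscaleA.
- by move=> *; exact: DscaleDl.
- by move=> *; exact: DscaleDr.
- by move=> *; exact: DcompDl.
- by move=> *; exact: DcompDr.
- by move=> *; exact: DcompZl.
- by move=> *; exact: DcompZr.
- by move=> X Y f g fg; apply: Dmap_eq => i; exact: fg.
- by move=> X Y Z g f; apply: Deq_trans (DmapM _ _); exact: Dmap_eq.
- by move=> X Y f g; apply: Deq_trans (DmapD _ _); exact: Dmap_eq.
- by move=> X Y a f; apply: Deq_trans (DmapZ _ _); exact: Dmap_eq.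
- by move=> X Y f Hf; apply: Deq_trans (DinvL _) _; exact: Dmap_eq.
- by move=> X Y f Hf; apply: Deq_trans (DinvR _) _; exact: Dmap_eq.
Qed.

(* X -> Y -> Z is a short exact sequence of complexes that is split in each *)
(* degree, by sections s and retractions r, and h = r d s.                  *)
Definition split_triangle (X Y Z : cpx)
    (f : cmap X Y) (g : cmap Y Z) (h : cmap Z (cshift 1 X)) : Prop :=
  exists (s : forall i, rhom (Z i) (Y i)) (r : forall i, rhom (Y i) (X i)),
    forall i,
    [/\ rheq (rcomp (r i) (cf f i)) (rid _),
        rheq (rcomp (cf g i) (s i)) (rid _),
        rheq (radd (rcomp (cf f i) (r i)) (rcomp (s i) (cf g i))) (rid _)
      & rheq (cf h i) (rcomp (r (i + 1)) (rcomp (cd Y i (i + 1)) (s i)))].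

Definition Disom_pair (X Y : cpx) (f : Dmor X Y) (g : Dmor Y X) : Prop :=
  Deq (Dcomp g f) (Dmap (cid X)) /\ Deq (Dcomp f g) (Dmap (cid Y)).

Definition Ddist (X Y Z : cpx)
    (u : Dmor X Y) (v : Dmor Y Z) (w : Dmor Z (cshift 1 X)) : Prop :=
  exists (X' Y' Z' : cpx) (f : cmap X' Y') (g : cmap Y' Z')
         (h : cmap Z' (cshift 1 X')) (a : Dmor X X') (b : Dmor Y Y')
         (c : Dmor Z Z'),
    [/\ split_triangle f g h,
        (exists a', Disom_pair a a') /\ (exists b', Disom_pair b b') /\
          (exists c', Disom_pair c c'),
        Deq (Dcomp b u) (Dcomp (Dmap f) a),
        Deq (Dcomp c v) (Dcomp (Dmap g) b)
      & Deq (Dcomp (Dshift 1 a) w) (Dcomp (Dmap h) c)].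

Lemma Dshift1 n X : Deq (Dshift n (Dmap (cid X))) (Dmap (cid (cshift n X))).
Proof. exact: Dmap_eq. Qed.

Definition Db : tricat K := @Tricat K cpx Dmor Deq
  (fun X => Dmap (cid X)) Dcomp (fun X Y => Dmap (c0 X Y)) Dadd Dscale
  (cshift 1) (Dshift 1) Ddist
  Deq_refl Deq_sym Deq_trans Deq_comp Deq_add Deq_scale (@Dshift_eq 1)
  DcompA Dcomp1m Dcompm1 DaddC DaddA Dadd0m Dscale0 Dscale1 DscaleA DscaleDl
  DscaleDr DcompDl DcompDr DcompZl DcompZr
  (Dshift1 1)
  (fun X Y Z g f => Deq_refl _) (fun X Y f g => Deq_refl _)
  (fun X Y a f => Deq_refl _).

End Db.

Section Stalk.
Variables (K : fieldType) (C : repcat K) (V : cobj C).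

Let st (i : int) : cobj C := if i == 0 then V else czero C.

Lemma stalk_shape i j : j != i + 1 ->
  rheq (rzero (st i) (st j)) (rzero (st i) (st j)).
Proof. by []. Qed.

Lemma stalk_dd i j k :
  rheq (rcomp (rzero (st j) (st k)) (rzero (st i) (st j)))
       (rzero (st i) (st k)).
Proof. by move=> v /=; rewrite comp_lfun0l. Qed.

Lemma stalk_bounded : exists N : nat,
  forall i : int, (N < `|i|)%N -> is_zero_rep (st i).
Proof.
exists 0%N => i; rewrite /st absz_gt0 => /negPf -> v u.
by apply/rowP => -[].
Qed.

Definition stalk : Db C := Cpx stalk_shape stalk_dd stalk_bounded.

End Stalk.

(* The standard heart of Db: cohomology only in degree 0. *)
Definition in_heart (K : fieldType) (C : repcat K) (E : Db C) : Prop :=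
  large (fun v => forall i j : int, j = i + 1 -> j != 0 ->
    forall x : rv (cX E j) v, cocycle x -> exists y, x = rf (cd E i j) v y).

Definition short_exact (K : fieldType) (Q : quiver) (U V W : rep K Q)
    (f : rhom U V) (g : rhom V W) : Prop :=
  forall i, [/\ forall x, rf f i x = 0 -> x = 0,
                forall z, exists y, rf g i y = z
              & forall y, rf g i y = 0 <-> exists x, y = rf f i x].

Definition rep_isom (K : fieldType) (Q : quiver) (V W : rep K Q) : Prop :=
  exists (f : rhom V W) (g : rhom W V),
    rheq (rcomp g f) (rid V) /\ rheq (rcomp f g) (rid W).

(* Yoneda's Ext^1(Q, Q') <> 0: there is an extension 0 -> Q' -> E -> Q -> 0 *)
(* that does not split.                                                     *)
Definition Ext1_nonzero (K : fieldType) (C : repcat K) (Q Q' : cobj C) : Prop :=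
  exists (E : cobj C) (f : rhom Q' E) (g : rhom E Q),
    short_exact f g /\ ~ exists s : rhom Q E, rheq (rcomp g s) (rid Q).

Definition A35_vertex := {ffun 'I_5 -> 'I_4}.

Definition A35_arrow (s t : A35_vertex) : bool :=
  [exists i, (t i == (s i).+1 :> nat) &&
             [forall j, (j != i) ==> (t j == s j)]].

Definition A35_quiver : quiver := @Quiver A35_vertex A35_arrow.

Definition A35_rel (K : fieldType) (V : rep K A35_quiver) : Prop :=
  forall (s t t' u : A35_vertex) (a : A35_arrow s t) (b : A35_arrow t u)
    (a' : A35_arrow s t') (b' : A35_arrow t' u),
  (@rm _ A35_quiver V t u b \o @rm _ A35_quiver V s t a =
   @rm _ A35_quiver V t' u b' \o @rm _ A35_quiver V s t' a')%VF.

Lemma A35_rel0 (K : fieldType) : A35_rel (rzero_rep K A35_quiver).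
Proof. by move=> s t t' u a b a' b' /=; rewrite !comp_lfun0l. Qed.

Definition modA35 (K : fieldType) : repcat K :=
  @RepCat K A35_quiver (@A35_rel K) (@A35_rel0 K)
    (fun A => forall v, A v) (fun=> I) (fun A B HA AB v => AB v (HA v)).

Definition simple_rep (K : fieldType) (s : A35_vertex) : rep K A35_quiver :=
  @Rep K A35_quiver (fun t : A35_vertex => 'rV[K]_(t == s)) (fun _ _ _ => 0).

Lemma simple_rel (K : fieldType) s : A35_rel (simple_rep K s).
Proof. by move=> x t t' u a b a' b' /=; rewrite !comp_lfun0l. Qed.

Definition simple (K : fieldType) (s : A35_vertex) : cobj (modA35 K) :=
  @CObj K (modA35 K) (simple_rep K s) (simple_rel K s).

(* By Serre's theorem Coh X is the category of finitely generated graded    *)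
(* modules over S = C[x_1..x_5]/(x_1^5 + .. + x_5^5) up to modules that     *)
(* vanish in degrees d >> 0, and D^b(Coh X) is the localization of the      *)
(* category of bounded complexes of such modules at the chain maps that are *)
(* quasi-isomorphisms in degrees d >> 0.  Only large degrees matter, so     *)
(* modules are graded by nat.                                               *)
Inductive gr_arrow : nat -> nat -> Type :=
| Mul (i : 'I_5) (d : nat) : gr_arrow d d.+1.

Definition gr_quiver : quiver := Quiver gr_arrow.

Definition eventually (A : nat -> Prop) : Prop :=
  exists N : nat, forall d, (N <= d)%N -> A d.

Lemma eventuallyT : eventually (fun=> True).
Proof. by exists 0%N. Qed.

Lemma eventuallyW (A B : nat -> Prop) :
  eventually A -> (forall d, A d -> B d) -> eventually B.
Proof. by move=> [N HN] AB; exists N => d /HN /AB. Qed.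

Section GradedModules.
Variable K : fieldType.
Implicit Type M : rep K gr_quiver.

Definition mulx M (i : 'I_5) (d : nat) : 'Hom(rv M d, rv M d.+1) :=
  @rm _ gr_quiver M d d.+1 (Mul i d).

Definition gr_rel M : Prop :=
  [/\ forall i j d, (mulx M i d.+1 \o mulx M j d =
                     mulx M j d.+1 \o mulx M i d)%VF,
      forall d, \sum_(i < 5) (mulx M i d.+4 \o (mulx M i d.+3 \o
                 (mulx M i d.+2 \o (mulx M i d.+1 \o mulx M i d))))%VF = 0
    & exists N : nat, forall d, (N <= d)%N ->
        (\sum_(i < 5) limg (mulx M i d) = fullv)%VS].

Lemma gr_rel0 : gr_rel (rzero_rep K gr_quiver).
Proof.
split=> [i j d|d|]; first by rewrite /mulx /= !comp_lfun0l.
- by rewrite big1 // => i _; exact: comp_lfun0l.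
- exists 0%N => d _; apply/vspaceP => u.
  have -> : u = 0 :> 'rV[K]_0 by apply/rowP => -[].
  by rewrite !mem0v.
Qed.

Definition CohX : repcat K :=
  @RepCat K gr_quiver gr_rel gr_rel0 eventually eventuallyT eventuallyW.

(* S itself, as the free graded module on one generator of degree 0 *)
Definition structure_sheaf (O : cobj CohX) : Prop :=
  exists one : @rv _ gr_quiver O 0%N,
    forall (M : cobj CohX) (m : @rv _ gr_quiver M 0%N),
      exists f : rhom O M, rf f 0%N one = m /\
        forall g : rhom O M, rf g 0%N one = m -> rheq f g.

(* M(1)_d = M_(d+1) *)
Definition twist_rep M : rep K gr_quiver :=
  @Rep K gr_quiver (fun d : nat => rv M d.+1)
    (fun d e a => match a in gr_arrow d e
                  return 'Hom(rv M d.+1, rv M e.+1) with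
                  | Mul i d => mulx M i d.+1 end).

Lemma twist_rel M : gr_rel M -> gr_rel (twist_rep M).
Proof.
case=> Hc HF [N HN]; split.
- by move=> i j d; exact: Hc.
- by move=> d; exact: (HF d.+1).
- by exists N => d Nd; apply: HN; exact: leqW.
Qed.

Definition twist_obj (M : cobj CohX) : cobj CohX :=
  @CObj K CohX (twist_rep M) (twist_rel (crelP M)).

Lemma twist_hom_proof (M N : rep K gr_quiver) (f : rhom M N) d e
    (a : gr_arrow d e) :
  (@rm _ gr_quiver (twist_rep N) d e a \o rf f d.+1 =
   rf f e.+1 \o @rm _ gr_quiver (twist_rep M) d e a)%VF.
Proof. by case: a => i {}d; exact: (rfP f (Mul i d.+1)). Qed.

Definition twist_hom (M N : rep K gr_quiver) (f : rhom M N) :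
    rhom (twist_rep M) (twist_rep N) :=
  @RHom K gr_quiver (twist_rep M) (twist_rep N)
    (fun d : nat => rf f d.+1) (twist_hom_proof f).

Section TwistComplex.
Variable E : cpx CohX.

Lemma twist_shape i j : j != i + 1 ->
  rheq (twist_hom (cd E i j)) (rzero (twist_obj (E i)) (twist_obj (E j))).
Proof. by move=> ij d; exact: (cd_shape E ij). Qed.

Lemma twist_dd i j k :
  rheq (rcomp (twist_hom (cd E j k)) (twist_hom (cd E i j)))
       (rzero (twist_obj (E i)) (twist_obj (E k))).
Proof. by move=> d; exact: (cd_cd E i j k). Qed.

Lemma twist_bounded : exists N : nat,
  forall i : int, (N < `|i|)%N -> is_zero_rep (twist_obj (E i)).
Proof. by have [N HN] := cd_bounded E; exists N => i /HN H d; exact: H. Qed.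

Definition twist : Db CohX :=
  @Cpx K CohX (fun i => twist_obj (E i)) (fun i j => twist_hom (cd E i j))
    twist_shape twist_dd twist_bounded.

End TwistComplex.

(* G-equivariant sheaves are graded modules with a compatible action of     *)
(* (Z/5)^5, where a acts on x_j by xi^(a_j); the action factors through     *)
(* G = (Z/5)^5/(Z/5) on Proj S and on the sheaf exactly if the diagonal     *)
(* element c acts on degree d by xi^(c d), as it does on S.                 *)
Inductive eqgr_arrow : nat -> nat -> Type :=
| Gr d e (a : gr_arrow d e) : eqgr_arrow d e
| Act (a : 'rV['Z_5]_5) (d : nat) : eqgr_arrow d d.

Definition eqgr_quiver : quiver := Quiver eqgr_arrow.

Definition forget_rep (M : rep K eqgr_quiver) : rep K gr_quiver :=
  @Rep K gr_quiver (rv M)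
    (fun d e a => @rm _ eqgr_quiver M d e (Gr a)).

Definition act (M : rep K eqgr_quiver) (a : 'rV['Z_5]_5) (d : nat) :
  'Hom(rv M d, rv M d) := @rm _ eqgr_quiver M d d (Act a d).

Definition eqgr_rel (xi : K) (M : rep K eqgr_quiver) : Prop :=
  [/\ gr_rel (forget_rep M),
      forall d, act M 0 d = \1%VF,
      forall a b d, act M (a + b) d = (act M a d \o act M b d)%VF,
      forall a j d, (act M a d.+1 \o mulx (forget_rep M) j d =
        xi ^+ (a 0 j : nat) *: (mulx (forget_rep M) j d \o act M a d))%VF
    & forall (c : 'Z_5) d, act M (const_mx c) d = xi ^+ (c * d)%N *: \1%VF].

Lemma eqgr_rel0 xi : eqgr_rel xi (rzero_rep K eqgr_quiver).
Proof.
have H0 d (f g : 'Hom('rV[K]_0, rv (rzero_rep K eqgr_quiver) d)) : f = g.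
  by apply/lfunP => u; apply/rowP => -[].
split.
- split=> [i j d|d|]; first exact: H0.
  + exact: (H0 d.+4.+1).
  + by have [_ _ [N HN]] := gr_rel0; exists N => d /HN.
- by move=> d; exact: H0.
- by move=> a b d; exact: H0.
- by move=> a j d; exact: (H0 d.+1).
- by move=> c d; exact: H0.
Qed.

Definition CohGX (xi : K) : repcat K :=
  @RepCat K eqgr_quiver (eqgr_rel xi) (eqgr_rel0 xi)
    eventually eventuallyT eventuallyW.

Section Forget.
Variable xi : K.

Lemma forget_rel (M : cobj (CohGX xi)) : gr_rel (forget_rep M).
Proof. by case: M => M []. Qed.

Definition forget_obj (M : cobj (CohGX xi)) : cobj CohX :=
  @CObj K CohX (forget_rep M) (forget_rel M).

Definition forget_hom (M N : rep K eqgr_quiver) (f : rhom M N) :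
    rhom (forget_rep M) (forget_rep N) :=
  @RHom K gr_quiver (forget_rep M) (forget_rep N) (rf f)
    (fun d e a => @rfP _ _ _ _ f d e (Gr a)).

Variable E : Db (CohGX xi).

Lemma forget_shape i j : j != i + 1 ->
  rheq (forget_hom (cd E i j)) (rzero (forget_obj (cX E i)) (forget_obj (cX E j))).
Proof. by move=> ij d; exact: (cd_shape E ij). Qed.

Lemma forget_dd i j k :
  rheq (rcomp (forget_hom (cd E j k)) (forget_hom (cd E i j)))
       (rzero (forget_obj (cX E i)) (forget_obj (cX E k))).
Proof. by move=> d; exact: (cd_cd E i j k). Qed.

Lemma forget_bounded : exists N : nat,
  forall i : int, (N < `|i|)%N -> is_zero_rep (forget_obj (cX E i)).
Proof. by have [N HN] := cd_bounded E; exists N => i /HN H d; exact: H. Qed.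

Definition forget : Db CohX :=
  @Cpx K CohX (fun i => forget_obj (cX E i))
    (fun i j => forget_hom (cd E i j)) forget_shape forget_dd forget_bounded.

End Forget.

Variable O : cobj CohX.

Definition OX (n : int) : Db CohX := cshift n (stalk O).

(* P is the direct sum of m(n) copies of O[-n], for n in a finite range *)
Definition is_coproduct (m : int -> nat) (P : Db CohX)
    (inc : forall n, 'I_(m n) -> mor (OX (- n)) P) : Prop :=
  forall (Y : Db CohX) (g : forall n, 'I_(m n) -> mor (OX (- n)) Y),
    exists u : mor P Y,
      (forall n j, eqm (cmp u (inc n j)) (g n j)) /\
      forall u', (forall n j, eqm (cmp u' (inc n j)) (g n j)) -> eqm u' u.

(* T is the cone of the evaluation map ev from the direct sum P of the      *)
(* Hom(O[-n], E) (x) O[-n] to E.                                            *)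
Definition spherical_twist (E T : Db CohX) : Prop :=
  exists (m : int -> nat) (P : Db CohX)
         (inc : forall n, 'I_(m n) -> mor (OX (- n)) P)
         (ev : mor P E) (b : mor E T) (c : mor T (sh P)),
    [/\ exists N : nat, forall n : int, (N < `|n|)%N -> m n = 0%N,
        is_coproduct inc,
        forall n, mor_basis (fun j => cmp ev (inc n j))
      & dist ev b c].

(* tau is only used up to isomorphism, as a relation. *)
Definition is_tau (E E' : Db CohX) : Prop :=
  exists2 T, spherical_twist E T & isom E' (twist T).

Fixpoint is_tau_pow (k : nat) (E E' : Db CohX) : Prop :=
  match k with
  | 0%N => isom E E'
  | k.+1 => exists2 E1, is_tau_pow k E E1 & is_tau E1 E'
  end.

(* A coherent sheaf that is a shift of tau^i(O), 0 <= i <= 4: these are the *)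
(* objects tau^i(O)[-i] of the Beilinson basis, up to shifts.               *)
Definition beilinson_sheaf (i : nat) (B : Db CohX) : Prop :=
  in_heart B /\ exists m : int, is_tau_pow i (stalk O) (cshift m B).

(* A G-equivariant coherent sheaf whose underlying sheaf is one of them. *)
Definition equivariant_beilinson_sheaf xi (B : Db (CohGX xi)) : Prop :=
  in_heart B /\ exists2 i : nat, (i < 5)%N & beilinson_sheaf i (forget B).

End GradedModules.

Section Periods.
Variable R : realType.
Local Notation C := R[i].

Definition cexp (z : C) : C :=
  ((expR (complex.Re z) * cos (complex.Im z)) +i*
   (expR (complex.Re z) * sin (complex.Im z)))%C.

Definition clim (u : nat -> C) : C :=
  (limn (fun n => complex.Re (u n)) +i* limn (fun n => complex.Im (u n)))%C.

Definition xi5 : C := cexp (0 +i* (pi *+ 2 / 5))%C.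

(* The even cohomology of X with complex coefficients is C[J]/J^4, and the  *)
(* integral of J^3 over X is 5.                                             *)
Definition Hev := {poly %/ ('X^4 : {poly C})}.

Definition J : Hev := 'qX.

Definition integral_X (v : Hev) : C := 5 * (v : {poly C})`_3.

(* c(X) = (1 + J)^5 / (1 + 5 J), so c_1 = 0, c_2 = 10 J^2 and               *)
(* Todd X = 1 + c_2 / 12.                                                   *)
Definition todd_X : Hev := 1 + (5 / 6 : C) *: J ^+ 2.

(* The exponential of a nilpotent class. *)
Definition hexp (h : Hev) : Hev :=
  \sum_(k < 4) ((k`!)%:R^-1 : C) *: h ^+ k.

(* The Chern character of D^b(Coh X): a homomorphism on the Grothendieck    *)
(* group, multiplicative for O(1), for which the Riemann-Roch formula       *)
(* chi(O, E) = sum_n (-1)^n dim Hom(O[-n], E) = int_X ch(E) Todd X holds.   *)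
(* As J^0, .., J^3 are spanned by the exp(n J), it is determined by these   *)
(* properties.                                                              *)
Definition chern_character (O : cobj (CohX C)) (ch : Db (CohX C) -> Hev) :
    Prop :=
  [/\ K_hom ch,
      ch (stalk O) = 1,
      forall E, ch (twist E) = hexp J * ch E
    & forall (E : Db (CohX C)) (N : nat) (m : int -> nat),
        (forall n : int, (N < `|n|)%N -> m n = 0%N) ->
        (forall n, exists f : 'I_(m n) -> mor (OX O (- n)) E, mor_basis f) ->
        integral_X (ch E * todd_X) =
        \sum_(k < N.*2.+1) (-1) ^ (k%:Z - N%:Z) * (m (k%:Z - N%:Z))%:R].

Definition Gamma (s : R) : R :=
  \int[lebesgue_measure]_(t in `]0, +oo[%classic) (t `^ (s - 1) * expR (- t)).

Definition gamma_coef (n k : nat) : R :=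
  derive1n k (fun p : R =>
    Gamma (1 + 5 * (n%:R + p)) / Gamma (1 + (n%:R + p)) ^+ 5) 0 / k`!%:R.

(* J / (2 pi i) *)
Definition p_J : Hev := (0 +i* (pi *+ 2))%C^-1 *: J.

(* the n-th term of w(x, J / (2 pi i)), where l = log x *)
Definition w_term (l : C) (n : nat) : Hev :=
  cexp (n%:R * l) *:
    ((\sum_(k < 4) (gamma_coef n k)%:C%C *: p_J ^+ k) * hexp (l *: p_J)).

Definition w_X (l : C) : Hev :=
  \sum_(j < 4)
    clim (fun N => (\sum_(n < N) w_term l n : {poly C})`_j) *: J ^+ j.

(* Z_x(E) as a function of l = log x and v = ch(E) *)
Definition quintic_period (l : C) (v : Hev) : C :=
  integral_X (v * w_X l * todd_X).

Local Notation modA := (modA35 C).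

(* A stability condition on D^b(mod A) with heart mod A and central charge  *)
(* Z.                                                                       *)
Record stability_condition (Z : Db modA -> C) := StabilityCondition {
  semistable : cobj modA -> Prop;
  phase : cobj modA -> R;
  central_charge_hom : K_hom Z;
  semistable_neq0 : forall Q, semistable Q -> ~ is_zero_rep Q;
  semistable_iso : forall Q Q' : cobj modA,
    rep_isom Q Q' -> semistable Q -> semistable Q';
  semistable_mass : forall Q, semistable Q ->
    exists2 m : R, 0 < m & Z (stalk Q) = m%:C%C * cexp (0 +i* phase Q)%C;
  semistable_ext : forall Q Q', semistable Q -> semistable Q' ->
    Ext1_nonzero Q Q' -> `|phase Q - phase Q'| < pi;
  semistable_hom : forall Q Q', semistable Q -> semistable Q' ->
    phase Q < phase Q' -> forall f : rhom Q' Q, rheq f (rzero Q' Q);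
  semistable_filtration : forall E : cobj modA, ~ is_zero_rep E ->
    exists (n : nat) (F Q : nat -> cobj modA),
      [/\ F 0%N = E, is_zero_rep (F n),
          forall i, (i < n)%N -> semistable (Q i) /\
            exists (f : rhom (F i.+1) (F i)) (g : rhom (F i) (Q i)),
              short_exact f g
        & forall i, (i.+1 < n)%N -> phase (Q i) < phase (Q i.+1)]
}.

(* Q is semistable and has no semistable subobject and quotient of its      *)
(* phase; split extensions by nonzero objects count as non-trivial.         *)
Definition stable (Z : Db modA -> C) (sigma : stability_condition Z)
    (Q : cobj modA) : Prop :=
  semistable sigma Q /\
  ~ exists (U V : cobj modA) (f : rhom U Q) (g : rhom Q V),
      [/\ semistable sigma U, semistable sigma V,
          phase sigma U = phase sigma Q, phase sigma V = phase sigma Q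
        & short_exact f g].

End Periods.

(* Main.v *)
(* As x -> 0 put t = log x / (2 pi i); its imaginary part y tends to infinity
   while its real part stays bounded. The functional equation of Gamma bounds the
   derivatives at p = 0 of the coefficients of w(x, p) geometrically in n, so the
   terms n >= 1 are exponentially small in y, and the coefficient of J^i in
   w(x, J / (2 pi i)) is t^i / i! + O(y^(i-1)), or O(1) for i = 0.

   Riemann-Roch gives ch(tau E) = e^J (ch E - chi(E)), so the ch(tau^(-n) O_X)
   run through five explicit vectors v_n, and for consecutive ones the minor in
   the coefficients of 1 and J is at least 1. Hence Z_n = Z_x(tau^(-n) O_X)
   satisfies Im (Z_(n+1) conj(Z_n)) > 0 for large y, and one can choose phases
   phi_n of Z_n with 0 < phi_(n+1) - phi_n < pi.

   Let the level of a vertex s be sum s_i, so that the simples of level n have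
   central charge Z_n. Take as semistable objects the nonzero representations
   concentrated on one level n, with phase phi_n. Arrows raise the level by one:
   the filtration by levels is the Harder-Narasimhan filtration, there are no maps
   between different levels, and a nonsplit extension of level n by level n' needs
   n' = n + 1. A representation on one level is a sum of simples, so the stable
   objects are the simples, which become vanishing cycles in FS(F), and shifts of
   Beilinson sheaves by tau^5 = [2]. *)
Require Import Defs.
From HB Require Import structures.
From mathcomp Require Import all_boot all_order all_algebra.
From mathcomp Require Import complex.
From mathcomp Require Import all_classical all_reals all_analysis.
From mathcomp Require Import measurable_realfun.
From mathcomp Require Import zify ring lra.
Import Defs.

Set Implicit Arguments.
Unset Strict Implicit.
Unset Printing Implicit Defensive.

Import Order.TTheory GRing.Theory Num.Theory.
Import numFieldNormedType.Exports.
Local Open Scope ring_scope.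

(** * The Gamma function and the coefficients of the period *)

(** The coefficients of ch on 1 and J decide because they pair with t^3 / 6 and t^2 / 2, whose
    leading terms -i y^3 / 6 and -y^2 / 2 produce y^5 / 12 times the minor; all other pairings are
    O(y^4). The factor Todd X adds 5/6 of the coefficient two degrees lower, which goes into the
    errors.

    Two steps hide most of the work. The spherical twist involves a coproduct known only by its
    universal property, to which no rule for ch except additivity on triangles applies. Its class is
    found by comparison with an explicit direct sum of complexes, once additivity has been shown to
    imply invariance under isomorphism and a change of sign under the shift. Moreover, morphisms of
    the derived category are formal expressions in chain maps and inverses of quasi-isomorphisms, so
    that being a sheaf is not visibly invariant under isomorphism. Letting these expressions act on
    cohomology in all large module degrees proves the invariance and carries the sheaf property from
    a Beilinson sheaf to an equivariant complex. *)

Section GammaFunction.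
Variable R : realType.
Local Open Scope classical_set_scope.
Local Notation mu := (@lebesgue_measure R).

Lemma expR_ge_pow (m : nat) (t : R) : 0 <= t -> t ^+ m / m`!%:R <= expR t.
Proof.
move=> t0; case: m => [|m]; first by rewrite expr0 fact0 divr1 -[1]expR0 ler_expR.
by apply: le_trans (expR_ge1Dxn m t0); rewrite lerDr.
Qed.

Lemma powR_le_exp (s t : R) (m : nat) : s <= m%:R -> 1 <= t ->
  t `^ s <= m`!%:R * expR t.
Proof.
move=> sm t1; apply: le_trans (ler_powR t1 sm) _.
rewrite powR_mulrn ?(le_trans _ t1)//.
by rewrite mulrC -ler_pdivrMr ?ltr0n ?fact_gt0// expR_ge_pow// (le_trans _ t1).
Qed.

Lemma powR_continuous_pos (s t : R) : 0 < t -> {for t, continuous (fun t => t `^ s)}.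
Proof.
move=> t0; apply/differentiable_continuous/derivable1_diffP.
by have [] := is_derive1_powR s t0.
Qed.

Lemma expRN_continuous : continuous (fun t : R => expR (- t)).
Proof. by move=> t; apply: continuous_comp; [exact: opp_continuous | exact: continuous_expR]. Qed.

Lemma is_derive_expRN (t : R) : is_derive t 1 (fun t => - expR (- t)) (expR (- t)).
Proof.
have H := is_deriveN (is_derive1_comp (is_derive_expR (- t)) (is_deriveNid t 1)).
by apply: is_derive_eq H _; rewrite mulrN1 opprK.
Qed.

Lemma within_itv_continuous (f : R -> R) (a b : R) :
  (forall t, a <= t <= b -> {for t, continuous f}) ->
  {within `[a, b], continuous f}.
Proof.
move=> H; apply: continuous_in_subspaceT => t.
by rewrite inE/= in_itv/= => /H.
Qed.

Lemma itv_LRcontinuous (f : R -> R) (a b : R) :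
  (forall t, a <= t <= b -> derivable f t 1) -> a <= b ->
  derivable_oo_LRcontinuous f a b.
Proof.
move=> df ab; have cf t : a <= t <= b -> {for t, continuous f}.
  by move=> /df /derivable1_diffP /differentiable_continuous.
split.
- by move=> t; rewrite in_itv/= => /andP[at_ tb]; apply: df; rewrite !ltW.
- by apply: cvg_at_right_filter; apply: cf; rewrite lexx.
- by apply: cvg_at_left_filter; apply: cf; rewrite lexx ab.
Qed.

(** The interval stays away from 0, where the power is not differentiable for s < 1; the improper
    integral is then reached by exhaustion. *)
Lemma gamma_by_parts (s a b : R) : 0 < a -> a < b ->
  (\int[mu]_(t in `[a, b]) (t `^ s * expR (- t))%:E =
   (a `^ s * expR (- a) - b `^ s * expR (- b))%:E +
   \int[mu]_(t in `[a, b]) (s%:E * (t `^ (s - 1) * expR (- t))%:E))%E.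
Proof.
move=> a0 ab.
have pos t : a <= t <= b -> 0 < t by move=> /andP[/(lt_le_trans a0)].
rewrite (@integration_by_parts R (fun t => t `^ s) (fun t => - expR (- t))
  (fun t => s * t `^ (s - 1)) (fun t => expR (- t)) a b ab).
- congr (_ + _)%E; first by congr (_%:E); ring.
  have mf : measurable_fun `[a, b] (fun t => s * t `^ (s - 1) * expR (- t)).
    apply: subspace_continuous_measurable_fun => //.
    apply: within_itv_continuous => t /pos t0.
    apply: continuousM; last exact: expRN_continuous.
    apply: continuousM; first exact: cst_continuous.
    exact: powR_continuous_pos.
  under eq_integral do rewrite mulrN EFinN.
  under [in RHS]eq_integral do rewrite -EFinM mulrA.
  rewrite integralN ?oppeK//=.
  apply: integrable_add_def; first exact: measurable_itv.
  apply: continuous_compact_integrable; first exact: segment_compact.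
  apply: within_itv_continuous => t /pos t0.
  apply: continuousM; last exact: expRN_continuous.
  apply: continuousM; first exact: cst_continuous.
  exact: powR_continuous_pos.
- apply: within_itv_continuous => t /pos t0.
  apply: continuousM; first exact: cst_continuous.
  exact: powR_continuous_pos.
- apply: itv_LRcontinuous; last exact: ltW.
  by move=> t /pos t0; have [] := is_derive1_powR s t0.
- move=> t; rewrite in_itv/= => /andP[/ltW at_ /ltW tb].
  have t0 : 0 < t by apply: pos; rewrite at_.
  by rewrite derive1E; have [_] := is_derive1_powR s t0.
- by apply: within_itv_continuous => t _; exact: expRN_continuous.
- apply: itv_LRcontinuous; last exact: ltW.
  by move=> t _; have [] := is_derive_expRN t.
- by move=> t _; rewrite derive1E; have [_] := is_derive_expRN t.
Qed.

(** With n + 1 instead of n + 2 the first interval would be a single point, while [gamma_by_parts]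
    requires a < b. *)
Let I (n : nat) : set R := `[n.+2%:R^-1, n.+2%:R].

Lemma bigcup_gamma_itv : \bigcup_n I n = `]0, +oo[%classic.
Proof.
apply/seteqP; split=> t /=.
  move=> [n _]; rewrite /I/= !in_itv/= andbT => /andP[+ _].
  by apply: lt_le_trans; rewrite invr_gt0.
rewrite in_itv/= andbT => t0.
pose n := Num.truncn (t + t^-1); exists n => //=.
have H : t + t^-1 < n.+2%:R.
  by apply: lt_trans (truncnS_gt _) _; rewrite ltr_nat.
rewrite /I/= in_itv/=; apply/andP; split.
- rewrite invf_ple ?posrE//; apply: ltW; apply: le_lt_trans H.
  by rewrite lerDr ltW.
- by apply: ltW; apply: le_lt_trans H; rewrite lerDl invr_ge0 ltW.
Qed.

Lemma gamma_itv_nondecreasing : nondecreasing_seq I.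
Proof.
move=> m n mn; apply/subsetPset => t; rewrite /I/= !in_itv/= => /andP[h1 h2].
apply/andP; split.
- by apply: le_trans h1; rewrite lef_pV2 ?posrE// ler_nat !ltnS.
- by apply: le_trans h2 _; rewrite ler_nat !ltnS.
Qed.

Lemma gamma_boundary (s : R) : 0 < s ->
  (n.+2%:R^-1 `^ s * expR (- n.+2%:R^-1)
   - n.+2%:R `^ s * expR (- n.+2%:R) : R) @[n --> \oo] --> (0 : R).
Proof.
move=> s0; rewrite -[X in _ --> X]subr0; apply: cvgB.
- apply: (@squeeze_cvgr _ _ _ _ (cst 0) (fun n => n.+2%:R^-1 `^ s)).
  + apply: nearW => n; apply/andP; split; first by rewrite mulr_ge0 ?powR_ge0 ?expR_ge0.
    by rewrite ler_piMr ?powR_ge0// expR_le1 oppr_le0 invr_ge0.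
  + exact: cvg_cst.
  + apply: (cvg_at_rightP (fun a => a `^ s) 0 0).1; first exact: powR_cvg0.
    split; first by move=> n; rewrite invr_gt0.
    have := @cvg_harmonic R; rewrite -cvg_shiftS.
    exact.
(* An integer m >= s + 1: then N^(s+1) <= m! exp(N) for N = n + 2, which leaves the factor 1 / N in
   the bound. *)
- pose m := (Num.truncn s).+2.
  apply: (@squeeze_cvgr _ _ _ _ (cst 0) (fun n => m`!%:R * n.+2%:R^-1)).
  + apply: nearW => n; apply/andP; split; first by rewrite mulr_ge0 ?powR_ge0 ?expR_ge0.
    rewrite expRN ler_pdivrMr ?expR_gt0// mulrAC ler_pdivlMr//.
    have -> : n.+2%:R `^ s * n.+2%:R = n.+2%:R `^ (s + 1) :> R.
      by rewrite powRD ?pnatr_eq0 ?implybT// powRr1.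
    apply: powR_le_exp; last by rewrite ler1n.
    by rewrite /m -[_.+2]addn1 natrD lerD2r ltW// truncnS_gt.
  + exact: cvg_cst.
  + rewrite -[X in _ --> X](mulr0 (m`!%:R)); apply: cvgMr.
    have := @cvg_harmonic R; rewrite -cvg_shiftS.
    exact.
Qed.

Lemma gamma_integrand_measurable (s : R) (A : set R) :
  measurable_fun A (fun t : R => (t `^ s * expR (- t))%:E).
Proof.
apply/measurable_EFinP/measurable_funTS/measurable_funM.
  exact: measurable_powR.
exact: continuous_measurable_fun expRN_continuous.
Qed.

Lemma Gamma_rec (s : R) : 0 < s -> Gamma (s + 1) = s * Gamma s.
Proof.
move=> s0.
have H (r : R) : (\int[mu]_(t in I n) (t `^ r * expR (- t))%:E @[n --> \oo] -->
    \int[mu]_(t in `]0%R, +oo[) (t `^ r * expR (- t))%:E)%E.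
  rewrite -bigcup_gamma_itv; apply: ge0_nondecreasing_set_cvg_integral => //.
  - exact: gamma_itv_nondecreasing.
  - by move=> n; exact: measurable_itv.
  - by move=> n; exact: gamma_integrand_measurable.
  - by move=> n t _; rewrite lee_fin mulr_ge0 ?powR_ge0 ?expR_ge0.
have E : (\int[mu]_(t in `]0%R, +oo[) (t `^ s * expR (- t))%:E =
   s%:E * \int[mu]_(t in `]0%R, +oo[) (t `^ (s - 1) * expR (- t))%:E)%E.
  apply: (cvg_unique _ (H s)); first exact: ereal_hausdorff.
  rewrite -(add0e (s%:E * _)%E).
  have -> : (fun n => \int[mu]_(t in I n) (t `^ s * expR (- t))%:E)%E =
    (fun n => (n.+2%:R^-1 `^ s * expR (- n.+2%:R^-1)
               - n.+2%:R `^ s * expR (- n.+2%:R))%:E +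
      s%:E * \int[mu]_(t in I n) (t `^ (s - 1) * expR (- t))%:E)%E.
    apply/funext => n; rewrite /I gamma_by_parts; last 2 first.
      by rewrite invr_gt0.
      by apply: (@lt_trans _ _ 1); rewrite ?invf_lt1 ?ltr1n.
    rewrite ge0_integralZl//.
    - exact: gamma_integrand_measurable.
    - by move=> t _; rewrite lee_fin mulr_ge0 ?powR_ge0 ?expR_ge0.
    - by rewrite lee_fin ltW.
  apply: cvgeD; first by rewrite fin_num_adde_defr.
    by apply: cvg_EFin; [exact: nearW | exact: gamma_boundary].
  by apply: cvgeZl => //; exact: H.
(* A real-valued integral is 0 by convention when the extended one is infinite, so the identity
   holds in those cases too. *)
rewrite /Gamma /Rintegral addrK E; case: (\int[mu]_(t in _) _)%E => [r| |]//=.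
- by rewrite gt0_muley ?lte_fin//= mulr0.
- by rewrite gt0_muleNy ?lte_fin//= mulr0.
Qed.

Lemma expRN_integral :
  (\int[mu]_(t in `]0%R, +oo[) (expR (- t))%:E = 1)%E.
Proof.
rewrite integral_itv_obnd_cbnd; last first.
  by apply/measurable_EFinP/measurable_funTS; exact: continuous_measurable_fun expRN_continuous.
rewrite (@ge0_continuous_FTC2y _ _ (fun t => - expR (- t)) _ 0).
- by rewrite oppr0 expR0 sub0e EFinN oppeK.
- by move=> t _; exact: expR_ge0.
- by apply: continuous_subspaceT => t; exact: expRN_continuous.
- by rewrite -[X in _ --> X]oppr0; apply: cvgN; exact: cvgr_expR.
- by move=> t _; have [] := is_derive_expRN t.
- apply: cvg_at_right_filter; apply: cvgN; exact: expRN_continuous.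
- by move=> t _; rewrite derive1E; have [_] := is_derive_expRN t.
Qed.

Lemma Gamma1 : Gamma (1 : R) = 1.
Proof.
rewrite /Gamma /Rintegral.
under eq_integral do rewrite subrr powRr0 mul1r.
by rewrite expRN_integral.
Qed.

End GammaFunction.

(** * Functions differentiable n times on an open set, and norms of their jets *)

Section Smooth.
Variable R : realType.
Local Open Scope classical_set_scope.
Implicit Types (f g : R -> R) (A B : set R).

Fixpoint smooth n A f : Prop :=
  if n is n'.+1 then (forall x, A x -> derivable f x 1) /\ smooth n' A (derive1 f)
  else True.

(** The l^1 norm of the n-jet. Being submultiplicative up to 2^n, it turns a multiplicative
    recursion between functions into a geometric bound on their derivatives. *)
Fixpoint jnorm n f x : R :=
  `|f x| + (if n is n'.+1 then jnorm n' (derive1 f) x else 0).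

Lemma open_near_eq A f g x : open A -> (forall x, A x -> f x = g x) -> A x ->
  \near x, f x = g x.
Proof. by move=> oA fg Ax; apply: filterS fg _; exact: open_nbhs_nbhs. Qed.

Lemma derive1_eq_on A f g : open A -> (forall x, A x -> f x = g x) ->
  forall x, A x -> (derive1 f) x = (derive1 g) x.
Proof.
move=> oA fg x Ax; rewrite !derive1E; apply: near_eq_derive.
exact: open_near_eq oA fg Ax.
Qed.

Lemma smooth_eq A n f g : open A -> (forall x, A x -> f x = g x) ->
  smooth n A f -> smooth n A g.
Proof.
move=> oA; elim: n f g => [//|n IH] f g fg /= [df sf]; split.
  move=> x Ax; apply: near_eq_derivable (df x Ax).
  exact: open_near_eq oA fg Ax.
exact: IH (derive1_eq_on oA fg) sf.
Qed.

Lemma jnorm_eq A n f g x : open A -> (forall x, A x -> f x = g x) -> A x ->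
  jnorm n f x = jnorm n g x.
Proof.
move=> oA + Ax; elim: n f g => [|n IH] f g fg /=; first by rewrite fg.
by rewrite fg// (IH _ _ (derive1_eq_on oA fg)).
Qed.

Lemma smoothW n A f : smooth n.+1 A f -> smooth n A f.
Proof.
elim: n f => [//|n IH] f [df sf]; split=> //.
exact: IH sf.
Qed.

Lemma derive1D_on A f g : smooth 1 A f -> smooth 1 A g ->
  forall x, A x -> (f \+ g)^`() x = ((derive1 f) \+ (derive1 g)) x.
Proof.
move=> [df _] [dg _] x Ax; rewrite /= !derive1E.
exact: (deriveD (df _ Ax) (dg _ Ax)).
Qed.

Lemma derive1M_on A f g : smooth 1 A f -> smooth 1 A g ->
  forall x, A x -> (f \* g)^`() x = (((derive1 f) \* g) \+ (f \* (derive1 g))) x.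
Proof.
move=> [df _] [dg _] x Ax; rewrite /= !derive1E.
rewrite (deriveM (df _ Ax) (dg _ Ax)) /= addrC; congr (_ + _).
by rewrite mulrC.
Qed.

Lemma smooth1 n A f : smooth n.+1 A f -> smooth 1 A f.
Proof. by move=> [df _]; split. Qed.

Lemma smoothD n A f g : open A -> smooth n A f -> smooth n A g ->
  smooth n A (f \+ g).
Proof.
move=> oA; elim: n f g => [//|n IH] f g sf sg; split.
  by move=> x Ax; apply: derivableD; [apply: sf.1 | apply: sg.1].
apply: (@smooth_eq _ _ ((derive1 f) \+ (derive1 g))) => //.
  by move=> x Ax; rewrite (derive1D_on (smooth1 sf) (smooth1 sg)).
exact: IH sf.2 sg.2.
Qed.

Lemma smoothM n A f g : open A -> smooth n A f -> smooth n A g ->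
  smooth n A (f \* g).
Proof.
move=> oA; elim: n f g => [//|n IH] f g sf sg; split.
  by move=> x Ax; apply: derivableM; [apply: sf.1 | apply: sg.1].
apply: (@smooth_eq _ _ (((derive1 f) \* g) \+ (f \* (derive1 g)))) => //.
  by move=> x Ax; rewrite (derive1M_on (smooth1 sf) (smooth1 sg)).
apply: smoothD => //; apply: IH; [exact: sf.2 | exact: smoothW |
  exact: smoothW | exact: sg.2].
Qed.

Lemma derive1_cst_fun c : (fun=> c : R)^`() = (fun=> 0 : R).
Proof. by apply/funext => x; rewrite derive1E; exact: derive_cst. Qed.

Lemma smooth_cst n A c : smooth n A (fun=> c).
Proof.
elim: n c => [//|n IH] c; split; first by move=> x _; exact: derivable_cst.
by rewrite derive1_cst_fun.
Qed.

Lemma smooth_id n A : smooth n A id.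
Proof.
case: n => [//|n]; split; first by move=> x _; exact: derivable_id.
rewrite (_ : (derive1 id) = fun=> 1); first exact: smooth_cst.
by apply/funext => x; rewrite derive1E; exact: derive_id.
Qed.

Lemma smoothX n A f k : open A -> smooth n A f ->
  smooth n A (fun x => f x ^+ k).
Proof.
move=> oA sf; elim: k => [|k IH].
  by apply: (smooth_eq oA (fun x _ => esym (expr0 (f x)))); exact: smooth_cst.
by apply: (smooth_eq oA (fun x _ => esym (exprS (f x) k))); exact: smoothM.
Qed.

Lemma derive1V_on A f : (forall x, A x -> f x != 0) -> smooth 1 A f ->
  forall x, A x -> (fun x => (f x)^-1)^`() x =
    ((cst (-1) \* (derive1 f)) \* ((fun x => (f x)^-1) \* (fun x => (f x)^-1))) x.
Proof.
move=> f0 [df _] x Ax; rewrite derive1E /=.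
have [_ ->] := is_deriveV (f0 _ Ax) (derivableP (df _ Ax)).
by rewrite derive1E /GRing.scale/= -invfM -expr2 mulN1r !mulNr mulrC.
Qed.

Lemma smoothV n A f : open A -> (forall x, A x -> f x != 0) ->
  smooth n A f -> smooth n A (fun x => (f x)^-1).
Proof.
move=> oA f0; elim: n => [//|n IH] sf; split.
  by move=> x Ax; apply: derivableV; [exact: f0 | exact: sf.1].
apply: (smooth_eq oA (fun x Ax => esym (derive1V_on f0 (smooth1 sf) Ax))).
have sV := IH (smoothW sf).
apply: smoothM => //; last exact: smoothM.
by apply: smoothM => //; [exact: smooth_cst | exact: sf.2].
Qed.

Lemma derive1_affine f (a b x : R) : derivable f (a * x + b) 1 ->
  is_derive x 1 (fun x => f (a * x + b)) (a * (derive1 f) (a * x + b)).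
Proof.
move=> df; have Hl : is_derive x 1 (fun x => a * x + b) a.
  have := is_deriveD (is_deriveZ a (is_derive_id x 1)) (is_derive_cst b x 1).
  by move=> H; apply: is_derive_eq H _; rewrite addr0 /GRing.scale/= mulr1.
have := @is_derive1_comp _ f (fun x => a * x + b) x _ _ (derivableP df) Hl.
by rewrite derive1E mulrC.
Qed.

Lemma smooth_affine n A B f (a b : R) : open A ->
  (forall x, A x -> B (a * x + b)) ->
  smooth n B f -> smooth n A (fun x => f (a * x + b)).
Proof.
move=> oA AB; elim: n f => [//|n IH] f [df sf]; split.
  by move=> x /AB /df /derive1_affine [].
apply: (@smooth_eq _ _ (cst a \* (fun x => (derive1 f) (a * x + b)))) => //.
  by move=> x /AB /df /derive1_affine [_ /= <-]; rewrite derive1E.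
by apply: smoothM => //; [exact: smooth_cst | exact: IH].
Qed.

Lemma jnorm_ge0 n f x : 0 <= jnorm n f x.
Proof. by elim: n f => [|n IH] f /=; rewrite addr_ge0. Qed.

Lemma jnorm_ge n f x : `|f x| <= jnorm n f x.
Proof. by case: n => [|n] /=; rewrite lerDl// jnorm_ge0. Qed.

Lemma jnormS n f x : jnorm n f x <= jnorm n.+1 f x.
Proof.
elim: n f => [|n IH] f; first by rewrite /= lerD2l addr_ge0.
by have := IH (derive1 f); rewrite [X in _ -> X]/= => H; rewrite lerD2l.
Qed.

Lemma derive1n_jnorm n k f x : (k <= n)%N -> `|derive1n k f x| <= jnorm n f x.
Proof.
elim: n k f => [|n IH] [|k] f //; try by move=> _; exact: jnorm_ge.
move=> kn; rewrite /derive1n iterSr; apply: le_trans (IH k _ kn) _.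
by rewrite /= lerDr.
Qed.

Lemma jnorm_cst n c x : jnorm n (fun=> c) x = `|c|.
Proof.
elim: n c => [|n IH] c /=; first by rewrite addr0.
by rewrite derive1_cst_fun IH normr0 addr0.
Qed.

Lemma jnormD n A f g x : open A -> A x -> smooth n A f -> smooth n A g ->
  jnorm n (f \+ g) x <= jnorm n f x + jnorm n g x.
Proof.
move=> oA Ax; elim: n f g => [|n IH] f g sf sg.
  by rewrite /= !addr0 ler_normD.
have E := derive1D_on (smooth1 sf) (smooth1 sg).
rewrite [jnorm _ _ _]/= (jnorm_eq n oA E Ax) [leRHS]/= addrACA.
by apply: lerD; [exact: ler_normD | exact: IH sf.2 sg.2].
Qed.

(** With E = 2^n, a = |f x|, b = |g x| and F, G the jet norms of order n + 1, Leibniz and induction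
    bound the derivative by E ((F - a) G + F (G - b)). The remaining value a b is absorbed by -E a
    G, which leaves 2 E F G. *)
Lemma jnormM n A f g x : open A -> A x -> smooth n A f -> smooth n A g ->
  jnorm n (f \* g) x <= 2 ^+ n * (jnorm n f x * jnorm n g x).
Proof.
move=> oA Ax; elim: n f g => [|n IH] f g sf sg.
  by rewrite /= !addr0 expr0 mul1r normrM.
have E := derive1M_on (smooth1 sf) (smooth1 sg).
rewrite [X in X <= _]/= (jnorm_eq n oA E Ax) normrM.
have s1 : smooth n A ((derive1 f) \* g) by apply: smoothM => //; [exact: sf.2 | exact: smoothW].
have s2 : smooth n A (f \* (derive1 g)) by apply: smoothM => //; [exact: smoothW | exact: sg.2].
have H := jnormD oA Ax s1 s2.
have H1 := IH _ _ sf.2 (smoothW sg).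
have H2 := IH _ _ (smoothW sf) sg.2.
have F1 := jnormS n f x; have G1 := jnormS n g x.
have fx := jnorm_ge n.+1 f x; have gx := jnorm_ge n.+1 g x.
have a0 := normr_ge0 (f x); have b0 := normr_ge0 (g x).
have E1 : 1 <= (2 : R) ^+ n by rewrite exprn_ege1// ler1n.
rewrite exprS.
have jg0 := jnorm_ge0 n g x; have jf0 := jnorm_ge0 n f x.
move: F1 G1 fx gx H H1 H2 E1 a0 b0 jg0 jf0; rewrite [jnorm n (derive1 f) x](_ : _ = jnorm n.+1 f x - `|f x|);
  last by rewrite [jnorm n.+1 _ _]/= addrC addKr.
rewrite [jnorm n (derive1 g) x](_ : _ = jnorm n.+1 g x - `|g x|);
  last by rewrite [jnorm n.+1 _ _]/= addrC addKr.
clear E sf sg s1 s2.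
move: (jnorm n.+1 f x) (jnorm n.+1 g x) (jnorm n f x) (jnorm n g x) (2 ^+ n).
move: (jnorm n _ x) (jnorm n _ x) (jnorm n _ x) `|f x| `|g x|.
move=> j j1 j2 a b F G F' G' E FF GG aF bG Hj H1 H2 E1 a0 b0 G0 F0.
have K1 : (F - a) * G' <= (F - a) * G by rewrite ler_wpM2l// subr_ge0.
have K2 : F' * (G - b) <= F * (G - b) by rewrite ler_wpM2r// subr_ge0.
have K3 : E * ((F - a) * G') <= E * ((F - a) * G) by rewrite ler_wpM2l// (le_trans _ E1).
have K4 : E * (F' * (G - b)) <= E * (F * (G - b)) by rewrite ler_wpM2l// (le_trans _ E1).
have K5 : a * b <= a * G by rewrite ler_wpM2l.
have aG : 0 <= a * G by rewrite mulr_ge0// (le_trans b0).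
have K6 : a * G <= E * (a * G) by rewrite ler_peMl.
have K7 : 0 <= E * (F * b) by rewrite !mulr_ge0// ?(le_trans a0 aF)// (le_trans ler01 E1).
lra.
Qed.

End Smooth.

(** * Smoothness of Gamma on the positive axis *)

Section GammaSmooth.
Variable R : realType.
Local Open Scope classical_set_scope.
Local Notation mu := (@lebesgue_measure R).

Definition log_gamma_integrand k (s t : R) : R :=
  ln t ^+ k * (t `^ (s - 1) * expR (- t)).

(* The k-th derivative of Gamma under the integral sign, dominated only for
   s > k + 1; the functional equation then carries smoothness to all s > 0. *)
Definition log_gamma k (s : R) : R :=
  \int[mu]_(t in `]0, +oo[) log_gamma_integrand k s t.

Lemma log_gamma_integrand_measurable k s (A : set R) :
  measurable_fun A (log_gamma_integrand k s).
Proof.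
apply/measurable_funTS/measurable_funM.
  by apply: measurable_funX; exact: measurable_ln.
apply: measurable_funM; first exact: measurable_powR.
exact: continuous_measurable_fun (@expRN_continuous R).
Qed.

(** Only half of the exponential is spent on the power, so that exp(-t/2) remains as an integrable
    majorant. *)
Lemma powR_le_exp_half (s t : R) (m : nat) : s <= m%:R -> 1 <= t ->
  t `^ s <= 2 ^+ m * m`!%:R * expR (t / 2).
Proof.
move=> sm t1; apply: le_trans (ler_powR t1 sm) _.
have t0 : 0 <= t by apply: le_trans t1.
rewrite powR_mulrn//.
have := @expR_ge_pow R m (t / 2); rewrite divr_ge0// => /(_ isT).
rewrite ler_pdivrMr ?ltr0n ?fact_gt0// expr_div_n ler_pdivrMr ?exprn_gt0//.
by move=> H; apply: le_trans H _; rewrite [leRHS](_ : _ = expR (t / 2) * m`!%:R * 2 ^+ m)//; ring.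
Qed.

Lemma ln_norm_le (t : R) : 0 < t -> t <= 1 -> `|ln t| <= t^-1.
Proof.
move=> t0 t1; rewrite ler0_norm ?ln_le0// -lnV ?posrE//.
by apply: ltW; apply: ln_sublinear; rewrite invr_gt0.
Qed.

(** Near 0 the bound |ln t| <= 1/t costs k powers of t, which s - 1 > N >= k pays for; beyond 1, ln
    t < t raises the exponent to at most N + M. The majorant depends on N and M only, hence is
    uniform in s. *)
Lemma log_gamma_dominated (N M k : nat) (s t : R) : (k <= N)%N ->
  N%:R + 1 < s -> s < M%:R -> 0 < t ->
  `|log_gamma_integrand k s t| <=
    (1 + 2 ^+ (N + M) * (N + M)`!%:R) * expR (- (t / 2)).
Proof.
move=> kN Ns sM t0; rewrite /log_gamma_integrand normrM normrX.
rewrite [X in _ * X]ger0_norm ?mulr_ge0 ?powR_ge0 ?expR_ge0//.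
have e2 : expR (- t) = expR (- (t / 2)) * expR (- (t / 2)).
  by rewrite -expRD; congr expR; lra.
have e1 : expR (- (t / 2)) <= 1 by rewrite expR_le1 oppr_le0 divr_ge0// ltW.
have e0 := expR_ge0 (- (t / 2)).
have kN' : (k%:R : R) <= N%:R by rewrite ler_nat.
have [t1|t1] := leP t 1.
- have H1 : `|ln t| ^+ k * t `^ (s - 1) <= 1.
    apply: (@le_trans _ _ (t^-1 ^+ k * t `^ (s - 1))).
      rewrite ler_wpM2r ?powR_ge0// lerXn2r ?nnegrE ?invr_ge0 ?(ltW t0)//.
      exact: ln_norm_le.
    rewrite exprVn -powR_mulrn ?(ltW t0)// -powRN -powRD; last first.
      by rewrite (gt_eqF t0) implybT.
    apply: le_trans (_ : t `^ 0 <= 1); last by rewrite powRr0.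
    apply: ger_powR; first by rewrite t0.
    lra.
  rewrite mulrA e2 mulrA ler_wpM2r//.
  apply: (@le_trans _ _ 1); last by rewrite lerDl !mulr_ge0.
  apply: le_trans H1; rewrite ler_piMr// mulr_ge0 ?powR_ge0// exprn_ge0//.
- have t1' := ltW t1.
  have H1 : `|ln t| ^+ k * t `^ (s - 1) <=
      2 ^+ (N + M) * (N + M)`!%:R * expR (t / 2).
    apply: (@le_trans _ _ (t ^+ k * t `^ (s - 1))).
      rewrite ler_wpM2r ?powR_ge0// lerXn2r ?nnegrE ?(ltW t0)//.
      by rewrite ger0_norm ?ln_ge0// ltW// ln_sublinear.
    rewrite -powR_mulrn ?(ltW t0)// -powRD; last by rewrite (gt_eqF t0) implybT.
    apply: powR_le_exp_half => //; rewrite natrD; lra.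
  rewrite mulrA e2 mulrA ler_wpM2r//.
  have -> : 1 + 2 ^+ (N + M) * (N + M)`!%:R =
    1 + 2 ^+ (N + M) * (N + M)`!%:R * expR (t / 2) * expR (- (t / 2)) :> R.
    by rewrite -mulrA -expRD subrr expR0 mulr1.
  apply: (@le_trans _ _ (2 ^+ (N + M) * (N + M)`!%:R * expR (t / 2) * expR (- (t / 2)))).
    by rewrite ler_wpM2r.
  by rewrite lerDr.
Qed.

Lemma expR_half_continuous : continuous (fun t : R => expR (- (t / 2))).
Proof.
move=> t; apply: (@continuous_comp _ _ _ (fun t : R => t / 2) (fun t => expR (- t))).
  exact: mulrr_continuous.
exact: expRN_continuous.
Qed.

Lemma expR_half_integrable :
  mu.-integrable `]0, +oo[ (fun t => (expR (- (t / 2)) : R)%:E).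
Proof.
apply/integrableP; split.
  apply/measurable_EFinP/measurable_funTS.
  exact: continuous_measurable_fun expR_half_continuous.
under eq_integral do rewrite /= ger0_norm ?expR_ge0//.
rewrite integral_itv_obnd_cbnd; last first.
  apply/measurable_EFinP/measurable_funTS.
  exact: continuous_measurable_fun expR_half_continuous.
have dF (t : R) : is_derive t 1 (fun t => - 2 * expR (- (t / 2))) (expR (- (t / 2))).
  have H1 : is_derive t 1 (fun t : R => 2^-1 * t + 0) (2^-1).
    have := is_deriveD (is_deriveZ 2^-1 (is_derive_id t 1)) (is_derive_cst (0 : R) t 1).
    by move=> H; apply: is_derive_eq H _; rewrite addr0 /GRing.scale/= mulr1.
  have H2 := @is_derive1_comp _ (fun t : R => - expR (- t)) _ t _ _ (is_derive_expRN (2^-1 * t + 0)) H1.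
  have H3 := is_deriveZ 2 H2.
  have E : (2 \*: ((fun t : R => - expR (- t)) \o (fun t : R => 2^-1 * t + 0))) = (fun t => - 2 * expR (- (t / 2))).
    apply/funext => u /=; rewrite addr0 /GRing.scale/= (mulrC _ u); lra.
  rewrite -E; apply: is_derive_eq H3 _.
  by rewrite addr0 /GRing.scale/= (mulrC 2^-1 t); lra.
have cF : continuous (fun t : R => - 2 * expR (- (t / 2))).
  by move=> t; apply/differentiable_continuous/derivable1_diffP; have [] := dF t.
rewrite (@ge0_continuous_FTC2y _ _ (fun t => - 2 * expR (- (t / 2))) _ 0).
- by rewrite -EFinB ltry.
- by move=> t _; exact: expR_ge0.
- exact: continuous_subspaceT expR_half_continuous.
- rewrite -[X in _ --> X](mulr0 (- 2 : R)); apply: cvgMr.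
  apply: (@cvg_comp _ _ _ (fun t : R => t / 2) (fun t => expR (- t)) _ (pinfty_nbhs R)); last exact: cvgr_expR.
  by apply: gt0_cvgMly.
- by move=> t _; have [] := dF t.
- by apply: cvg_at_right_filter; exact: cF.
- by move=> t _; rewrite derive1E; have [_] := dF t.
Qed.

Lemma log_gamma_integrand_derive k (s t : R) : 0 < t ->
  is_derive s 1 (log_gamma_integrand k ^~ t) (log_gamma_integrand k.+1 s t).
Proof.
move=> t0; have H1 : is_derive s 1 (fun s : R => ln t * s + - ln t) (ln t).
  have := is_deriveD (is_deriveZ (ln t) (is_derive_id s 1)) (is_derive_cst (- ln t) s 1).
  by move=> H; apply: is_derive_eq H _; rewrite addr0 /GRing.scale/= mulr1.
have H2 := @is_derive1_comp _ expR _ s _ _ (is_derive_expR (ln t * s + - ln t)) H1.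
have H3 := is_deriveZ (ln t ^+ k * expR (- t)) H2.
have e (u : R) : expR (ln t * u + - ln t) = t `^ (u - 1).
  by rewrite /powR gt_eqF//; congr expR; ring.
have E : (ln t ^+ k * expR (- t)) \*: (expR \o (fun s : R => ln t * s + - ln t))
   = (log_gamma_integrand k ^~ t).
  by apply/funext => u /=; rewrite e /log_gamma_integrand /GRing.scale/=; ring.
rewrite -E; apply: is_derive_eq H3 _.
by rewrite e /log_gamma_integrand /GRing.scale/= exprS; ring.
Qed.

(** Each differentiation under the integral sign trades one order of smoothness for one power of ln
    t, so n + k does not grow and the domination stays valid. *)
Lemma smooth_log_gamma (n k N M : nat) : (n + k <= N)%N ->
  smooth n `]N%:R + 1, M%:R[ (log_gamma k).
Proof.
elim: n k => [//|n IH] k nkN.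
have kN : (k <= N)%N by lia.
have kN1 : (k.+1 <= N)%N by lia.
pose C := (1 + 2 ^+ (N + M) * (N + M)`!%:R) : R.
pose G (t : R) := C * expR (- (t / 2)).
have C0 : 0 <= C by rewrite addr_ge0// mulr_ge0.
have iG : mu.-integrable `]0, +oo[ (EFin \o G).
  have -> : EFin \o G = (fun t => C%:E * (expR (- (t / 2)))%:E)%E by [].
  by apply: integrableZl => //; exact: expR_half_integrable.
have intf j (s : R) : (j <= N)%N -> `]N%:R + 1, M%:R[%classic s ->
    mu.-integrable `]0, +oo[ (EFin \o log_gamma_integrand j s).
  move=> jN; rewrite /= in_itv/= => /andP[Ns sM].
  apply: le_integrable iG => //.
    by apply/measurable_EFinP; exact: log_gamma_integrand_measurable.
  move=> t; rewrite /= in_itv/= andbT => t0.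
  by rewrite lee_fin (le_trans (log_gamma_dominated jN Ns sM t0))// ler_norm.
have d1 s t : 0 < t -> (partial1of2 (log_gamma_integrand k)) s t = log_gamma_integrand k.+1 s t.
  by move=> t0; rewrite partial1of2E; have [_] := log_gamma_integrand_derive k s t0.
have derf s t : `]N%:R + 1, M%:R[%classic s -> `]0, +oo[%classic t ->
    derivable (log_gamma_integrand k ^~ t) s 1.
  move=> _; rewrite /= in_itv/= andbT => t0.
  by have [] := log_gamma_integrand_derive k s t0.
have ub s t : `]N%:R + 1, M%:R[%classic s -> `]0, +oo[%classic t ->
    `|(partial1of2 (log_gamma_integrand k)) s t| <= G t.
  rewrite /= !in_itv/= andbT => /andP[Ns sM] t0.
  by rewrite d1// log_gamma_dominated.
have G0 t : 0 <= G t by rewrite mulr_ge0 ?expR_ge0.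
split.
  move=> s As; apply: (derivable_under_integral _ As (fun s => @intf k s kN) derf G0 iG ub) => //.
apply: (@smooth_eq _ _ _ (log_gamma k.+1)); first exact: interval_open.
  move=> s As; rewrite (differentiation_under_integral _ As (fun s => @intf k s kN) derf G0 iG ub)//.
  apply: eq_Rintegral => t; rewrite inE/= in_itv/= andbT => t0.
  by rewrite d1.
by apply: IH; lia.
Qed.

Lemma Gamma_log_gamma0 : @Gamma R = log_gamma 0.
Proof.
apply/funext => s; rewrite /Gamma /log_gamma /log_gamma_integrand.
by apply: eq_Rintegral => t _; rewrite expr0 mul1r.
Qed.

(** Descending induction on the left end j, from n + 1 to 0: Gamma(s) = Gamma(s + 1) / s brings
    smoothness from ]j + 1, k + 1[ to ]j, k[. *)
Lemma smooth_Gamma (n M : nat) : smooth n `]0, M%:R[ (@Gamma R).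
Proof.
suff H j (k : nat) : (j <= n.+1)%N -> smooth n `]j%:R, k%:R[ (@Gamma R) by exact: (H 0%N).
elim: {j}(n.+1 - j)%N {-2}j (erefl (n.+1 - j)%N) k => [|d IH] j dj k jn.
  have -> : j = n.+1 by lia.
  by rewrite Gamma_log_gamma0 -addn1 natrD; apply: smooth_log_gamma; rewrite addn0.
have sG : smooth n `]j.+1%:R, k.+1%:R[ (@Gamma R) by apply: IH; lia.
have oA : open (`]j%:R : R, k%:R[%classic : set R) by exact: interval_open.
have pos (s : R) : `]j%:R, k%:R[%classic s -> 0 < s.
  by rewrite /= in_itv/= => /andP[+ _]; apply: le_lt_trans.
apply: (@smooth_eq _ _ _ ((fun s => Gamma (1 * s + 1)) \* (fun s => s^-1))) => //.
  by move=> s /pos s0; rewrite /= mul1r Gamma_rec// mulrC mulKf// gt_eqF.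
apply: smoothM => //.
  apply: (smooth_affine oA _ sG) => s; rewrite /= !in_itv/= mul1r.
  by rewrite -!natr1 !ltrD2r.
apply: smoothV => //; last exact: smooth_id.
by move=> s /pos /gt_eqF ->.
Qed.

End GammaSmooth.

(** * Geometric bounds for the coefficients of w(x, p) and their derivatives at p = 0 *)

Section GammaCoefficients.
Variable R : realType.
Local Open Scope classical_set_scope.
Implicit Types A : set R.

Definition period_coef (n : nat) (p : R) : R :=
  Gamma (1 + 5 * (n%:R + p)) / Gamma (1 + (n%:R + p)) ^+ 5.

(* The quotient (5(n + p) + i + 1) / (n + 1 + p) of factors of
   Gamma(1 + 5(n + 1 + p)) / Gamma(1 + 5(n + p)) and of (n + 1 + p)^5, in a form
   bounded uniformly in n. *)
Definition period_factor (n i : nat) (p : R) : R :=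
  5 - (4 - i%:R) * (n.+1%:R + p)^-1.

Definition period_ratio (n : nat) (p : R) : R := \prod_(i < 5) period_factor n i p.

Lemma Gamma_add5 (s : R) : 0 < s ->
  Gamma (s + 5) = (\prod_(i < 5) (s + i%:R)) * Gamma s.
Proof.
move=> s0.
have e : s + 5 = s + 1 + 1 + 1 + 1 + 1 by ring.
rewrite e !Gamma_rec//; try lra.
rewrite !big_ord_recl big_ord0 /= /bump /=.
rewrite !addr0 mulr1; ring.
Qed.

(** The bound on p keeps 1 + 5 (n + p) positive for every n, where [Gamma_rec] is applied. *)
Lemma period_coef_rec (n : nat) (p : R) : -5^-1 < p ->
  period_coef n.+1 p = period_coef n p * period_ratio n p.
Proof.
move=> p0; have n0 : 0 <= n%:R :> R by [].
have a0 : 0 < 1 + 5 * (n%:R + p) by lra.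
have b0 : 0 < 1 + (n%:R + p) by lra.
rewrite /period_coef.
have -> : 1 + 5 * (n.+1%:R + p) = 1 + 5 * (n%:R + p) + 5 by rewrite -natr1; ring.
have -> : 1 + (n.+1%:R + p) = 1 + (n%:R + p) + 1 by rewrite -natr1; ring.
rewrite Gamma_add5// Gamma_rec//.
have -> : \prod_(i < 5) (1 + 5 * (n%:R + p) + i%:R) =
  period_ratio n p * (1 + (n%:R + p)) ^+ 5.
  rewrite /period_ratio /period_factor !big_ord_recl !big_ord0 /= /bump /= -natr1.
  by field; apply/eqP; lra.
rewrite exprMn invfM; move: (Gamma (1 + (n%:R + p)) ^+ 5)^-1 => H.
have b5 : (1 + (n%:R + p)) ^+ 5 != 0 by rewrite expf_neq0// gt_eqF.
move: ((1 + (n%:R + p)) ^+ 5) b5 => b b5.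
by field.
Qed.

Lemma smooth_prod m A (F : nat -> R -> R) k : open A ->
  (forall i, smooth m A (F i)) ->
  smooth m A (fun p => \prod_(i < k) F i p).
Proof.
move=> oA sF; elim: k => [|k IH].
  by under eq_fun do rewrite big_ord0; exact: smooth_cst.
by under eq_fun do rewrite big_ord_recr /=; exact: smoothM.
Qed.

Lemma jnorm_prod m A (F : nat -> R -> R) (D x : R) k : open A -> A x ->
  (forall i, smooth m A (F i)) -> (forall i, (i < k)%N -> jnorm m (F i) x <= D) ->
  jnorm m (fun p => \prod_(i < k) F i p) x <= (2 ^+ m * D) ^+ k.
Proof.
move=> oA Ax sF; elim: k => [|k IH] FD.
  under eq_fun do rewrite big_ord0.
  by rewrite jnorm_cst normr1 expr0.
under eq_fun do rewrite big_ord_recr /=.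
have := jnormM oA Ax (smooth_prod k oA sF) (sF k).
move=> /le_trans; apply; rewrite mulrCA exprSr.
apply: ler_pM; rewrite ?mulr_ge0 ?jnorm_ge0 ?exprn_ge0//.
  by apply: IH => i ik; apply: FD; exact: ltnW.
by rewrite ler_pM2l ?exprn_gt0// FD.
Qed.

Lemma smooth_shift_inv m A (c : R) : open A -> (forall y, A y -> c + y != 0) ->
  smooth m A (fun p => (c + p)^-1).
Proof.
move=> oA c0; apply: smoothV => //.
exact: smoothD oA (smooth_cst _ _ c) (smooth_id _ _).
Qed.

(** The derivative of 1/(c + p) is minus its own square, so the induction on m closes through
    [jnormM] with constants independent of c; c >= 1 enters only through the value 1/c <= 1. *)
Lemma jnorm_shift_inv m : exists2 B : R, 0 <= B & forall A (c : R),
  open A -> A 0 -> (forall y, A y -> c + y != 0) -> 1 <= c ->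
  jnorm m (fun p => (c + p)^-1) 0 <= B.
Proof.
elim: m => [|m [B B0 IH]].
  exists 1 => // A c _ _ _ c1.
  rewrite /= !addr0 ger0_norm ?invr_ge0 ?(le_trans _ c1)//.
  by rewrite invf_le1// (lt_le_trans _ c1).
exists (1 + 2 ^+ m * (1 * (2 ^+ m * (B * B)))).
  by rewrite addr_ge0// !mulr_ge0.
move=> A c oA A0 c0 c1; rewrite [X in X <= _]/= addr0.
have sI k := smooth_shift_inv k oA c0.
apply: lerD.
  rewrite ger0_norm ?invr_ge0 ?(le_trans _ c1)//.
  by rewrite invf_le1// (lt_le_trans _ c1).
have E y : A y -> derive1 (fun p => (c + p)^-1) y =
    ((fun=> -1) \* ((fun p => (c + p)^-1) \* (fun p => (c + p)^-1))) y.
  move=> Ay; have sl : smooth 1 A (fun p => c + p).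
    exact: smoothD oA (smooth_cst _ _ c) (smooth_id _ _).
  rewrite (derive1V_on c0 sl Ay) /=; congr (_ * _).
  rewrite derive1E [X in _ * X](_ : _ = 1) ?mulr1//.
  have [_ ->] := is_deriveD (is_derive_cst c y 1) (is_derive_id y 1).
  by rewrite add0r.
rewrite (jnorm_eq m oA E A0).
apply: le_trans (jnormM oA A0 (smooth_cst _ _ _) (smoothM oA (sI m) (sI m))) _.
rewrite ler_pM2l ?exprn_gt0// jnorm_cst normrN normr1 !mul1r.
apply: le_trans (jnormM oA A0 (sI m) (sI m)) _.
rewrite ler_pM2l ?exprn_gt0//.
have HB := IH A c oA A0 c0 c1.
by apply: ler_pM; rewrite ?jnorm_ge0.
Qed.

Lemma smooth_period_factor m A n i : open A -> (forall y, A y -> -1 < y) ->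
  smooth m A (period_factor n i).
Proof.
move=> oA A1.
have c0 y : A y -> n.+1%:R + y != 0.
  by move=> /A1 y1; rewrite -natr1 gt_eqF//; have : 0 <= n%:R :> R by []; lra.
apply: (@smooth_eq _ _ _ ((fun=> 5) \+ ((fun=> - (4 - i%:R)) \* (fun p => (n.+1%:R + p)^-1)))) => //.
  by move=> y _ /=; rewrite /period_factor mulNr.
apply: smoothD (smooth_cst _ _ _) (smoothM _ (smooth_cst _ _ _) _) => //.
exact: smooth_shift_inv.
Qed.

Lemma jnorm_period_ratio m A : open A -> A 0 -> (forall y, A y -> -1 < y) ->
  exists2 M : R, 0 <= M & forall n, jnorm m (period_ratio n) 0 <= M.
Proof.
move=> oA A0 A1; have [B B0 HB] := jnorm_shift_inv m.
exists ((2 ^+ m * (5 + 2 ^+ m * (4 * B))) ^+ 5).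
  by rewrite exprn_ge0// mulr_ge0// addr_ge0// !mulr_ge0.
move=> n; have c0 y : A y -> n.+1%:R + y != 0.
  by move=> /A1 y1; rewrite -natr1 gt_eqF//; have : 0 <= n%:R :> R by []; lra.
apply: (jnorm_prod oA A0 (fun i => smooth_period_factor m n i oA A1)) => i i5.
have E y : A y -> period_factor n i y =
   ((fun=> 5) \+ ((fun=> - (4 - i%:R)) \* (fun p => (n.+1%:R + p)^-1))) y.
  by move=> _ /=; rewrite /period_factor mulNr.
rewrite (jnorm_eq m oA E A0).
have sI := smooth_shift_inv m oA c0.
have sM := smoothM oA (smooth_cst m A (- (4 - i%:R))) sI.
apply: le_trans (jnormD oA A0 (smooth_cst _ _ _) sM) _.
rewrite jnorm_cst ger0_norm// lerD2l.
apply: le_trans (jnormM oA A0 (smooth_cst _ _ _) sI) _.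
rewrite ler_pM2l ?exprn_gt0// jnorm_cst normrN.
have i4 : (i%:R : R) <= 4 by rewrite ler_nat.
have i0 : 0 <= (i%:R : R) by [].
apply: ler_pM; rewrite ?jnorm_ge0//; last by apply: (HB A) => //; rewrite ler1n.
rewrite ger0_norm; lra.
Qed.

(** The neighbourhood comes from continuity at 1, where Gamma is 1. The cap 1/10 keeps p above -1/5,
    as in [period_coef_rec], and 1 + 5 p inside ]0, 2[. *)
Lemma Gamma_neq0_near1 : exists2 d : R, 0 < d <= 10^-1 &
  forall p, `]-d, d[%classic p -> Gamma (1 + p) != 0.
Proof.
have : {for 1, continuous (@Gamma R)}.
  apply/differentiable_continuous/derivable1_diffP.
  have [H _] := smooth_Gamma R 1 2; apply: H.
  by rewrite /= in_itv/=; lra.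
move=> /cvgrPdist_lt /(_ (1 : R) ltr01) /nbhs_ballP[e /= e0 He].
exists (Num.min e 10^-1).
  by rewrite lt_min e0 ge_min lexx orbT andbT /= invr_gt0.
move=> p; rewrite /= in_itv/= => pd; apply/eqP => G0.
have : ball (1 : R) e (1 + p).
  rewrite /ball/= opprD addrA subrr add0r normrN ltr_norml.
  by move: pd; rewrite -!ltr_norml lt_min => /andP[].
by move=> /He; rewrite G0 Gamma1 subr0 normr1 ltxx.
Qed.

(** Dividing by Gamma is needed only for n = 0. Each later step multiplies the 3-jet at 0 by that of
    [period_ratio], bounded uniformly in n. Order 3 is enough because J^4 = 0. *)
Lemma gamma_coef_bound : exists K M : R, [/\ 0 <= K, 0 <= M &
  forall n k, (k <= 3)%N -> `|gamma_coef R n k| <= K * M ^+ n].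
Proof.
have [d /andP[d0 d10] Gd] := Gamma_neq0_near1.
pose A : set R := `]-d, d[%classic.
have oA : open A by exact: interval_open.
have A0 : A 0 by rewrite /A/= in_itv/= oppr_lt0 d0.
have Ad y : A y -> -10^-1 < y < 10^-1.
  by rewrite /A/= in_itv/= => /andP[? ?]; apply/andP; split; lra.
have A1 y : A y -> -1 < y by move=> /Ad /andP[+ _]; lra.
have A5 y : A y -> - 5^-1 < y by move=> /Ad /andP[+ _]; lra.
have s0 m : smooth m A (period_coef 0).
  apply: (@smooth_eq _ _ _ ((fun p => Gamma (5 * p + 1)) \*
     (fun p => (Gamma (1 * p + 1) ^+ 5)^-1))) => //.
    by move=> y _ /=; rewrite /period_coef !add0r mul1r !(addrC 1).
  apply: smoothM => //.
    apply: (smooth_affine oA _ (smooth_Gamma R m 2)) => y /Ad /andP[y1 y2].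
    by rewrite /= in_itv/=; lra.
  apply: smoothV => //.
    by move=> y Ay; rewrite mul1r addrC expf_neq0// Gd.
  apply: smoothX => //.
  apply: (smooth_affine oA _ (smooth_Gamma R m 2)) => y /Ad /andP[y1 y2].
  by rewrite /= in_itv/=; lra.
have E n y : A y -> period_coef n.+1 y = (period_coef n \* period_ratio n) y.
  by move=> /A5 y5; rewrite period_coef_rec.
have sr m n : smooth m A (period_ratio n).
  by apply: smooth_prod => // i; exact: smooth_period_factor.
have s m n : smooth m A (period_coef n).
  elim: n => [|n IH]; first exact: s0.
  apply: (smooth_eq oA (fun y Ay => esym (E n y Ay))).
  exact: smoothM.
have [M M0 HM] := jnorm_period_ratio 3 oA A0 A1.
exists (jnorm 3 (period_coef 0) 0), (2 ^+ 3 * M); split.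
- exact: jnorm_ge0.
- by rewrite mulr_ge0.
move=> n k k3; apply: (@le_trans _ _ (jnorm 3 (period_coef n) 0)).
  rewrite /gamma_coef normrM.
  apply: le_trans (derive1n_jnorm _ _ k3); rewrite ler_piMr//.
  rewrite ger0_norm ?invr_ge0// invf_le1 ?ltr0n ?fact_gt0//.
  by rewrite ler1n fact_gt0.
elim: n => [|n IH]; first by rewrite expr0 mulr1.
rewrite (jnorm_eq 3 oA (E n) A0).
apply: le_trans (jnormM oA A0 (s _ _) (sr _ _)) _.
rewrite [leLHS]mulrCA [in leRHS]exprSr [leRHS]mulrA.
apply: ler_pM; rewrite ?mulr_ge0 ?jnorm_ge0//.
by rewrite ler_pM2l// HM.
Qed.

Lemma gamma_coef00 : gamma_coef R 0 0 = 1.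
Proof.
rewrite /gamma_coef /derive1n /= !addr0 mulr0 addr0 Gamma1.
by rewrite expr1n fact0 !divr1.
Qed.

End GammaCoefficients.

(** * Asymptotics of the period *)

(* Row n %% 5 lists the coefficients on 1, J, J^2, J^3 of ch(tau^(-n) O_X),
   which is periodic in n because tau^5 = [2]. *)
Definition tau_lattice (F : numFieldType) (n j : nat) : F :=
  nth 0 (nth [::] [:: [:: 1]; [:: -4; -1; 1 / 2; - (1 / 6)];
    [:: 6; 3; - (1 / 2); - (1 / 2)]; [:: -4; -3; - (1 / 2); 1 / 2];
    [:: 1; 1; 1 / 2; 1 / 6]] (n %% 5)) j.

Lemma lt4P (P : nat -> Prop) : P 0%N -> P 1%N -> P 2%N -> P 3%N ->
  forall j, (j < 4)%N -> P j.
Proof. by move=> P0 P1 P2 P3 [|[|[|[|m]]]]. Qed.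

Lemma tau_lattice_mod (F : numFieldType) n j :
  tau_lattice F (n %% 5) j = tau_lattice F n j.
Proof. by rewrite /tau_lattice modn_mod. Qed.

(** * Coefficients in C[J]/J^4 and the action of tau on Chern characters *)

Section HevCoefficients.
Variable R : realType.
Local Notation C := R[i].
Implicit Types u v : Hev R.

Definition hcoef v (j : nat) : C := (v : {poly C})`_j.

Lemma hev_modulus : mk_monic ('X^4 : {poly C}) = 'X^4 :> {poly C}.
Proof. exact: mk_monic_Xn. Qed.

Lemma hcoef_ge4 v j : (4 <= j)%N -> hcoef v j = 0.
Proof. by move=> j4; apply: big_coef_npoly; rewrite hev_modulus size_polyXn. Qed.

Lemma hcoefP u v : (forall j, (j < 4)%N -> hcoef u j = hcoef v j) -> u = v.
Proof.
move=> H; apply/npolyP => j; have [/H //|j4] := ltnP j 4.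
by rewrite -!/(hcoef _ _) !hcoef_ge4.
Qed.

Lemma hcoefD u v j : hcoef (u + v) j = hcoef u j + hcoef v j.
Proof. by rewrite /hcoef coefD. Qed.

Lemma hcoefB u v j : hcoef (u - v) j = hcoef u j - hcoef v j.
Proof. by rewrite /hcoef coefB. Qed.

Lemma hcoefZ (a : C) v j : hcoef (a *: v) j = a * hcoef v j.
Proof. by rewrite /hcoef coefZ. Qed.

Lemma hcoef0 j : hcoef 0 j = 0.
Proof. by rewrite /hcoef coef0. Qed.

Lemma hcoef_sum (I : Type) (r : seq I) (P : pred I) (F : I -> Hev R) j :
  hcoef (\sum_(i <- r | P i) F i) j = \sum_(i <- r | P i) hcoef (F i) j.
Proof.
by elim/big_rec2: _ => [|i x v _ <-]; rewrite ?hcoef0// hcoefD.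
Qed.

Lemma hcoefM u v j : (j < 4)%N ->
  hcoef (u * v) j = \sum_(i < j.+1) hcoef u i * hcoef v (j - i).
Proof.
move=> j4; rewrite /hcoef poly_of_qpolyM -coefM.
move: (polyn u) (polyn v) => p q; rewrite hev_modulus.
rewrite [in RHS](Pdiv.RingMonic.rdivp_eq (monicXn C 4) (p * q)).
by rewrite coefD coefMXn j4 add0r.
Qed.

Lemma hcoef1 j : hcoef 1 j = (j == 0)%:R.
Proof. by rewrite /hcoef coefC; case: j. Qed.

Lemma hcoefJ j : hcoef (J R) j = (j == 1)%:R.
Proof.
rewrite /hcoef /J qpolyXE ?coefX ?size_polyXn//; exact: monicXn.
Qed.

Lemma hcoefJX k j : (j < 4)%N -> hcoef (J R ^+ k) j = (j == k)%:R.
Proof.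
elim: k j => [|k IH] j j4; first by rewrite expr0 hcoef1.
rewrite exprS hcoefM//; case: j j4 => [|j] j4.
  by rewrite big_ord1 hcoefJ mul0r.
rewrite (bigD1 (inord 1)) //= inordK// hcoefJ eqxx mul1r subSS subn0.
rewrite IH ?(ltnW j4)// eqSS big1 ?addr0// => i /eqP i1.
rewrite hcoefJ; case: eqP => [e|_]; last by rewrite mul0r.
by case: i1; apply: val_inj; rewrite /= e inordK.
Qed.

Lemma hcoef_hexpZ (a : C) j : (j < 4)%N ->
  hcoef (hexp (a *: J R)) j = a ^+ j / (j`!)%:R.
Proof.
move=> j4; rewrite /hexp hcoef_sum (bigD1 (Ordinal j4))//=.
rewrite hcoefZ exprZn hcoefZ hcoefJX// eqxx mulr1 mulrC big1 ?addr0// => i /eqP ij.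
rewrite hcoefZ exprZn hcoefZ hcoefJX//; case: eqP => [e|_]; last by rewrite !mulr0.
by case: ij; apply: val_inj.
Qed.

Lemma hcoef_hexpJ j : (j < 4)%N -> hcoef (hexp (J R)) j = (j`!)%:R^-1.
Proof. by move=> j4; rewrite -{1}[J R]scale1r hcoef_hexpZ// expr1n mul1r. Qed.

Lemma hcoef_todd j : (j < 4)%N ->
  hcoef (todd_X R) j = (j == 0)%:R + 5 / 6 * (j == 2)%:R.
Proof. by move=> j4; rewrite /todd_X hcoefD hcoef1 hcoefZ hcoefJX. Qed.

Lemma hcoefM0 u v : hcoef (u * v) 0 = hcoef u 0 * hcoef v 0.
Proof. by rewrite hcoefM// big_ord1. Qed.
Lemma hcoefM1 u v : hcoef (u * v) 1 = hcoef u 0 * hcoef v 1 + hcoef u 1 * hcoef v 0.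
Proof. by rewrite hcoefM// !big_ord_recl big_ord0 addr0. Qed.
Lemma hcoefM2 u v : hcoef (u * v) 2 =
  hcoef u 0 * hcoef v 2 + hcoef u 1 * hcoef v 1 + hcoef u 2 * hcoef v 0.
Proof. by rewrite hcoefM// !big_ord_recl big_ord0 addr0 !addrA. Qed.
Lemma hcoefM3 u v : hcoef (u * v) 3 =
  hcoef u 0 * hcoef v 3 + hcoef u 1 * hcoef v 2 + hcoef u 2 * hcoef v 1 +
  hcoef u 3 * hcoef v 0.
Proof. by rewrite hcoefM// !big_ord_recl big_ord0 addr0 !addrA. Qed.

Lemma integral_todd v :
  integral_X (v * todd_X R) = 5 * (hcoef v 3 + 5 / 6 * hcoef v 1).
Proof.
by rewrite /integral_X -/(hcoef _ 3) hcoefM3 !hcoef_todd//=; field.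
Qed.

Lemma quintic_periodE (l : C) v : quintic_period l v =
  5 * (hcoef v 0 * (hcoef (w_X l) 3 + 5 / 6 * hcoef (w_X l) 1) +
       hcoef v 1 * (hcoef (w_X l) 2 + 5 / 6 * hcoef (w_X l) 0) +
       hcoef v 2 * hcoef (w_X l) 1 + hcoef v 3 * hcoef (w_X l) 0).
Proof.
by rewrite /quintic_period integral_todd hcoefM3 hcoefM1; field.
Qed.

Lemma tau_lattice_real n j : (tau_lattice R n j)%:C%C = tau_lattice C n j.
Proof.
rewrite -[LHS]/(real_complex R _) /tau_lattice.
by move: (n %% 5)%N => [|[|[|[|[|m]]]]]; move: j => [|[|[|[|j]]]];
 rewrite /= ?nth_nil ?rmorphN ?rmorphM ?fmorphV ?rmorph_nat ?rmorph1 ?rmorph0.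
Qed.

(** Dividing by exp(J) recovers v - c, with c the Euler characteristic of v, hence the coefficients
    of v on J, J^2, J^3. These determine c = 5 (v_3 + 5/6 v_1), which does not involve v_0, and then
    v_0 as well. *)
Lemma tau_lattice_step n v :
  (forall j, (j < 4)%N ->
    hcoef (hexp (J R) * (v - integral_X (v * todd_X R) *: 1)) j =
    tau_lattice C n j) ->
  forall j, (j < 4)%N -> hcoef v j = tau_lattice C n.+1 j.
Proof.
move=> H.
have /(_ isT) := H 3%N; have /(_ isT) := H 2%N; have /(_ isT) := H 1%N; have /(_ isT) := H 0%N.
rewrite integral_todd hcoefM0 hcoefM1 hcoefM2 hcoefM3 !hcoefB !hcoefZ !hcoef1 !hcoef_hexpJ//=.
rewrite /= !mulr0 !subr0 !mulr1 !factS fact0 /= {H}.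
set c := 5 * _ => H0 H1 H2 H3.
have E1 : hcoef v 1 = tau_lattice C n 1 - tau_lattice C n 0.
  by rewrite -H0 -H1; field.
have E2 : hcoef v 2 = tau_lattice C n 2 - tau_lattice C n 1 + tau_lattice C n 0 / 2.
  by rewrite -H0 -H1 -H2; field.
have E3 : hcoef v 3 = tau_lattice C n 3 - hcoef v 2 - hcoef v 1 / 2 - tau_lattice C n 0 / 6.
  by rewrite -H3 -H0; field.
have E0 : hcoef v 0 = tau_lattice C n 0 + 5 * (hcoef v 3 + 5 / 6 * hcoef v 1).
  by rewrite -H0 -/c; field.
move: E0 E1 E2 E3 {H0 H1 H2 H3 c}.
rewrite -!(tau_lattice_mod _ n) => E0 E1 E2 E3 j j4.
rewrite -(tau_lattice_mod _ n.+1) -addn1 -modnDml.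
have : (n %% 5 < 5)%N by rewrite ltn_mod.
move: (n %% 5)%N E0 E1 E2 E3 => [|[|[|[|[|m]]]]]//; rewrite /tau_lattice /= => E0 E1 E2 E3 _;
  elim/lt4P: j4 => /=; rewrite ?E0 ?E3 ?E2 ?E1; by field.
Qed.
End HevCoefficients.

(** * Estimates for w(x, J / (2 pi i)) near x = 0 *)

Section PeriodAsymptotics.
Variable R : realType.
Local Notation C := R[i].
Local Notation Re := complex.Re.
Local Notation Im := complex.Im.
Implicit Types (z w l : C).

(** Unlike the norm of R[i] it takes values in R, where limits and linear arithmetic are available,
    and it is submultiplicative with constant 1. *)
Definition nrm z : R := `|Re z| + `|Im z|.

Lemma nrm_ge0 z : 0 <= nrm z.
Proof. by rewrite addr_ge0. Qed.

Lemma nrm_Re z : `|Re z| <= nrm z.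
Proof. by rewrite lerDl. Qed.

Lemma nrm_Im z : `|Im z| <= nrm z.
Proof. by rewrite lerDr. Qed.

Lemma ReM z w : Re (z * w) = Re z * Re w - Im z * Im w.
Proof. by case: z w => [a b] [c d]. Qed.

Lemma ImM z w : Im (z * w) = Re z * Im w + Im z * Re w.
Proof. by case: z w => [a b] [c d]. Qed.

Lemma ReD z w : Re (z + w) = Re z + Re w.
Proof. by case: z w => [a b] [c d]. Qed.

Lemma ImD z w : Im (z + w) = Im z + Im w.
Proof. by case: z w => [a b] [c d]. Qed.

Lemma nrmD z w : nrm (z + w) <= nrm z + nrm w.
Proof.
rewrite /nrm ReD ImD addrACA; exact: lerD (ler_normD _ _) (ler_normD _ _).
Qed.

Lemma nrmM z w : nrm (z * w) <= nrm z * nrm w.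
Proof.
rewrite /nrm ReM ImM mulrDl !mulrDr -!normrM.
have := ler_normB (Re z * Re w) (Im z * Im w).
have := ler_normD (Re z * Im w) (Im z * Re w).
lra.
Qed.

Lemma nrm_real (a : R) : nrm (a%:C)%C = `|a|.
Proof. by rewrite /nrm /= normr0 addr0. Qed.

Lemma nrm0 : nrm 0 = 0.
Proof. by rewrite /nrm /= normr0 addr0. Qed.

Lemma nrmX z n : nrm (z ^+ n) <= nrm z ^+ n.
Proof.
elim: n => [|n IH]; first by rewrite !expr0 /nrm /= normr0 addr0 normr1.
rewrite !exprS; apply: le_trans (nrmM _ _) _.
by rewrite ler_wpM2l ?nrm_ge0.
Qed.

Lemma nrm_sum n (F : 'I_n -> C) : nrm (\sum_i F i) <= \sum_i nrm (F i).
Proof.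
elim/big_rec2: _ => [|i y x _ IH]; first by rewrite nrm0.
by apply: le_trans (nrmD _ _) _; rewrite lerD2l.
Qed.

Lemma Re_sum n (F : nat -> C) : Re (\sum_(i < n) F i) = \sum_(i < n) Re (F i).
Proof. by elim/big_rec2: _ => [//|i y x _ <-]; rewrite ReD. Qed.

Lemma Im_sum n (F : nat -> C) : Im (\sum_(i < n) F i) = \sum_(i < n) Im (F i).
Proof. by elim/big_rec2: _ => [//|i y x _ <-]; rewrite ImD. Qed.

Lemma nrm_cexp z : nrm (cexp z) <= 2 * expR (Re z).
Proof.
rewrite /nrm /= !normrM ger0_norm ?expR_ge0// -mulrDr mulrC ler_pM2r ?expR_gt0//.
have -> : (2 : R) = 1 + 1 by [].
by apply: lerD; [exact: cos_max | exact: sin_max].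
Qed.

Definition period_log l : C := l * (0 +i* (pi *+ 2))%C^-1.

Lemma inv_2pi_i : ((0 +i* (pi *+ 2))%C^-1 : C) = (0 +i* - (pi *+ 2)^-1)%C.
Proof.
have p2 : (pi *+ 2 : R) != 0 by rewrite mulrn_eq0 /= gt_eqF ?pi_gt0.
have z0 : (0 +i* (pi *+ 2))%C != 0 :> C by rewrite eq_complex /= negb_and p2 orbT.
apply: (mulfI z0); rewrite mulfV//; apply/eqP; rewrite eq_complex ReM ImM /=.
by rewrite mulrN opprK mulfV// !(mul0r, mulr0, add0r, addr0) !eqxx.
Qed.

Lemma period_logE l : period_log l = (Im l / (pi *+ 2) +i* - (Re l / (pi *+ 2)))%C.
Proof.
by case: l => [a b]; rewrite /period_log inv_2pi_i /=; apply/eqP; rewrite eq_complex /=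
  !mulr0 ?add0r ?addr0 ?sub0r !mulrN ?opprK !eqxx.
Qed.

Lemma nrm_inv_2pi_i : nrm (0 +i* (pi *+ 2))%C^-1 <= 1.
Proof.
have p2 : 2 <= pi :> R := @pi_ge2 R.
rewrite inv_2pi_i /nrm /= normr0 add0r normrN ger0_norm ?invr_ge0.
  by rewrite invf_le1 mulr2n; lra.
by rewrite mulr2n; lra.
Qed.

Lemma hcoef_gamma_sum (g : nat -> C) i : (i < 4)%N ->
  hcoef (\sum_(k < 4) g k *: p_J R ^+ k) i = g i * (0 +i* (pi *+ 2))%C^-1 ^+ i.
Proof.
move=> i4; rewrite hcoef_sum (bigD1 (Ordinal i4))//=.
rewrite hcoefZ /p_J exprZn hcoefZ hcoefJX// eqxx mulr1 big1 ?addr0// => k /eqP ki.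
rewrite hcoefZ exprZn hcoefZ hcoefJX//; case: eqP => [e|_]; last by rewrite !mulr0.
by case: ki; apply: val_inj.
Qed.

Lemma hcoef_w_term l n j : (j < 4)%N -> hcoef (w_term l n) j =
  cexp (n%:R * l) * \sum_(k < j.+1) (gamma_coef R n k)%:C%C *
    (0 +i* (pi *+ 2))%C^-1 ^+ k * (period_log l ^+ (j - k) / ((j - k)`!)%:R).
Proof.
move=> j4; rewrite /w_term hcoefZ hcoefM//; congr (_ * _).
apply: eq_bigr => k _.
have k4 : (k < 4)%N by have := ltn_ord k; lia.
rewrite (hcoef_gamma_sum (fun k => (gamma_coef R n k)%:C%C))//.
rewrite /p_J scalerA hcoef_hexpZ//; lia.
Qed.

(** The base 1 + [nrm z] is at least 1, so that the exponents j - k can later be raised to a common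
    one. *)
Lemma nrm_term (k j : nat) (K g : R) (z : C) : (j < 4)%N -> (k <= j)%N ->
  `|g| <= K ->
  nrm ((g%:C)%C * (0 +i* (pi *+ 2))%C^-1 ^+ k * (z ^+ (j - k) / ((j - k)`!)%:R))
  <= K * (1 + nrm z) ^+ (j - k).
Proof.
move=> j4 kj gK; apply: le_trans (nrmM _ _) _.
have H1 : nrm ((g%:C)%C * (0 +i* (pi *+ 2))%C^-1 ^+ k) <= K.
  apply: le_trans (nrmM _ _) _; rewrite nrm_real.
  rewrite -[leRHS]mulr1; apply: ler_pM; rewrite ?nrm_ge0//.
  by apply: le_trans (nrmX _ _) _; rewrite exprn_ile1 ?nrm_ge0// nrm_inv_2pi_i.
apply: ler_pM; rewrite ?nrm_ge0//.
apply: le_trans (nrmM _ _) _.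
have -> : ((j - k)`!%:R^-1 : C) = (((j - k)`!%:R^-1 : R)%:C)%C.
  by rewrite -[RHS]/(real_complex R _) fmorphV rmorph_nat.
rewrite nrm_real ger0_norm ?invr_ge0//.
rewrite -[leRHS]mulr1; apply: ler_pM; rewrite ?nrm_ge0 ?invr_ge0//.
  apply: le_trans (nrmX _ _) _; rewrite lerXn2r ?nnegrE ?nrm_ge0 ?addr_ge0 ?nrm_ge0//.
  by rewrite lerDr.
by rewrite invf_le1 ?ltr0n ?ler1n fact_gt0.
Qed.

Lemma geometric_tail_le (r : R) N : 0 <= r -> r <= 2^-1 ->
  \sum_(n < N) r ^+ n.+1 <= 2 * r - 2 * r ^+ N.+1.
Proof.
move=> r0 r1; elim: N => [|N IH]; first by rewrite big_ord0 expr1 subrr.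
rewrite big_ord_recr /=.
have : r ^+ N.+2 <= 2^-1 * r ^+ N.+1 by rewrite exprS ler_wpM2r ?exprn_ge0.
lra.
Qed.

Local Open Scope classical_set_scope.

(** The majorant first yields convergence, so that [limn] is the actual sum, and then bounds
    everything after the term of index 0. *)
Lemma geometric_series_lim (u : nat -> R) (D r : R) : 0 <= D -> 0 <= r -> r <= 2^-1 ->
  (forall n, `|u n| <= D * r ^+ n) ->
  `|limn (fun N => \sum_(n < N) u n) - u 0%N| <= 2 * D * r.
Proof.
move=> D0 r0 r1 uD.
have E : (fun N => \sum_(n < N) u n) = series u.
  by apply/funext => N; rewrite /series /= big_mkord.
have cu : cvgn (series u).
  apply: normed_cvg; apply: (@series_le_cvg _ _ (geometric D r)) => //.
  - by move=> n; exact: normr_ge0.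
  - by move=> n; rewrite /geometric /= mulr_ge0// exprn_ge0.
  - apply: is_cvg_geometric_series; rewrite ger0_norm//.
    by apply: le_lt_trans r1 _; rewrite invf_lt1// ltr1n.
have bound N : `|\sum_(n < N.+1) u n - u 0%N| <= 2 * D * r.
  rewrite big_ord_recl /= addrC addKr.
  apply: le_trans (ler_norm_sum _ _ _) _.
  apply: (@le_trans _ _ (\sum_(n < N) D * r ^+ n.+1)).
    by apply: ler_sum => i _; exact: uD.
  rewrite -mulr_sumr (mulrC 2) -mulrA ler_wpM2l//.
  apply: le_trans (geometric_tail_le N r0 r1) _.
  by rewrite lerBlDr lerDl mulr_ge0// exprn_ge0.
have nb : \forall N \near \oo, `|series u N - u 0%N| <= 2 * D * r.
  exists 1%N => // -[//|N] _ /=.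
  by rewrite -(congr1 (fun f => f N.+1) E).
rewrite E ler_norml lerBrDr lerBlDr; apply/andP; split.
- apply: limr_ge => //; apply: filterS nb => N.
  by rewrite ler_norml lerBrDr => /andP[].
- apply: limr_le => //; apply: filterS nb => N.
  by rewrite ler_norml [X in _ && X]lerBlDr => /andP[].
Qed.

Lemma hcoef_w_X l j : (j < 4)%N ->
  hcoef (w_X l) j = clim (fun N => \sum_(n < N) hcoef (w_term l n) j).
Proof.
move=> j4; rewrite /w_X hcoef_sum (bigD1 (Ordinal j4))//=.
rewrite hcoefZ hcoefJX// eqxx mulr1 big1 ?addr0; last first.
  move=> k /eqP kj; rewrite hcoefZ hcoefJX//; case: eqP => [e|_]; last by rewrite mulr0.
  by case: kj; apply: val_inj.
by congr clim; apply/funext => N; rewrite -/(hcoef _ j) hcoef_sum.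
Qed.

Lemma clim_close (u : nat -> C) (D r : R) : 0 <= D -> 0 <= r -> r <= 2^-1 ->
  (forall n, nrm (u n) <= D * r ^+ n) ->
  nrm (clim (fun N => \sum_(n < N) u n) - u 0%N) <= 4 * D * r.
Proof.
move=> D0 r0 r1 uD; rewrite /nrm /clim.
have -> : (fun N => Re (\sum_(n < N) u n)) = (fun N => \sum_(n < N) Re (u n)).
  by apply/funext => N; rewrite Re_sum.
have -> : (fun N => Im (\sum_(n < N) u n)) = (fun N => \sum_(n < N) Im (u n)).
  by apply/funext => N; rewrite Im_sum.
have H1 := @geometric_series_lim (fun n => Re (u n)) D r D0 r0 r1
  (fun n => le_trans (nrm_Re _) (uD n)).
have H2 := @geometric_series_lim (fun n => Im (u n)) D r D0 r0 r1
  (fun n => le_trans (nrm_Im _) (uD n)).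
have -> : 4 * D * r = 2 * D * r + 2 * D * r by ring.
move: H1 H2; case: (u 0%N) => a b /= H1 H2; exact: lerD.
Qed.

(** The series in n has ratio M |x|, as |x| = exp(Re l). In 8 K the 2 comes from [nrm_cexp] and the
    4 counts the summands k <= j < 4; the outer 4 is that of [clim_close]. *)
Lemma w_X_close : exists D r : R, [/\ 0 <= D, 0 <= r &
  forall l j, (j < 4)%N -> r * expR (Re l) <= 2^-1 ->
  nrm (hcoef (w_X l) j - hcoef (w_term l 0) j) <=
    D * (1 + nrm (period_log l)) ^+ 3 * expR (Re l)].
Proof.
have [K [M [K0 M0 HKM]]] := gamma_coef_bound R.
exists (4 * (8 * K) * M), M; split => //; first by rewrite !mulr_ge0.
move=> l j j4 Hr; rewrite hcoef_w_X//.
set Q := (1 + nrm (period_log l)).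
have Q1 : 1 <= Q by rewrite lerDl nrm_ge0.
have Q0 : 0 <= Q by apply: le_trans Q1.
have H n : nrm (hcoef (w_term l n) j) <= (8 * K * Q ^+ 3) * (M * expR (Re l)) ^+ n.
  rewrite hcoef_w_term//; apply: le_trans (nrmM _ _) _.
  have -> : 8 * K * Q ^+ 3 * (M * expR (Re l)) ^+ n =
    (2 * expR (Re l) ^+ n) * (4 * (K * M ^+ n * Q ^+ 3)) by rewrite exprMn; ring.
  apply: ler_pM; rewrite ?nrm_ge0//.
    apply: le_trans (nrm_cexp _) _; rewrite ler_pM2l//.
    rewrite -expRM_natl ler_expR; case: (l) => a b.
    have -> : Re (n%:R * (a +i* b)%C) = n%:R * a; last by [].
    rewrite ReM; have -> : (n%:R : C) = (n%:R : R)%:C%C by rewrite -[RHS]/(real_complex R _) rmorph_nat.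
    by rewrite /= mul0r subr0.
  apply: le_trans (nrm_sum _) _.
  apply: (@le_trans _ _ (\sum_(k < j.+1) K * M ^+ n * Q ^+ 3)); last first.
    rewrite sumr_const card_ord -[leLHS]mulr_natl ler_wpM2r//.
      by rewrite !mulr_ge0 ?exprn_ge0.
    by rewrite ler_nat.
  apply: ler_sum => k _; have kj : (k <= j)%N by rewrite -ltnS.
  have k3 : (k <= 3)%N by exact: leq_trans kj _.
  apply: le_trans (@nrm_term k j _ _ (period_log l) j4 kj (HKM n k k3)) _.
  rewrite ler_wpM2l ?mulr_ge0 ?exprn_ge0// ler_weXn2l//; lia.
have := clim_close _ _ Hr H; rewrite !mulr_ge0 ?exprn_ge0 ?expR_ge0//.
move=> /(_ isT isT) /le_trans; apply; rewrite le_eqVlt; apply/orP; left; apply/eqP.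
by rewrite -/Q; ring.
Qed.

(** The summand k = 0 is exactly t^j / j! by [gamma_coef00]; each of the at most three others has
    lost a power of t. For j = 0 there are none, so the truncated exponent [j.-1] does no harm. *)
Lemma w_term0_close : exists2 K : R, 0 <= K & forall l j, (j < 4)%N ->
  nrm (hcoef (w_term l 0) j - period_log l ^+ j / (j`!)%:R) <=
    K * (1 + nrm (period_log l)) ^+ j.-1.
Proof.
have [K [M [K0 M0 HKM]]] := gamma_coef_bound R.
exists (3 * K); first by rewrite mulr_ge0.
move=> l j j4; rewrite hcoef_w_term// mul0r.
have -> : cexp (0 : C) = 1 by rewrite /cexp /= expR0 cos0 sin0 mulr1 mulr0.
rewrite mul1r big_ord_recl /= gamma_coef00 expr0 mulr1 subn0.
have -> : ((1 : R)%:C%C : C) = 1 by [].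
rewrite mul1r addrC addKr.
apply: le_trans (nrm_sum _) _.
set Q := (1 + nrm (period_log l)).
have Q1 : 1 <= Q by rewrite lerDl nrm_ge0.
have Q0 : 0 <= Q by apply: le_trans Q1.
apply: (@le_trans _ _ (\sum_(k < j) K * Q ^+ j.-1)); last first.
  rewrite sumr_const card_ord -[leLHS]mulr_natl -mulrA ler_wpM2r ?mulr_ge0 ?exprn_ge0//.
  by rewrite ler_nat.
apply: ler_sum => k _; have := ltn_ord k => kj.
have k3 : (k.+1 <= 3)%N by exact: leq_trans kj _.
have := HKM 0%N k.+1 k3; rewrite expr0 mulr1 => HK.
apply: le_trans (@nrm_term k.+1 j _ _ (period_log l) j4 kj HK) _.
rewrite ler_wpM2l// ler_weXn2l//; lia.
Qed.

End PeriodAsymptotics.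

(** * The direction in which consecutive central charges turn *)

Section PeriodPhases.
Variable R : realType.
Local Notation C := R[i].
Local Notation Re := complex.Re.
Local Notation Im := complex.Im.
Implicit Types (l : C).

(* The coefficient of J^j in w(x, J / (2 pi i)) Todd X. *)
Definition twisted_w l (j : nat) : C :=
  hcoef (w_X l) j + 5 / 6 * (if (2 <= j)%N then hcoef (w_X l) (j - 2) else 0).

Lemma ReB (z w : C) : Re (z - w) = Re z - Re w.
Proof. by case: z w => [a b] [c d]. Qed.

Lemma ImB (z w : C) : Im (z - w) = Im z - Im w.
Proof. by case: z w => [a b] [c d]. Qed.

Lemma ReZ (a : R) (z : C) : Re ((a%:C)%C * z) = a * Re z.
Proof. by case: z => [b c]; rewrite /= mul0r subr0. Qed.

Lemma ImZ (a : R) (z : C) : Im ((a%:C)%C * z) = a * Im z.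
Proof. by case: z => [b c]; rewrite /= mul0r addr0. Qed.

Lemma w_X_asymptotics (theta : R) : exists2 D : R, 0 <= D & exists2 Y : R, 1 <= Y &
  forall l, let y := - (Re l / (pi *+ 2)) in Y <= y ->
    theta <= Im l < theta + pi *+ 2 ->
  exists2 a : R, `|a| <= `|theta| + 1 & [/\ period_log l = (a +i* y)%C,
    nrm (hcoef (w_X l) 0) <= D, nrm (hcoef (w_X l) 1) <= D * y,
    nrm (hcoef (w_X l) 2 - period_log l ^+ 2 / 2) <= D * y &
    nrm (hcoef (w_X l) 3 - period_log l ^+ 3 / 6) <= D * y ^+ 2].
Proof.
have [D1 [r [D10 r0 H1]]] := w_X_close R.
have [K K0 H2] := w_term0_close R.
have [A AE A0] : exists2 A : R, A = `|theta| + 1 & 0 <= A.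
  by exists (`|theta| + 1) => //; rewrite addr_ge0.
have [B BE B1] : exists2 B : R, B = 2 + A & 1 <= B by exists (2 + A) => //; lra.
have B0 : 0 <= B by lra.
exists (3 + K + A + K * B ^+ 2); first by rewrite !addr_ge0 ?mulr_ge0 ?exprn_ge0.
(* The 1 gives y >= 1, the 2 r gives r exp(-y) <= 1/2 through 1 + y <= exp(y), and 24 = 4! gives D1
   (B y)^3 <= exp(y) through y^4 / 4! <= exp(y). *)
exists (1 + 2 * r + 24 * (D1 * B ^+ 3)).
  by rewrite -addrA lerDl addr_ge0 ?mulr_ge0 ?exprn_ge0.
move=> l y Yy /andP[th1 th2].
have p2 : 2 <= pi :> R := @pi_ge2 R.
have p4 : 4 <= pi *+ 2 :> R by rewrite mulr2n; lra.
have p0 : 0 < pi *+ 2 :> R by lra.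
have c0 : 0 <= D1 * B ^+ 3 by rewrite mulr_ge0 ?exprn_ge0.
have y1 : 1 <= y by move: Yy; lra.
have y0 : 0 < y by lra.
have ReE : Re l = - (y * (pi *+ 2)) by rewrite /y mulNr opprK divfK// gt_eqF.
pose a := Im l / (pi *+ 2).
have aA : `|a| <= A.
  (* The branch of the logarithm enters only here: a window of length 2 pi for Im l bounds the real
     part of t. *)
  rewrite AE /a normrM [`|_^-1|]ger0_norm ?invr_ge0 ?(ltW p0)// ler_pdivrMr// mulrDl mul1r.
  have t0 := normr_ge0 theta.
  have K1 : `|theta| <= `|theta| * pi *+ 2 by rewrite -mulrnAr ler_peMr//; lra.
  have := ler_norm theta; have := ler_norm (- theta); rewrite normrN => h1 h2.
  move: K1; rewrite -mulrnAr => K1.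
  by rewrite ler_norml; apply/andP; split; lra.
exists a; first by rewrite -AE.
have tE : period_log l = (a +i* y)%C by rewrite period_logE.
have nt : 1 + nrm (period_log l) <= B * y.
  rewrite tE /nrm /= (ger0_norm (ltW y0)) BE.
  have : A <= A * y by rewrite ler_peMr.
  lra.
have nt0 : 0 <= 1 + nrm (period_log l) by rewrite addr_ge0 ?nrm_ge0.
have eR : expR (Re l) <= expR (- y).
  rewrite ler_expR ReE lerN2; apply: ler_peMr; lra.
have yr : r * expR (Re l) <= 2^-1.
  apply: (@le_trans _ _ (r * expR (- y))); first by rewrite ler_wpM2l.
  rewrite expRN ler_pdivrMr ?expR_gt0//.
  have := expR_ge1Dx y; move: Yy; lra.
have yD : D1 * (1 + nrm (period_log l)) ^+ 3 * expR (Re l) <= 1.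
  apply: (@le_trans _ _ (D1 * (B * y) ^+ 3 * expR (- y))).
    apply: ler_pM; rewrite ?expR_ge0 ?mulr_ge0 ?exprn_ge0//.
    by rewrite ler_wpM2l// lerXn2r ?nnegrE// mulr_ge0 ?(ltW y0).
  rewrite expRN ler_pdivrMr ?expR_gt0// mul1r.
  apply: le_trans (expR_ge_pow 4 (ltW y0)).
  rewrite exprMn mulrA ler_pdivlMr// (exprSr y 3) mulrC mulrA [leLHS]mulrC -mulrA.
  rewrite [leLHS](_ : _ = y ^+ 3 * (24 * (D1 * B ^+ 3))); last first.
    by rewrite !factS fact0 /=; ring.
  by rewrite ler_wpM2l ?exprn_ge0 ?(ltW y0)//; move: Yy; lra.
have Hj j : (j < 4)%N -> nrm (hcoef (w_X l) j - period_log l ^+ j / (j`!)%:R)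
     <= 1 + K * (B * y) ^+ j.-1.
  move=> j4; rewrite -(subrKA (hcoef (w_term l 0) j)).
  apply: le_trans (nrmD _ _) _; apply: lerD.
    exact: le_trans (H1 l j j4 yr) yD.
  apply: le_trans (H2 l j j4) _; rewrite ler_wpM2l//.
  by rewrite lerXn2r ?nnegrE// mulr_ge0 ?(ltW y0).
have y2 : y <= y ^+ 2 by rewrite expr2 ler_peMr// ltW.
have KB1 : K <= K * B ^+ 2 by rewrite ler_peMr// exprn_ege1.
have KB2 : K * B <= K * B ^+ 2 by rewrite ler_wpM2l// expr2 ler_peMr.
have KB0 : 0 <= K * B by rewrite mulr_ge0.
have KBy : K * B * y <= K * B ^+ 2 * y by rewrite ler_wpM2r// ltW.
have AyA : A <= A * y by rewrite ler_peMr.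
have Ky : K <= K * y by rewrite ler_peMr.
have KBBy : 0 <= K * B ^+ 2 * y by rewrite !mulr_ge0 ?exprn_ge0// ltW.
have h0 := Hj 0%N isT; have h1 := Hj 1%N isT; have h2 := Hj 2%N isT; have h3 := Hj 3%N isT.
move: h0 h1 h2 h3; rewrite /= !expr0 !expr1 !factS fact0 !muln1 !mulr1 !divr1 => h0 h1 h2 h3.
split => //.
- rewrite -(subrK 1 (hcoef (w_X l) 0)); apply: le_trans (nrmD _ _) _.
  have -> : nrm (1 : C) = 1 by rewrite /nrm /= normr1 normr0 addr0.
  by move: h0 KB1; lra.
- rewrite -(subrK (period_log l) (hcoef (w_X l) 1)); apply: le_trans (nrmD _ _) _.
  have : nrm (period_log l) <= A + y by rewrite tE /nrm /= (ger0_norm (ltW y0)); lra.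
  by move: h1; lra.
- by apply: le_trans h2 _; lra.
- apply: le_trans h3 _; rewrite exprMn.
  have : 0 <= K * y ^+ 2 by rewrite mulr_ge0 ?exprn_ge0 ?(ltW y0).
  have : 0 <= A * y ^+ 2 by rewrite mulr_ge0 ?exprn_ge0 ?(ltW y0).
  by lra.
Qed.

Lemma mul_bound (x z a b : R) : `|x| <= a -> `|z| <= b -> `|x * z| <= a * b.
Proof. by move=> xa zb; rewrite normrM; apply: ler_pM. Qed.

(* The conclusion is Im (S' * conj S) > 0 for S = sum v_i T_(3-i) and
   S' = sum v'_i T_(3-i): by bilinearity this is the sum of the 2 x 2 minors of
   (v', v) against those of the T_i, where the (0,1) term is at least
   y^5/12 - O(y^4) and the five others are O(y^4). *)
Lemma cross_product_pos (D : R) : 0 <= D -> exists Y : R, forall y : R,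
  1 <= y -> Y <= y ->
  forall (T0 T1 T2 T3 : C),
  nrm T0 <= D -> nrm T1 <= D * y ->
  `|Re T2 + y ^+ 2 / 2| <= D * y -> `|Im T2| <= D * y ->
  `|Re T3| <= D * y ^+ 2 -> `|Im T3 + y ^+ 3 / 6| <= D * y ^+ 2 ->
  forall v v' : nat -> R,
  (forall i, `|v i| <= 6) -> (forall i, `|v' i| <= 6) ->
  1 <= v' 0%N * v 1%N - v' 1%N * v 0%N ->
  0 < (v' 0%N * Im T3 + v' 1%N * Im T2 + v' 2%N * Im T1 + v' 3%N * Im T0) *
      (v 0%N * Re T3 + v 1%N * Re T2 + v 2%N * Re T1 + v 3%N * Re T0) -
      (v' 0%N * Re T3 + v' 1%N * Re T2 + v' 2%N * Re T1 + v' 3%N * Re T0) *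
      (v 0%N * Im T3 + v 1%N * Im T2 + v 2%N * Im T1 + v 3%N * Im T0).
Proof.
move=> D0; pose E := 1 + 2 * D.
(* Each minor of (v', v) has absolute value at most 72 = 2 * 6 * 6, so the five error terms add up
   to at most 360 E^2 y^4; the 12 clears the denominator of y^5 / 12. *)
exists (1 + 12 * ((D + 2 * D ^+ 2) + 360 * E ^+ 2)) => y y1 Yy T0 T1 T2 T3 H0 H1 R2 I2 R3 I3 v v' V V' d01.
have y0 : 0 <= y by lra.
have W (z w : C) p q : nrm z <= p -> nrm w <= q -> `|Im z * Re w - Re z * Im w| <= p * q.
  move=> zp wq; apply: (@le_trans _ _ (nrm z * nrm w)); last by apply: ler_pM; rewrite ?nrm_ge0.
  rewrite /nrm mulrDl !mulrDr -!normrM.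
  have := ler_normB (Im z * Re w) (Re z * Im w).
  have := normr_ge0 (Re z * Re w); have := normr_ge0 (Im z * Im w); lra.
have d i j : `|v' i * v j - v' j * v i| <= 72.
  apply: le_trans (ler_normB _ _) _.
  by have := mul_bound (V' i) (V j); have := mul_bound (V' j) (V i); lra.
have yX k : 1 <= y ^+ k by rewrite exprn_ege1.
have DyX k : D <= D * y ^+ k by rewrite ler_peMr.
have E0 : 0 <= E by rewrite /E; lra.
have n0 : nrm T0 <= E by rewrite /E; lra.
have n1 : nrm T1 <= E * y by have := mulr_ge0 D0 y0; rewrite /E; lra.
have n2 : nrm T2 <= E * y ^+ 2.
  have Dy : D * y <= D * y ^+ 2 by rewrite ler_wpM2l// expr2 ler_peMr.
  have y2 := yX 2%N.
  rewrite /nrm /E; have := ler_normB (Re T2 + y ^+ 2 / 2) (y ^+ 2 / 2).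
  rewrite addrK (@ger0_norm _ (y ^+ 2 / 2)); last by rewrite divr_ge0 ?exprn_ge0.
  lra.
have n3 : nrm T3 <= E * y ^+ 3.
  have Dy : D * y ^+ 2 <= D * y ^+ 3 by rewrite ler_wpM2l// (exprS _ 2) ler_peMl// exprn_ge0.
  have y3 := yX 3%N.
  rewrite /nrm /E; have := ler_normB (Im T3 + y ^+ 3 / 6) (y ^+ 3 / 6).
  rewrite addrK (@ger0_norm _ (y ^+ 3 / 6)); last by rewrite divr_ge0 ?exprn_ge0.
  lra.
have small (i j : nat) (z w : C) a b : nrm z <= E * y ^+ a -> nrm w <= E * y ^+ b -> (a + b <= 4)%N ->
    - (72 * (E ^+ 2 * y ^+ 4)) <= (v' i * v j - v' j * v i) * (Im z * Re w - Re z * Im w).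
  move=> za wb ab; have := mul_bound (d i j) (W _ _ _ _ za wb).
  rewrite ler_norml => /andP[+ _]; apply: le_trans; rewrite lerN2 ler_wpM2l//.
  rewrite mulrACA -expr2 -exprD ler_wpM2l ?exprn_ge0// ler_weXn2l//.
have n1' : nrm T1 <= E * y ^+ 1 by rewrite expr1.
have n0' : nrm T0 <= E * y ^+ 0 by rewrite expr0 mulr1.
have s02 := small 0%N 2%N T3 T1 3%N 1%N n3 n1' isT.
have s03 := small 0%N 3%N T3 T0 3%N 0%N n3 n0' isT.
have s12 := small 1%N 2%N T2 T1 2%N 1%N n2 n1' isT.
have s13 := small 1%N 3%N T2 T0 2%N 0%N n2 n0' isT.
have s23 := small 2%N 3%N T1 T0 1%N 0%N n1' n0' isT.
have main : y ^+ 5 / 12 - (D + 2 * D ^+ 2) * y ^+ 4 <= Im T3 * Re T2 - Re T3 * Im T2.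
  have b1 := mul_bound R3 I2.
  have b2 := mul_bound I3 R2.
  have y34 : D ^+ 2 * y ^+ 3 <= D ^+ 2 * y ^+ 4.
    by rewrite ler_wpM2l ?exprn_ge0// (exprS _ 3) ler_peMl// exprn_ge0.
  have e1 : D * y ^+ 2 * (D * y) = D ^+ 2 * y ^+ 3 by ring.
  rewrite e1 in b1 b2.
  have c1 : y ^+ 2 / 2 * (Im T3 + y ^+ 3 / 6) <= D * y ^+ 4 / 2.
    have : y ^+ 2 / 2 * (Im T3 + y ^+ 3 / 6) <= y ^+ 2 / 2 * (D * y ^+ 2).
      by rewrite ler_wpM2l ?divr_ge0 ?exprn_ge0// (le_trans (ler_norm _) I3).
    by move=> /le_trans; apply; rewrite le_eqVlt; apply/orP; left; apply/eqP; field.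
  have c2 : y ^+ 3 / 6 * (Re T2 + y ^+ 2 / 2) <= D * y ^+ 4 / 6.
    have : y ^+ 3 / 6 * (Re T2 + y ^+ 2 / 2) <= y ^+ 3 / 6 * (D * y).
      by rewrite ler_wpM2l ?divr_ge0 ?exprn_ge0// (le_trans (ler_norm _) R2).
    by move=> /le_trans; apply; rewrite le_eqVlt; apply/orP; left; apply/eqP; field.
  have eq : Im T3 * Re T2 = (Im T3 + y ^+ 3 / 6) * (Re T2 + y ^+ 2 / 2)
     - y ^+ 2 / 2 * (Im T3 + y ^+ 3 / 6) - y ^+ 3 / 6 * (Re T2 + y ^+ 2 / 2) + y ^+ 5 / 12 by field.
  have Dy4 : 0 <= D * y ^+ 4 by rewrite mulr_ge0 ?exprn_ge0.
  rewrite eq mulrDl -mulrA.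
  move: b1 b2; rewrite !ler_norml => /andP[_ b1] /andP[b2 _].
  lra.
have y5 : 12 * ((D + 2 * D ^+ 2) + 360 * E ^+ 2) * y ^+ 4 < y ^+ 5.
  rewrite (exprS _ 4) ltr_pM2r; last by rewrite exprn_gt0//; lra.
  lra.
(* The leading minor is only known to be at least 1, so its cofactor has to be nonnegative before
   [main] can be multiplied by it. *)
have mpos : 0 <= Im T3 * Re T2 - Re T3 * Im T2.
  apply: le_trans main; have : 0 <= E ^+ 2 * y ^+ 4 by rewrite mulr_ge0 ?exprn_ge0.
  move: y5; rewrite mulrDr mulrDl -!mulrA; lra.
have main' : y ^+ 5 / 12 - (D + 2 * D ^+ 2) * y ^+ 4 <=
   (v' 0%N * v 1%N - v' 1%N * v 0%N) * (Im T3 * Re T2 - Re T3 * Im T2).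
  by apply: le_trans main _; rewrite ler_peMl.
have -> : (v' 0%N * Im T3 + v' 1%N * Im T2 + v' 2%N * Im T1 + v' 3%N * Im T0) *
      (v 0%N * Re T3 + v 1%N * Re T2 + v 2%N * Re T1 + v 3%N * Re T0) -
      (v' 0%N * Re T3 + v' 1%N * Re T2 + v' 2%N * Re T1 + v' 3%N * Re T0) *
      (v 0%N * Im T3 + v 1%N * Im T2 + v 2%N * Im T1 + v 3%N * Im T0) =
  (v' 0%N * v 1%N - v' 1%N * v 0%N) * (Im T3 * Re T2 - Re T3 * Im T2) +
  (v' 0%N * v 2%N - v' 2%N * v 0%N) * (Im T3 * Re T1 - Re T3 * Im T1) +
  (v' 0%N * v 3%N - v' 3%N * v 0%N) * (Im T3 * Re T0 - Re T3 * Im T0) +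
  (v' 1%N * v 2%N - v' 2%N * v 1%N) * (Im T2 * Re T1 - Re T2 * Im T1) +
  (v' 1%N * v 3%N - v' 3%N * v 1%N) * (Im T2 * Re T0 - Re T2 * Im T0) +
  (v' 2%N * v 3%N - v' 3%N * v 2%N) * (Im T1 * Re T0 - Re T1 * Im T0) by ring.
have y5' : 12 * ((D + 2 * D ^+ 2) * y ^+ 4) + 4320 * (E ^+ 2 * y ^+ 4) < y ^+ 5.
  rewrite [ltLHS](_ : _ = 12 * ((D + 2 * D ^+ 2) + 360 * E ^+ 2) * y ^+ 4) //.
  by move: (D ^+ 2) (E ^+ 2) (y ^+ 4) => D2 E2 y4; ring.
move: (_ * (Im T3 * Re T2 - Re T3 * Im T2)) main' => P01.
move: (_ * (Im T3 * Re T1 - Re T3 * Im T1)) s02 => P02.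
move: (_ * (Im T3 * Re T0 - Re T3 * Im T0)) s03 => P03.
move: (_ * (Im T2 * Re T1 - Re T2 * Im T1)) s12 => P12.
move: (_ * (Im T2 * Re T0 - Re T2 * Im T0)) s13 => P13.
move: (_ * (Im T1 * Re T0 - Re T1 * Im T0)) s23 => P23.
move: ((D + 2 * D ^+ 2) * y ^+ 4) (E ^+ 2 * y ^+ 4) (y ^+ 5) y5' => a b c.
clear; lra.
Qed.

Lemma tau_lattice_le n i : `|tau_lattice R n i| <= 6.
Proof.
rewrite -tau_lattice_mod; have : (n %% 5 < 5)%N by rewrite ltn_mod.
by move: (n %% 5)%N => [|[|[|[|[|m]]]]]// _; case: i => [|[|[|[|i]]]];
 rewrite /tau_lattice /= ?nth_nil ler_norml; apply/andP; split; lra.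
Qed.

(** The values are 1, 6, 6, 1, 1 for n = 0, ..., 4 modulo 5: the pair of rank and degree always
    turns in the same direction. *)
Lemma tau_lattice_det n :
  1 <= tau_lattice R n.+1 0 * tau_lattice R n 1 - tau_lattice R n.+1 1 * tau_lattice R n 0.
Proof.
rewrite -(tau_lattice_mod _ n.+1 0) -(tau_lattice_mod _ n.+1 1) -addn1 -modnDml.
rewrite -(tau_lattice_mod _ n 0) -(tau_lattice_mod _ n 1).
have : (n %% 5 < 5)%N by rewrite ltn_mod.
by move: (n %% 5)%N => [|[|[|[|[|m]]]]]// _; rewrite /tau_lattice /=; lra.
Qed.

Lemma quintic_period_real l (v : Hev R) (u : nat -> R) :
  (forall j, (j < 4)%N -> hcoef v j = ((u j)%:C)%C) ->
  let T j := twisted_w l j in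
  Re (quintic_period l v) = 5 * (u 0%N * Re (T 3%N) + u 1%N * Re (T 2%N) + u 2%N * Re (T 1%N) + u 3%N * Re (T 0%N)) /\
  Im (quintic_period l v) = 5 * (u 0%N * Im (T 3%N) + u 1%N * Im (T 2%N) + u 2%N * Im (T 1%N) + u 3%N * Im (T 0%N)).
Proof.
move=> uv T; rewrite quintic_periodE !uv//.
have -> : (5 : C) = (5 : R)%:C%C by rewrite -[RHS]/(real_complex R _) rmorph_nat.
have e3 : hcoef (w_X l) 3 + (5 : R)%:C%C / 6 * hcoef (w_X l) 1 = T 3%N.
  by rewrite /T /twisted_w -[(5 : R)%:C%C]/(real_complex R _) rmorph_nat.
have e2 : hcoef (w_X l) 2 + (5 : R)%:C%C / 6 * hcoef (w_X l) 0 = T 2%N.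
  by rewrite /T /twisted_w -[(5 : R)%:C%C]/(real_complex R _) rmorph_nat.
have e1 : hcoef (w_X l) 1 = T 1%N by rewrite /T /twisted_w mulr0 addr0.
have e0 : hcoef (w_X l) 0 = T 0%N by rewrite /T /twisted_w mulr0 addr0.
rewrite e3 e2 e1 e0; move: (T 3%N) (T 2%N) (T 1%N) (T 0%N) => t3 t2 t1 t0.
by rewrite ReZ ImZ !ReD !ImD !ReZ !ImZ; split.
Qed.

(** In the first four lines the middle summand is what t^3 / 6 and t^2 / 2 leave at t = a + i y
    besides -i y^3 / 6 and -y^2 / 2; the first summand is the error of [w_X_asymptotics] and the
    last one the Todd correction. *)
Lemma phase_error_bounds (D A y : R) : 0 <= D -> 0 <= A -> 1 <= y ->
  let D' := 3 * D + A + A ^+ 2 + A ^+ 3 in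
  [/\ D * y ^+ 2 + (A ^+ 3 + 3 * (A * y ^+ 2)) / 6 + D * y <= D' * y ^+ 2,
      D * y ^+ 2 + A ^+ 2 * y / 2 + D * y <= D' * y ^+ 2,
      D * y + A ^+ 2 / 2 + D <= D' * y,
      D * y + A * y + D <= D' * y &
      D * y <= D' * y].
Proof.
move=> D0 A0 y1 D'; have y0 : 0 <= y by lra.
have Ak k : 0 <= A ^+ k by rewrite exprn_ge0.
have up (c : R) : 0 <= c -> c <= c * y /\ c * y <= c * y ^+ 2.
  by move=> c0; rewrite ler_peMr// expr2 mulrA ler_peMr// mulr_ge0.
have [] := up D D0; have [] := up A A0; have [] := up _ (Ak 2%N); have [] := up _ (Ak 3%N).
have := Ak 2%N; have := Ak 3%N; rewrite /D'.
move: (A ^+ 2) (A ^+ 3) (y ^+ 2) => A2 A3 y2 h1 h2 h3 h4 h5 h6 h7 h8 h9 h10.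
by split; rewrite !mulrDl -?mulrA; lra.
Qed.

Lemma norm_sum3_le (x z t X Z T : R) : `|x| <= X -> `|z| <= Z -> `|t| <= T ->
  `|x + z + t| <= X + Z + T.
Proof.
move=> xX zZ tT; apply: le_trans (ler_normD _ _) _; apply: lerD => //.
by apply: le_trans (ler_normD _ _) _; exact: lerD.
Qed.

Lemma quintic_period_turn (theta : R) : exists Y : R, forall l,
  Y <= - (Re l / (pi *+ 2)) -> theta <= Im l < theta + pi *+ 2 ->
  forall n (v v' : Hev R),
  (forall j, (j < 4)%N -> hcoef v j = tau_lattice C n j) ->
  (forall j, (j < 4)%N -> hcoef v' j = tau_lattice C n.+1 j) ->
  0 < Im (quintic_period l v') * Re (quintic_period l v) -
      Re (quintic_period l v') * Im (quintic_period l v).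
Proof.
have [D D0 [Y1 Y11 HD]] := w_X_asymptotics theta.
have [A AE A0] : exists2 A : R, A = `|theta| + 1 & 0 <= A.
  by exists (`|theta| + 1) => //; rewrite addr_ge0.
have [D' DE D'0] : exists2 D' : R, D' = 3 * D + A + A ^+ 2 + A ^+ 3 & 0 <= D'.
  by exists (3 * D + A + A ^+ 2 + A ^+ 3) => //; rewrite !addr_ge0 ?mulr_ge0 ?exprn_ge0.
have DD' : D <= D'.
  have := exprn_ge0 2 A0; have := exprn_ge0 3 A0; rewrite DE; lra.
have [Y2 HY2] := cross_product_pos D'0.
exists (Num.max Y1 Y2) => l; rewrite ge_max => /andP[Y1y Y2y] th n v v' Hv Hv'.
have [a] := HD l Y1y th; rewrite -AE => aA [tE w0 w1 w2 w3].
set y := - (Re l / (pi *+ 2)) in Y1y Y2y tE w0 w1 w2 w3.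
have y1 : 1 <= y by apply: le_trans Y11 Y1y.
have y0 : 0 <= y by apply: le_trans y1.
have [B1 B2 B3 B4 B5] := phase_error_bounds D0 A0 y1.
rewrite -DE in B1 B2 B3 B4 B5.
have c56 (z : C) p : nrm z <= p -> nrm (5 / 6 * z) <= p.
  have -> : (5 / 6 : C) = (5 / 6 : R)%:C%C.
    by rewrite -[RHS]/(real_complex R _) rmorphM fmorphV !rmorph_nat.
  move=> zp; apply: le_trans (nrmM _ _) _; rewrite nrm_real ger0_norm ?divr_ge0//.
  by have := nrm_ge0 z; lra.
have e2 (z : C) : z / 2 = (2^-1 : R)%:C%C * z.
  by rewrite mulrC -[(_)%:C%C]/(real_complex R _) fmorphV rmorph_nat.
have e6 (z : C) : z / 6 = (6^-1 : R)%:C%C * z.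
  by rewrite mulrC -[(_)%:C%C]/(real_complex R _) fmorphV rmorph_nat.
have ak k m : `|a ^+ k * y ^+ m| <= A ^+ k * y ^+ m.
  rewrite normrM (ger0_norm (exprn_ge0 m y0)) ler_wpM2r ?exprn_ge0//.
  by rewrite normrX lerXn2r ?nnegrE.
have w2' := c56 _ _ w0; have w3' := c56 _ _ w1.
have T3R : `|Re (twisted_w l 3)| <= D' * y ^+ 2.
  apply: le_trans B1.
  have -> : Re (twisted_w l 3) = Re (hcoef (w_X l) 3 - period_log l ^+ 3 / 6) +
     (a ^+ 3 * y ^+ 0 + 3 * - (a ^+ 1 * y ^+ 2)) / 6 + Re (5 / 6 * hcoef (w_X l) 1).
    by rewrite /twisted_w /= ReD ReB e6 ReZ tE !exprS expr0 mulr1 /=; ring.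
  apply: norm_sum3_le; [exact: le_trans (nrm_Re _) w3 | | exact: le_trans (nrm_Re _) w3'].
  rewrite normrM [X in _ * X]ger0_norm ?invr_ge0// ler_wpM2r ?invr_ge0//.
  apply: le_trans (ler_normD _ _) _; apply: lerD.
    by have := ak 3%N 0%N; rewrite !expr0 !mulr1.
  by rewrite normrM ger0_norm// normrN ler_wpM2l//; exact: (ak 1%N 2%N).
have T3I : `|Im (twisted_w l 3) + y ^+ 3 / 6| <= D' * y ^+ 2.
  apply: le_trans B2.
  have -> : Im (twisted_w l 3) + y ^+ 3 / 6 = Im (hcoef (w_X l) 3 - period_log l ^+ 3 / 6) +
     a ^+ 2 * y ^+ 1 / 2 + Im (5 / 6 * hcoef (w_X l) 1).
    by rewrite /twisted_w /= ImD ImB e6 ImZ tE !exprS expr0 mulr1 /=; field.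
  apply: norm_sum3_le; [exact: le_trans (nrm_Im _) w3 | | exact: le_trans (nrm_Im _) w3'].
  by rewrite normrM [X in _ * X]ger0_norm ?invr_ge0// ler_wpM2r ?invr_ge0//; exact: (ak 2%N 1%N).
have T2R : `|Re (twisted_w l 2) + y ^+ 2 / 2| <= D' * y.
  apply: le_trans B3.
  have -> : Re (twisted_w l 2) + y ^+ 2 / 2 = Re (hcoef (w_X l) 2 - period_log l ^+ 2 / 2) +
     a ^+ 2 * y ^+ 0 / 2 + Re (5 / 6 * hcoef (w_X l) 0).
    by rewrite /twisted_w /= ReD ReB e2 ReZ tE !exprS expr0 mulr1 /=; field.
  apply: norm_sum3_le; [exact: le_trans (nrm_Re _) w2 | | exact: le_trans (nrm_Re _) w2'].
  rewrite normrM [X in _ * X]ger0_norm ?invr_ge0// ler_wpM2r ?invr_ge0//.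
  by have := ak 2%N 0%N; rewrite !expr0 !mulr1.
have T2I : `|Im (twisted_w l 2)| <= D' * y.
  apply: le_trans B4.
  have -> : Im (twisted_w l 2) = Im (hcoef (w_X l) 2 - period_log l ^+ 2 / 2) +
     a ^+ 1 * y ^+ 1 + Im (5 / 6 * hcoef (w_X l) 0).
    by rewrite /twisted_w /= ImD ImB e2 ImZ tE !exprS expr0 mulr1 /=; field.
  apply: norm_sum3_le; [exact: le_trans (nrm_Im _) w2 | | exact: le_trans (nrm_Im _) w2'].
  exact: (ak 1%N 1%N).
have T1n : nrm (twisted_w l 1) <= D' * y.
  by rewrite /twisted_w /= mulr0 addr0; exact: le_trans w1 B5.
have T0n : nrm (twisted_w l 0) <= D'.
  by rewrite /twisted_w /= mulr0 addr0; exact: le_trans w0 DD'.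
have Hvr j : (j < 4)%N -> hcoef v j = (tau_lattice R n j)%:C%C.
  by move=> j4; rewrite Hv// tau_lattice_real.
have Hvr' j : (j < 4)%N -> hcoef v' j = (tau_lattice R n.+1 j)%:C%C.
  by move=> j4; rewrite Hv'// tau_lattice_real.
have [-> ->] := quintic_period_real l Hvr; have [-> ->] := quintic_period_real l Hvr'.
have := HY2 y y1 Y2y _ _ _ _ T0n T1n T2R T2I T3R T3I (tau_lattice R n) (tau_lattice R n.+1)
  (tau_lattice_le n) (tau_lattice_le n.+1) (tau_lattice_det n).
set X := _ - _ => X0.
(* Each of the two periods carries the factor 5, the integral of J^3 over X. *)
rewrite [ltRHS](_ : _ = 25 * X); last by rewrite /X; ring.
by rewrite mulr_gt0.
Qed.

End PeriodPhases.

(** * Polar coordinates and the choice of phases *)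

Section Phases.
Variable R : realType.
Local Notation C := R[i].
Local Notation Re := complex.Re.
Local Notation Im := complex.Im.

Lemma polar_coordinates (a b : R) : (a != 0) || (b != 0) ->
  exists r phi : R, [/\ 0 < r, a = r * cos phi, b = r * sin phi &
    0 < b -> 0 < phi < pi].
Proof.
move=> ab0; pose r := Num.sqrt (a ^+ 2 + b ^+ 2).
have s0 : 0 < a ^+ 2 + b ^+ 2.
  rewrite lt_neqAle addr_ge0 ?sqr_ge0// andbT eq_sym paddr_eq0 ?sqr_ge0//.
  by rewrite !sqrf_eq0 negb_and.
have r0 : 0 < r by rewrite sqrtr_gt0.
have rr : r ^+ 2 = a ^+ 2 + b ^+ 2 by rewrite sqr_sqrtr// ltW.
have rn : r != 0 by rewrite gt_eqF.
have ar : (a / r) ^+ 2 = 1 - (b / r) ^+ 2.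
  by rewrite !expr_div_n rr; field; rewrite -rr sqrf_eq0.
have ar1 : -1 <= a / r <= 1.
  rewrite -ler_norml -(@ler_pXn2r _ 2)// ?nnegrE// expr1n -normrX ger0_norm ?sqr_ge0//.
  by rewrite ar lerBlDr lerDl sqr_ge0.
have cE : cos (acos (a / r)) = a / r by rewrite acosK// in_itv.
have sE : sin (acos (a / r)) = `|b| / r.
  by rewrite sin_acos// ar opprB addrC subrK sqrtr_sqr normrM normfV (gtr0_norm r0).
have [b0|b0] := ltP 0 b; [exists r, (acos (a / r)) | exists r, (- acos (a / r))]; split => //.
- by rewrite cE mulrC divfK.
- by rewrite sE (gtr0_norm b0) mulrC divfK.
- move=> _; have ar1' : -1 < a / r < 1.
    rewrite -ltr_norml -(@ltr_pXn2r _ 2)// ?nnegrE// expr1n -normrX ger0_norm ?sqr_ge0//.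
    by rewrite ar ltrBlDr ltrDl exprn_gt0// divr_gt0.
  move: ar1' => /andP[h1 h2].
  by rewrite acos_gt0 ?acos_ltpi// ?h1 ?h2 ?ltW.
- by rewrite cosN cE mulrC divfK.
- by rewrite sinN sE (ler0_norm b0) mulNr opprK mulrC divfK.
Qed.

Definition is_phase (z : C) (phi : R) : Prop :=
  exists2 m : R, 0 < m & z = (m%:C)%C * cexp (0 +i* phi)%C.

Lemma is_phaseE (z : C) (phi m : R) : 0 < m -> Re z = m * cos phi ->
  Im z = m * sin phi -> is_phase z phi.
Proof.
move=> m0 zr zi; exists m => //; rewrite /cexp /= expR0 !mul1r.
by case: z zr zi => a b /= -> ->; rewrite /GRing.mul /= !mul0r subr0 addr0.
Qed.

Lemma is_phaseP (z : C) (phi : R) : is_phase z phi ->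
  exists2 m : R, 0 < m & Re z = m * cos phi /\ Im z = m * sin phi.
Proof.
move=> [m m0 ->]; exists m => //; rewrite /cexp /= expR0 !mul1r.
by rewrite !mul0r subr0 addr0.
Qed.

(** The increment is the argument of z' conj(z) = c + i s, and s > 0 places it in ]0, pi[. *)
Lemma next_phase (z z' : C) (phi : R) : is_phase z phi ->
  0 < Im z' * Re z - Re z' * Im z ->
  exists2 phi', is_phase z' phi' & 0 < phi' - phi < pi.
Proof.
move=> /is_phaseP[m m0 [zr zi]]; rewrite zr zi => s0.
set s := _ - _ in s0; pose c := Re z' * (m * cos phi) + Im z' * (m * sin phi).
have [|r [delta [r0 cE sE dpi]]] := @polar_coordinates c s.
  by rewrite (gt_eqF s0) orbT.
have cs := cos2Dsin2 phi.
exists (phi + delta); last by rewrite addrAC subrr add0r; exact: dpi.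
have mn : m != 0 by rewrite gt_eqF.
apply: (@is_phaseE _ _ (r / m)); first by rewrite divr_gt0.
- rewrite cosD [RHS](_ : _ = (cos phi * (r * cos delta) - sin phi * (r * sin delta)) / m); last by field.
  rewrite -cE -sE /c /s [RHS](_ : _ = Re z' * (cos phi ^+ 2 + sin phi ^+ 2)); last by field.
  by rewrite cs mulr1.
- rewrite sinD [RHS](_ : _ = (sin phi * (r * cos delta) + cos phi * (r * sin delta)) / m); last by field.
  rewrite -cE -sE /c /s [RHS](_ : _ = Im z' * (cos phi ^+ 2 + sin phi ^+ 2)); last by field.
  by rewrite cs mulr1.
Qed.

Lemma turning_phases (Z : nat -> C) :
  (forall n, 0 < Im (Z n.+1) * Re (Z n) - Re (Z n.+1) * Im (Z n)) ->
  exists phi : nat -> R, (forall n, is_phase (Z n) (phi n)) /\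
    forall n, 0 < phi n.+1 - phi n < pi.
Proof.
move=> HZ.
(* Stated for all pairs of an index and a candidate phase, so that plain choice yields a step
   function, which the recursion below iterates. *)
have : forall p : nat * R, exists phi' : R, is_phase (Z p.1) p.2 ->
    is_phase (Z p.1.+1) phi' /\ 0 < phi' - p.2 < pi.
  move=> [n phi] /=; have [Hp|] := pselect (is_phase (Z n) phi); last by exists 0.
  by have [phi' h1 h2] := next_phase Hp (HZ n); exists phi'.
move=> /choice[f Hf].
have [phi0 H0] : exists phi0, is_phase (Z 0%N) phi0.
  have [|r [phi [r0 h1 h2 _]]] := @polar_coordinates (Re (Z 0%N)) (Im (Z 0%N)).
    apply: contraT; rewrite negb_or !negbK => /andP[/eqP h1 /eqP h2].
    by have := HZ 0%N; rewrite h1 h2 !mulr0 subrr ltxx.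
  by exists phi; exact: is_phaseE r0 h1 h2.
pose phi := fix phi n := if n is n'.+1 then f (n', phi n') else phi0.
have Hphi n : is_phase (Z n) (phi n).
  by elim: n => [//|n IH]; have [] := Hf (n, phi n) IH.
by exists phi; split => // n; have [] := Hf (n, phi n) (Hphi n).
Qed.

End Phases.

(** * Derived categories and additive invariants *)

Section TricatIsom.
Variables (K : fieldType) (T : tricat K).

Lemma cmp_eqml (X Y Z : T) (g g' : mor Y Z) (f : mor X Y) :
  eqm g g' -> eqm (cmp g f) (cmp g' f).
Proof. by move=> H; apply: cmp_eqm => //; exact: eqm_refl. Qed.

Lemma cmp_eqmr (X Y Z : T) (g : mor Y Z) (f f' : mor X Y) :
  eqm f f' -> eqm (cmp g f) (cmp g f').
Proof. by move=> H; apply: cmp_eqm => //; exact: eqm_refl. Qed.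

Lemma cmp_cancel_mid (X Y Z W : T) (h : mor Y Z) (g : mor W Y) (f : mor Y W)
    (k : mor X Y) : eqm (cmp g f) (idm Y) ->
  eqm (cmp (cmp h g) (cmp f k)) (cmp h k).
Proof.
move=> H; apply: eqm_trans (eqm_sym (cmpA _ _ _)) _; apply: cmp_eqmr.
apply: eqm_trans (cmpA _ _ _) _; apply: eqm_trans (cmp_eqml k H) _.
exact: cmp1m.
Qed.

Lemma isom_refl (X : T) : isom X X.
Proof. by exists (idm X), (idm X); split; exact: cmp1m. Qed.

Lemma isom_sym (X Y : T) : isom X Y -> isom Y X.
Proof. by move=> [f [g [h1 h2]]]; exists g, f; split. Qed.

Lemma isom_trans (Y X Z : T) : isom X Y -> isom Y Z -> isom X Z.
Proof.
move=> [f [g [h1 h2]]] [f' [g' [h1' h2']]]; exists (cmp f' f), (cmp g g'); split.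
  exact: eqm_trans (cmp_cancel_mid g f h1') h1.
exact: eqm_trans (cmp_cancel_mid f' g' h2) h2'.
Qed.

Lemma cmp0m (X Y Z : T) (f : mor X Y) : eqm (cmp (zrm Y Z) f) (zrm X Z).
Proof.
apply: eqm_trans (cmp_eqml f (eqm_sym (scl0m (zrm Y Z)))) _.
apply: eqm_trans (cmpZl 0 (zrm Y Z) f) _; exact: scl0m.
Qed.

Lemma cmpm0 (X Y Z : T) (g : mor Y Z) : eqm (cmp g (zrm X Y)) (zrm X Z).
Proof.
apply: eqm_trans (cmp_eqmr g (eqm_sym (scl0m (zrm X Y)))) _.
apply: eqm_trans (cmpZr 0 g (zrm X Y)) _; exact: scl0m.
Qed.

Lemma addm0 (X Y : T) (f : mor X Y) : eqm (addm f (zrm X Y)) f.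
Proof. exact: eqm_trans (addmC _ _) (add0m f). Qed.

End TricatIsom.

Lemma functor_isom (K : fieldType) (S T : tricat K) (F : exact_functor S T)
    (X Y : S) : isom X Y -> isom (F X) (F Y).
Proof.
move=> [f [g [h1 h2]]]; exists (fmor F f), (fmor F g); split.
- apply: eqm_trans (eqm_sym (fmorM F _ _)) _.
  exact: eqm_trans (fmor_eqm F h1) (fmor1 F _).
- apply: eqm_trans (eqm_sym (fmorM F _ _)) _.
  exact: eqm_trans (fmor_eqm F h2) (fmor1 F _).
Qed.

(** * Isomorphisms, triangles and shifts in the localization *)

Section DerivedCategory.
Variables (K : fieldType) (C : repcat K).
Implicit Types X Y Z : cpx C.

Lemma isom_cmap X Y (f : cmap X Y) (g : cmap Y X) :
  (forall i, rheq (rcomp (cf g i) (cf f i)) (rid (X i))) ->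
  (forall i, rheq (rcomp (cf f i) (cf g i)) (rid (Y i))) ->
  isom (X : Db C) Y.
Proof.
move=> gf fg; exists (Dmap f), (Dmap g); split.
- by apply: Deq_trans (Deq_sym (DmapM _ _)) _; apply: Dmap_eq => i; exact: gf.
- by apply: Deq_trans (Deq_sym (DmapM _ _)) _; apply: Dmap_eq => i; exact: fg.
Qed.

Lemma isom_qis X Y (f : cmap X Y) : qis f -> isom (X : Db C) Y.
Proof.
by move=> Hf; exists (Dmap f), (Dinv Hf); split; [exact: DinvL | exact: DinvR].
Qed.

Lemma Dshift_isom n X Y : isom (X : Db C) Y ->
  isom (cshift n X : Db C) (cshift n Y).
Proof.
move=> [f [g [h1 h2]]]; exists (Dshift n f), (Dshift n g); split.
- exact: (@Deq_trans _ _ _ _ _ _ _ (Dshift_eq n h1) (Dshift1 n _)).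
- exact: (@Deq_trans _ _ _ _ _ _ _ (Dshift_eq n h2) (Dshift1 n _)).
Qed.

Lemma Disom_id X : exists a', Disom_pair (Dmap (cid X)) a'.
Proof. by exists (Dmap (cid X)); split; exact: Dcomp1m. Qed.

Lemma Dcomp_id X Y (f : Dmor X Y) :
  Deq (Dcomp (Dmap (cid Y)) f) (Dcomp f (Dmap (cid X))).
Proof. exact: Deq_trans (Dcomp1m f) (Deq_sym (Dcompm1 f)). Qed.

Lemma split_triangle_dist X Y Z (f : cmap X Y) (g : cmap Y Z)
    (h : cmap Z (cshift 1 X)) : split_triangle f g h ->
  @dist _ (Db C) X Y Z (Dmap f) (Dmap g) (Dmap h).
Proof.
move=> fgh; exists X, Y, Z, f, g, h, (Dmap (cid X)), (Dmap (cid Y)), (Dmap (cid Z)).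
split => //; [by split; [|split]; exact: Disom_id | exact: Dcomp_id | exact: Dcomp_id |].
apply: Deq_trans (Dcomp_id _); apply: Deq_comp (Deq_refl _).
exact: Dshift1.
Qed.

Definition zero_cpx : cpx C := stalk (czero C).

Lemma zero_cpx_eq0 i v (u : rv (zero_cpx i) v) : u = 0.
Proof.
by move: u; rewrite /zero_cpx /=; case: (i == 0) => u; apply/rowP => -[].
Qed.

Lemma zero_cpx_dist X : @dist _ (Db C) X X zero_cpx (@idm _ (Db C) X) (@zrm _ (Db C) X zero_cpx)
  (@zrm _ (Db C) zero_cpx (cshift 1 X)).
Proof.
apply: split_triangle_dist.
exists (fun i => rzero _ _), (fun i => rid _) => i; split => v /=.
- by rewrite comp_lfun1l.
- by apply/lfunP => u; rewrite (zero_cpx_eq0 u) !linear0.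
- by rewrite comp_lfun1l comp_lfun0l addr0.
- by rewrite !comp_lfun0r.
Qed.

Section AdditiveInvariant.
Variables (V : zmodType) (F : Db C -> V).
Hypothesis FK : K_hom F.

Lemma K_hom_zero : F zero_cpx = 0.
Proof. by apply: (@addrI _ (F zero_cpx)); rewrite addr0 -(FK (zero_cpx_dist zero_cpx)). Qed.

(** An isomorphism u fits into a distinguished triangle X -> Y -> 0: the split model of X -> X -> 0
    serves again, with its comparison map at the middle term composed with the inverse of u. *)
Lemma K_hom_isom X Y : isom (X : Db C) Y -> F X = F Y.
Proof.
move=> [u [u' [u'u uu']]].
have H : @dist _ (Db C) X Y zero_cpx u (@zrm _ (Db C) Y zero_cpx)
    (@zrm _ (Db C) zero_cpx (cshift 1 X)).
  have [X' [Y' [Z' [f [g [h [a [b [c [fgh [ia [ib ic]] e1 e2 e3]]]]]]]]]] := zero_cpx_dist X.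
  exists X', Y', Z', f, g, h, a, (Dcomp b u'), c; split => //.
  - split => //; split => //; have [b' [hb1 hb2]] := ib.
    exists (Dcomp u b'); split.
      apply: Deq_trans uu'; exact: (@cmp_cancel_mid _ (Db C) _ _ _ _ u b' b u' hb1).
    apply: Deq_trans hb2; exact: (@cmp_cancel_mid _ (Db C) _ _ _ _ b u' u b' u'u).
  - apply: Deq_trans (Deq_sym (DcompA _ _ _)) _.
    apply: Deq_trans (Deq_comp (Deq_refl b) u'u) _.
    exact: e1.
  - apply: Deq_trans (@cmpm0 _ (Db C) _ _ _ c) _.
    apply: Deq_sym; apply: Deq_trans (DcompA _ _ _) _.
    apply: Deq_trans (Deq_comp (Deq_sym e2) (Deq_refl u')) _.
    apply: Deq_trans (Deq_comp (@cmpm0 _ (Db C) _ _ _ c) (Deq_refl u')) _.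
    exact: (@cmp0m _ (Db C)).
by rewrite (FK H) K_hom_zero addr0.
Qed.

Lemma K_hom_split X Y Z (f : cmap X Y) (g : cmap Y Z)
    (h : cmap Z (cshift 1 X)) : split_triangle f g h -> F Y = F X + F Z.
Proof. by move=> /split_triangle_dist /FK. Qed.

End AdditiveInvariant.

Section Transport.
Variable X : cpx C.

(* Replaces the identity of X i where i = j is only a provable equality, as in
   X[n][m] = X[m + n]. *)
Definition transport (i j : int) : rhom (X i) (X j) :=
  match i =P j with
  | ReflectT e => eq_rect i (fun j => rhom (X i) (X j)) (rid (X i)) j e
  | ReflectF _ => rzero (X i) (X j)
  end.

Lemma transport_id i : rheq (transport i i) (rid (X i)).
Proof. by move=> v; rewrite /transport; case: eqP => // e; rewrite eq_axiomK. Qed.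

Lemma transport_neq i j : i != j -> rheq (transport i j) (rzero (X i) (X j)).
Proof. by move=> ij v; rewrite /transport; case: eqP ij => //= ->; rewrite eqxx. Qed.

Lemma transportK i j : i = j ->
  rheq (rcomp (transport j i) (transport i j)) (rid (X i)).
Proof. by move=> <- v /=; rewrite transport_id comp_lfun1l. Qed.

Lemma transport_cd i i' j j' : i = i' -> j = j' ->
  rheq (rcomp (cd X i' j') (transport i i')) (rcomp (transport j j') (cd X i j)).
Proof.
move=> <- <- v /=; rewrite !transport_id; exact: etrans (comp_lfun1r _) (esym (comp_lfun1l _)).
Qed.

End Transport.

Lemma cshift_add m n X : isom (cshift m (cshift n X) : Db C) (cshift (m + n) X).
Proof.
have e (i : int) : i + m + n = i + (m + n) by rewrite addrA.
have P (i j : int) : rheq (rcomp (cd (cshift (m + n) X) i j) (transport X (i + m + n) (i + (m + n))))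
    (rcomp (transport X (j + m + n) (j + (m + n))) (cd (cshift m (cshift n X)) i j)).
  move=> v; have := @transport_cd X _ _ _ _ (e i) (e j) v.
  rewrite /= -!comp_lfunZl -!comp_lfunZr => ->.
  by rewrite scalerA expfzDr// oppr_eq0 oner_eq0.
have P' (i j : int) : rheq (rcomp (cd (cshift m (cshift n X)) i j) (transport X (i + (m + n)) (i + m + n)))
    (rcomp (transport X (j + (m + n)) (j + m + n)) (cd (cshift (m + n) X) i j)).
  move=> v; have := @transport_cd X _ _ _ _ (esym (e i)) (esym (e j)) v.
  rewrite /= -!comp_lfunZl -!comp_lfunZr => ->.
  by rewrite scalerA expfzDr// oppr_eq0 oner_eq0.
by apply: (@isom_cmap _ _ (@CMap _ _ (cshift m (cshift n X)) (cshift (m + n) X) _ P)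
  (@CMap _ _ (cshift (m + n) X) (cshift m (cshift n X)) _ P')) => i;
  [exact: (transportK X (e i)) | exact: (transportK X (esym (e i)))].
Qed.

Lemma cshift0 X : isom (cshift 0 X : Db C) X.
Proof.
have e (i : int) : i + 0 = i by rewrite addr0.
have P (i j : int) : rheq (rcomp (cd X i j) (transport X (i + 0) i))
    (rcomp (transport X (j + 0) j) (cd (cshift 0 X) i j)).
  move=> v; have := @transport_cd X _ _ _ _ (e i) (e j) v.
  by rewrite /= -!comp_lfunZr expr0z scale1r => ->.
have P' (i j : int) : rheq (rcomp (cd (cshift 0 X) i j) (transport X i (i + 0)))
    (rcomp (transport X j (j + 0)) (cd X i j)).
  move=> v; have := @transport_cd X _ _ _ _ (esym (e i)) (esym (e j)) v.
  by rewrite /= -!comp_lfunZl expr0z scale1r => ->.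
by apply: (@isom_cmap _ _ (@CMap _ _ (cshift 0 X) X _ P) (@CMap _ _ X (cshift 0 X) _ P')) => i;
  [exact: (transportK X (e i)) | exact: (transportK X (esym (e i)))].
Qed.

Lemma cshift_opp m n X : m + n = 0 -> isom (cshift m (cshift n X) : Db C) X.
Proof. by move=> mn; apply: isom_trans (cshift_add m n X) _; rewrite mn; exact: cshift0. Qed.

End DerivedCategory.

(** * Direct sums of vector spaces, representations and complexes *)

Section PairHom.
Variables (K : fieldType) (V W : vectType K).

Definition pfst : 'Hom((V * W)%type, V) := linfun fst.
Definition psnd : 'Hom((V * W)%type, W) := linfun snd.

Definition pair_inl (v : V) : (V * W)%type := (v, 0).
Definition pair_inr (w : W) : (V * W)%type := (0, w).

Fact pair_inl_linear : linear pair_inl.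
Proof.
move=> a u v; have -> : a *: pair_inl u + pair_inl v = (a *: u + v, a *: 0 + 0) by [].
by rewrite scaler0 addr0.
Qed.
HB.instance Definition _ :=
  GRing.isLinear.Build K V (V * W)%type *:%R pair_inl pair_inl_linear.

Fact pair_inr_linear : linear pair_inr.
Proof.
move=> a u v; have -> : a *: pair_inr u + pair_inr v = (a *: 0 + 0, a *: u + v) by [].
by rewrite scaler0 addr0.
Qed.
HB.instance Definition _ :=
  GRing.isLinear.Build K W (V * W)%type *:%R pair_inr pair_inr_linear.

Definition pinl : 'Hom(V, (V * W)%type) := linfun pair_inl.
Definition pinr : 'Hom(W, (V * W)%type) := linfun pair_inr.

Lemma pfstE p : pfst p = p.1. Proof. exact: lfunE. Qed.
Lemma psndE p : psnd p = p.2. Proof. exact: lfunE. Qed.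
Lemma pinlE v : pinl v = (v, 0). Proof. by rewrite lfunE. Qed.
Lemma pinrE w : pinr w = (0, w). Proof. by rewrite lfunE. Qed.

Lemma pfst_inl : (pfst \o pinl)%VF = \1%VF.
Proof. by apply/lfunP => v; rewrite comp_lfunE id_lfunE pinlE pfstE. Qed.
Lemma psnd_inr : (psnd \o pinr)%VF = \1%VF.
Proof. by apply/lfunP => v; rewrite comp_lfunE id_lfunE pinrE psndE. Qed.
Lemma pfst_inr : (pfst \o pinr)%VF = 0.
Proof. by apply/lfunP => v; rewrite comp_lfunE zero_lfunE pinrE pfstE. Qed.
Lemma psnd_inl : (psnd \o pinl)%VF = 0.
Proof. by apply/lfunP => v; rewrite comp_lfunE zero_lfunE pinlE psndE. Qed.
Lemma pair_id : ((pinl \o pfst) + (pinr \o psnd))%VF = \1%VF.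
Proof.
apply/lfunP => -[v w]; rewrite add_lfunE !comp_lfunE id_lfunE pfstE psndE pinlE pinrE /=.
have -> : (v, 0) + (0, w) = (v + 0, 0 + w) :> (V * W)%type by [].
by rewrite addr0 add0r.
Qed.

End PairHom.
Arguments pfst {K V W}.
Arguments psnd {K V W}.
Arguments pinl {K V W}.
Arguments pinr {K V W}.

Section MatrixHom.
Variables (K : fieldType) (V1 V2 W1 W2 : vectType K).

(* [[a, b], [c, d]] as a map V1 + V2 -> W1 + W2 *)
Definition mat_hom (a : 'Hom(V1, W1)) (b : 'Hom(V2, W1)) (c : 'Hom(V1, W2))
    (d : 'Hom(V2, W2)) : 'Hom((V1 * V2)%type, (W1 * W2)%type) :=
  ((pinl \o ((a \o pfst) + (b \o psnd))) + (pinr \o ((c \o pfst) + (d \o psnd))))%VF.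

Lemma mat_homE a b c d p :
  mat_hom a b c d p = (a p.1 + b p.2, c p.1 + d p.2).
Proof.
rewrite /mat_hom add_lfunE !comp_lfunE !add_lfunE !comp_lfunE pfstE psndE.
rewrite pinlE pinrE; set x := a _ + _; set y := c _ + _.
have -> : (x, 0) + (0, y) = (x + 0, 0 + y) :> (W1 * W2)%type by [].
by rewrite addr0 add0r.
Qed.

End MatrixHom.

Section RepSum.
Variables (K : fieldType) (Q : quiver).

Definition rsum_rep (V W : rep K Q) : rep K Q :=
  @Rep K Q (fun i => (rv V i * rv W i)%type : vectType K)
    (fun i j a => mat_hom (rm V a) 0 0 (rm W a)).

Lemma rsum_mE (V W : rep K Q) i j (a : arr i j) p :
  rm (rsum_rep V W) a p = (rm V a p.1, rm W a p.2).
Proof. by rewrite /= mat_homE !zero_lfunE addr0 add0r. Qed.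

Lemma rinl_proof (V W : rep K Q) i j (a : arr i j) :
  (rm (rsum_rep V W) a \o pinl = pinl \o rm V a)%VF.
Proof. by apply/lfunP => v; rewrite !comp_lfunE rsum_mE !pinlE /= linear0. Qed.
Definition rinl (V W : rep K Q) : rhom V (rsum_rep V W) := @RHom K Q V (rsum_rep V W) (fun i => pinl) (@rinl_proof V W).

Lemma rinr_proof (V W : rep K Q) i j (a : arr i j) :
  (rm (rsum_rep V W) a \o pinr = pinr \o rm W a)%VF.
Proof. by apply/lfunP => v; rewrite !comp_lfunE rsum_mE !pinrE /= linear0. Qed.
Definition rinr (V W : rep K Q) : rhom W (rsum_rep V W) := @RHom K Q W (rsum_rep V W) (fun i => pinr) (@rinr_proof V W).

Lemma rfst_proof (V W : rep K Q) i j (a : arr i j) :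
  (rm V a \o pfst = pfst \o rm (rsum_rep V W) a)%VF.
Proof. by apply/lfunP => v; rewrite !comp_lfunE rsum_mE !pfstE. Qed.
Definition rfst (V W : rep K Q) : rhom (rsum_rep V W) V := @RHom K Q (rsum_rep V W) V (fun i => pfst) (@rfst_proof V W).

Lemma rsnd_proof (V W : rep K Q) i j (a : arr i j) :
  (rm W a \o psnd = psnd \o rm (rsum_rep V W) a)%VF.
Proof. by apply/lfunP => v; rewrite !comp_lfunE rsum_mE !psndE. Qed.
Definition rsnd (V W : rep K Q) : rhom (rsum_rep V W) W := @RHom K Q (rsum_rep V W) W (fun i => psnd) (@rsnd_proof V W).

Lemma rmat_proof (V1 V2 W1 W2 : rep K Q) (a : rhom V1 W1) (b : rhom V2 W1)
    (c : rhom V1 W2) (d : rhom V2 W2) i j (x : arr i j) :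
  (rm (rsum_rep W1 W2) x \o mat_hom (rf a i) (rf b i) (rf c i) (rf d i) =
   mat_hom (rf a j) (rf b j) (rf c j) (rf d j) \o rm (rsum_rep V1 V2) x)%VF.
Proof.
have e (V W : rep K Q) (f : rhom V W) u : rm W x (rf f i u) = rf f j (rm V x u).
  by rewrite -!comp_lfunE rfP.
by apply/lfunP => -[u v]; rewrite !comp_lfunE !rsum_mE !mat_homE /= !linearD /= !e.
Qed.
Definition rmat (V1 V2 W1 W2 : rep K Q) (a : rhom V1 W1) (b : rhom V2 W1)
    (c : rhom V1 W2) (d : rhom V2 W2) : rhom (rsum_rep V1 V2) (rsum_rep W1 W2) :=
  @RHom K Q (rsum_rep V1 V2) (rsum_rep W1 W2)
    (fun i => mat_hom (rf a i) (rf b i) (rf c i) (rf d i)) (rmat_proof a b c d).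

Lemma rmatE (V1 V2 W1 W2 : rep K Q) (a : rhom V1 W1) (b : rhom V2 W1)
    (c : rhom V1 W2) (d : rhom V2 W2) i p :
  rf (rmat a b c d) i p = (rf a i p.1 + rf b i p.2, rf c i p.1 + rf d i p.2).
Proof. exact: mat_homE. Qed.

Lemma rsum_zero (V W : rep K Q) :
  is_zero_rep V -> is_zero_rep W -> is_zero_rep (rsum_rep V W).
Proof. by move=> V0 W0 i [v w]; rewrite (V0 i v) (W0 i w). Qed.

End RepSum.

Section ComplexSum.
Variables (K : fieldType) (C : repcat K).
(** A [repcat] need not be closed under direct sums; for graded modules over the quintic this is
    [gr_rel_sum]. *)
Hypothesis crel_sum : forall V W : rep K (cquiv C),
  crel V -> crel W -> crel (rsum_rep V W).
Implicit Types X Y Z : cpx C.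

Definition cobj_sum (V W : cobj C) : cobj C :=
  CObj (crel_sum (crelP V) (crelP W)).

Lemma rheqE (V W : rep K (cquiv C)) (f g : rhom V W) :
  (forall i u, rf f i u = rf g i u) -> rheq f g.
Proof. by move=> H i; apply/lfunP => u; exact: H. Qed.

Lemma cd_shapeE X i j v u : j != i + 1 -> rf (cd X i j) v u = 0.
Proof. by move=> ij; rewrite cd_shape// zero_lfunE. Qed.

Lemma cd_cdE X i j k v u : rf (cd X j k) v (rf (cd X i j) v u) = 0.
Proof. by have /(congr1 (fun f => fun_of_lfun f u)) := cd_cd X i j k v; rewrite /= comp_lfunE zero_lfunE. Qed.

Section Sum.
Variables X Y : cpx C.

Let sd i j : rhom (cobj_sum (X i) (Y i)) (cobj_sum (X j) (Y j)) :=
  rmat (cd X i j) (rzero _ _) (rzero _ _) (cd Y i j).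

Lemma csum_shape i j : j != i + 1 -> rheq (sd i j) (rzero _ _).
Proof.
move=> ij; apply: rheqE => v u.
by rewrite rmatE /= !zero_lfunE !cd_shapeE// !addr0.
Qed.

Lemma csum_dd i j k : rheq (rcomp (sd j k) (sd i j)) (rzero _ _).
Proof.
apply: rheqE => v u.
by rewrite /= comp_lfunE !mat_homE /= !zero_lfunE !addr0 !add0r !cd_cdE.
Qed.

Lemma csum_bounded : exists N : nat,
  forall i : int, (N < `|i|)%N -> is_zero_rep (cobj_sum (X i) (Y i)).
Proof.
have [M HM] := cd_bounded X; have [N HN] := cd_bounded Y.
exists (M + N)%N => i Hi; apply: rsum_zero; [apply: HM | apply: HN]; lia.
Qed.

Definition csum : cpx C := Cpx csum_shape csum_dd csum_bounded.

Lemma cinl_proof i j : rheq (rcomp (cd csum i j) (rinl (X i) (Y i)))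
  (rcomp (rinl (X j) (Y j)) (cd X i j)).
Proof.
apply: rheqE => v u.
by rewrite /= !comp_lfunE mat_homE !pinlE /= !zero_lfunE !linear0 !addr0.
Qed.
Definition cinl : cmap X csum := @CMap K C X csum (fun i => rinl (X i) (Y i)) cinl_proof.

Lemma cinr_proof i j : rheq (rcomp (cd csum i j) (rinr (X i) (Y i)))
  (rcomp (rinr (X j) (Y j)) (cd Y i j)).
Proof.
apply: rheqE => v u.
by rewrite /= !comp_lfunE mat_homE !pinrE /= !zero_lfunE !linear0 !add0r.
Qed.
Definition cinr : cmap Y csum := @CMap K C Y csum (fun i => rinr (X i) (Y i)) cinr_proof.

Lemma cfst_proof i j : rheq (rcomp (cd X i j) (rfst (X i) (Y i)))
  (rcomp (rfst (X j) (Y j)) (cd csum i j)).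
Proof.
apply: rheqE => v u.
by rewrite /= !comp_lfunE mat_homE !pfstE /= !zero_lfunE !addr0.
Qed.
Definition cfst : cmap csum X := @CMap K C csum X (fun i => rfst (X i) (Y i)) cfst_proof.

Lemma csnd_proof i j : rheq (rcomp (cd Y i j) (rsnd (X i) (Y i)))
  (rcomp (rsnd (X j) (Y j)) (cd csum i j)).
Proof.
apply: rheqE => v u.
by rewrite /= !comp_lfunE mat_homE !psndE /= !zero_lfunE !add0r.
Qed.
Definition csnd : cmap csum Y := @CMap K C csum Y (fun i => rsnd (X i) (Y i)) csnd_proof.

Lemma csum_split : split_triangle cinl csnd (c0 Y (cshift 1 X)).
Proof.
exists (fun i => rinr (X i) (Y i)), (fun i => rfst (X i) (Y i)) => i; split => v /=.
- exact: pfst_inl.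
- exact: psnd_inr.
- exact: pair_id.
- apply/lfunP => u.
  by rewrite !comp_lfunE mat_homE pfstE pinrE /= !zero_lfunE !linear0 addr0.
Qed.

End Sum.

(* The cone of the identity of X, with X^i + X^(i+1) in degree i: it is acyclic,
   so that an additive invariant changes sign under a shift. *)
Section IdentityCone.
Variable X : cpx C.

Let kd i j : rhom (cobj_sum (X i) (X (i + 1))) (cobj_sum (X j) (X (j + 1))) :=
  rmat (cd X i j) (transport X (i + 1) j) (rzero _ _)
    (rscale (-1) (cd X (i + 1) (j + 1))).

Lemma idcone_shape i j : j != i + 1 -> rheq (kd i j) (rzero _ _).
Proof.
move=> ij; apply: rheqE => v u.
rewrite rmatE /= !zero_lfunE scale_lfunE !cd_shapeE//; last by rewrite (inj_eq (addIr 1)).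
by rewrite transport_neq 1?eq_sym// zero_lfunE scaler0 !addr0.
Qed.

Lemma idcone_dd i j k : rheq (rcomp (kd j k) (kd i j)) (rzero _ _).
Proof.
apply: rheqE => v u.
rewrite /= comp_lfunE !mat_homE /= !zero_lfunE !scale_lfunE !add0r.
rewrite linearD /= cd_cdE !linearZ /= cd_cdE scaler0 scaler0 add0r.
have [->|ij] := eqVneq j (i + 1); last first.
  rewrite transport_neq 1?eq_sym// zero_lfunE linear0 add0r.
  by rewrite cd_shapeE ?(inj_eq (addIr 1))// linear0 scaler0.
rewrite transport_id id_lfunE.
have [->|jk] := eqVneq k (i + 1 + 1).
  by rewrite transport_id id_lfunE scaleN1r subrr.
by rewrite cd_shapeE// transport_neq 1?eq_sym// zero_lfunE scaler0 addr0.
Qed.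

Lemma idcone_bounded : exists N : nat,
  forall i : int, (N < `|i|)%N -> is_zero_rep (cobj_sum (X i) (X (i + 1))).
Proof.
have [N HN] := cd_bounded X.
exists N.+1 => i Hi; apply: rsum_zero; apply: HN; lia.
Qed.

Definition idcone : cpx C := Cpx idcone_shape idcone_dd idcone_bounded.

Lemma idcone_inl_proof i j : rheq (rcomp (cd idcone i j) (rinl (X i) (X (i + 1))))
  (rcomp (rinl (X j) (X (j + 1))) (cd X i j)).
Proof.
apply: rheqE => v u.
by rewrite /= !comp_lfunE mat_homE !pinlE /= !zero_lfunE !linear0 !addr0.
Qed.
Definition idcone_inl : cmap X idcone := @CMap K C X idcone (fun i => rinl (X i) (X (i + 1))) idcone_inl_proof.

Lemma idcone_snd_proof i j :
  rheq (rcomp (cd (cshift 1 X) i j) (rsnd (X i) (X (i + 1))))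
    (rcomp (rsnd (X j) (X (j + 1))) (cd idcone i j)).
Proof.
apply: rheqE => v u.
by rewrite /= !comp_lfunE mat_homE !psndE /= !zero_lfunE !scale_lfunE add0r expr1z.
Qed.
Definition idcone_snd : cmap idcone (cshift 1 X) := @CMap K C idcone (cshift 1 X) (fun i => rsnd (X i) (X (i + 1)))
    idcone_snd_proof.

Lemma idcone_split : split_triangle idcone_inl idcone_snd (cid (cshift 1 X)).
Proof.
exists (fun i => rinr (X i) (X (i + 1))), (fun i => rfst (X i) (X (i + 1))) => i; split => v /=.
- exact: pfst_inl.
- exact: psnd_inr.
- exact: pair_id.
- apply/lfunP => u.
  rewrite !comp_lfunE mat_homE pfstE pinrE /= linear0 add0r transport_id.
  by rewrite !id_lfunE.
Qed.

(** A cocycle (x, y) of the cone satisfies y = - d x, so it is the coboundary of (0, x). *)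
Lemma idcone_zero : isom (zero_cpx C : Db C) idcone.
Proof.
apply: (@isom_qis _ _ _ _ (c0 (zero_cpx C) idcone)).
apply: largeW (largeT C) _ => v _ i _ ->; split.
  by move=> x _ _; exists 0; rewrite (zero_cpx_eq0 x) linear0.
move=> [x y] xy; exists 0; split; first by move=> k; rewrite linear0.
have := xy (i + 1 + 1); rewrite /= mat_homE /= transport_id id_lfunE => -[H _].
have -> : y = - rf (cd X (i + 1) (i + 1 + 1)) v x.
  by rewrite -[RHS]addr0 -H addKr.
exists (0, x); rewrite zero_lfunE add0r mat_homE /= linear0 add0r zero_lfunE add0r.
by rewrite scale_lfunE scaleN1r transport_id id_lfunE.
Qed.

End IdentityCone.

Section AdditiveInvariant.
Variables (V : zmodType) (F : Db C -> V).
Hypothesis FK : K_hom F.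

Lemma K_hom_sum X Y : F (csum X Y) = F X + F Y.
Proof. exact: (K_hom_split FK (csum_split X Y)). Qed.

Lemma K_hom_shift1 X : F (cshift 1 X) = - F X.
Proof.
have := K_hom_split FK (idcone_split X).
rewrite -(K_hom_isom FK (idcone_zero X)) (K_hom_zero FK) => /esym/eqP.
by rewrite addrC addr_eq0 => /eqP.
Qed.

Lemma K_hom_shift n X : F (cshift n X) = if odd `|n|%N then - F X else F X.
Proof.
have pos (k : nat) (Y : cpx C) : F (cshift k Y) = if odd k then - F Y else F Y.
  elim: k => [|k IH]; first exact: (K_hom_isom FK (cshift0 Y)).
  rewrite intS -(K_hom_isom FK (cshift_add 1 k Y)) K_hom_shift1 IH /=.
  by case: (odd k); rewrite ?opprK.
case: n => [k|k]; first exact: pos.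
have k0 : (k.+1)%:Z + Negz k = 0 by rewrite NegzE subrr.
have := K_hom_isom FK (cshift_opp X k0).
rewrite pos => <-; rewrite [absz _]/=.
by case: (odd k.+1); rewrite ?opprK.
Qed.

End AdditiveInvariant.

End ComplexSum.

Lemma override_at (I : eqType) (T : I -> Type) (f : forall i, T i) (i0 : I) (x : T i0) :
  exists f' : forall i, T i, f' i0 = x /\ forall i, i0 != i -> f' i = f i.
Proof.
exists (fun i => match i0 =P i with
  | ReflectT e => eq_rect i0 T x i e
  | ReflectF _ => f i
  end); split; first by case: eqP => // e; rewrite eq_axiomK.
by move=> i; case: eqP.
Qed.

(** * Finite coproducts of shifts of O_X and their classes *)

Section CoherentSums.
Variable K : fieldType.

Lemma pair_eq0 (V W : vectType K) (p : (V * W)%type) :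
  pfst p = 0 -> psnd p = 0 -> p = 0.
Proof. by rewrite pfstE psndE; case: p => v w /= -> ->. Qed.

Lemma gr_rel_sum (V W : rep K gr_quiver) :
  gr_rel V -> gr_rel W -> gr_rel (rsum_rep V W).
Proof.
have mE i d p : mulx (rsum_rep V W) i d p = (mulx V i d p.1, mulx W i d p.2).
  exact: rsum_mE.
move=> [cV fV [NV gV]] [cW fW [NW gW]]; split.
- move=> i j d; apply/lfunP => p; rewrite !comp_lfunE !mE /=.
  by rewrite -!comp_lfunE cV cW.
- move=> d; apply/lfunP => p; rewrite sum_lfunE zero_lfunE.
  have := congr1 (fun f => fun_of_lfun f p.1) (fV d).
  have := congr1 (fun f => fun_of_lfun f p.2) (fW d).
  rewrite !sum_lfunE !zero_lfunE => hW hV.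
  apply: pair_eq0; rewrite linear_sum.
  + rewrite -[RHS]hV; apply: eq_bigr => i _.
    by rewrite /= pfstE !comp_lfunE !mE.
  + rewrite -[RHS]hW; apply: eq_bigr => i _.
    by rewrite /= psndE !comp_lfunE !mE.
- exists (NV + NW)%N => d Nd; apply/eqP; rewrite eqEsubv subvf /=.
  have eV : (\sum_(i < 5) limg (mulx V i d) = fullv)%VS by apply: gV; lia.
  have eW : (\sum_(i < 5) limg (mulx W i d) = fullv)%VS by apply: gW; lia.
  apply/subvP => p _; have -> : p = pinl p.1 + pinr p.2.
    rewrite -[LHS]id_lfunE -pair_id add_lfunE !comp_lfunE pfstE psndE //.
  apply: rpredD.
  + have : p.1 \in (\sum_(i < 5) limg (mulx V i d))%VS by rewrite eV memvf.
    move=> /memv_sumP[u Hu ->]; rewrite linear_sum; apply: memv_sumr => i _.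
    have /memv_imgP[u' _ ->] := Hu i isT.
    rewrite /=; have -> : pinl (mulx V i d u') = mulx (rsum_rep V W) i d (pinl u').
      by rewrite mE !pinlE /= linear0.
    exact/memv_img/memvf.
  + have : p.2 \in (\sum_(i < 5) limg (mulx W i d))%VS by rewrite eW memvf.
    move=> /memv_sumP[u Hu ->]; rewrite linear_sum; apply: memv_sumr => i _.
    have /memv_imgP[u' _ ->] := Hu i isT.
    rewrite /=; have -> : pinr (mulx W i d u') = mulx (rsum_rep V W) i d (pinr u').
      by rewrite mE !pinrE /= linear0.
    exact/memv_img/memvf.
Qed.

Variable O : cobj (CohX K).
Let csumX := (@csum K (CohX K) gr_rel_sum).
Let Dm := Db (CohX K).

(* is_coproduct with the ordinals below m n replaced by bounded naturals, so
   that a multiplicity can be raised by one without a cast *)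
Definition coproduct_on (m : int -> nat) (P : Dm)
    (inc : forall n, nat -> mor (OX O (- n)) P) : Prop :=
  forall (Y : Dm) (g : forall n, nat -> mor (OX O (- n)) Y),
    exists u : mor P Y,
      (forall n j, (j < m n)%N -> eqm (cmp u (inc n j)) (g n j)) /\
      forall u', (forall n j, (j < m n)%N -> eqm (cmp u' (inc n j)) (g n j)) ->
        eqm u' u.

Lemma coproduct_zero : @coproduct_on (fun=> 0%N) (zero_cpx (CohX K))
  (fun n _ => zrm _ _).
Proof.
move=> Y g; exists (zrm _ _); split => // u' _.
have e : eqm (idm (zero_cpx (CohX K) : Dm)) (zrm _ _).
  by apply: Dmap_eq => i v; apply/lfunP => u; rewrite (zero_cpx_eq0 u) !linear0.
apply: eqm_trans (eqm_sym (cmpm1 u')) _.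
apply: eqm_trans (cmp_eqmr u' e) _; exact: cmpm0.
Qed.

Lemma csum_biproduct (X Y : cpx (CohX K)) (i1 := Dmap (@cinl K (CohX K) gr_rel_sum X Y))
   (i2 := Dmap (@cinr K (CohX K) gr_rel_sum X Y)) (p1 := Dmap (@cfst K (CohX K) gr_rel_sum X Y))
   (p2 := Dmap (@csnd K (CohX K) gr_rel_sum X Y)) :
  [/\ Deq (Dcomp p1 i1) (Dmap (cid X)), Deq (Dcomp p2 i2) (Dmap (cid Y)),
     Deq (Dcomp p1 i2) (Dmap (c0 Y X)), Deq (Dcomp p2 i1) (Dmap (c0 X Y)) &
     Deq (Dadd (Dcomp i1 p1) (Dcomp i2 p2)) (Dmap (cid (csumX X Y)))].
Proof.
split.
- apply: Deq_trans (Deq_sym (DmapM _ _)) _; apply: Dmap_eq => i v; exact: pfst_inl.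
- apply: Deq_trans (Deq_sym (DmapM _ _)) _; apply: Dmap_eq => i v; exact: psnd_inr.
- apply: Deq_trans (Deq_sym (DmapM _ _)) _; apply: Dmap_eq => i v; exact: pfst_inr.
- apply: Deq_trans (Deq_sym (DmapM _ _)) _; apply: Dmap_eq => i v; exact: psnd_inl.
- apply: Deq_trans (Deq_add (Deq_sym (DmapM _ _)) (Deq_sym (DmapM _ _))) _.
  apply: Deq_trans (Deq_sym (DmapD _ _)) _; apply: Dmap_eq => i v; exact: pair_id.
Qed.

(** The new copy of O[-n0] takes the first free index [m n0]; the universal property then follows
    from the biproduct equations. *)
Lemma coproduct_succ (m : int -> nat) (n0 : int) (P : cpx (CohX K))
    (inc : forall n, nat -> @mor _ Dm (OX O (- n)) P) :
  @coproduct_on m P inc ->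
  exists inc', @coproduct_on (fun n => (m n + (n == n0))%N) (csumX (OX O (- n0)) P) inc'.
Proof.
move=> cop; have [e11 e22 e12 e21 eid] := csum_biproduct (OX O (- n0)) P.
set i1 := Dmap (cinl _ _ _) in e11 e21 eid; set i2 := Dmap (cinr _ _ _) in e22 e12 eid.
set p1 := Dmap (cfst _ _ _) in e11 e12 eid; set p2 := Dmap (csnd _ _ _) in e21 e22 eid.
pose inc0 n j : @mor _ Dm (OX O (- n)) (csumX (OX O (- n0)) P) := @cmp _ Dm _ _ _ i2 (inc n j).
have [inc' [inc'e inc'n]] := @override_at int _ inc0 n0
  (fun j : nat => if j == m n0 then i1 else inc0 n0 j).
exists inc' => Y g; have [u [u1 u2]] := cop Y g.
have inc'1 : inc' n0 (m n0) = i1 by rewrite inc'e eqxx.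
have inc'2 n j : (j < m n)%N -> inc' n j = inc0 n j.
  move=> jm; have [e|ne] := eqVneq n0 n; last by rewrite inc'n.
  by move: jm; rewrite -e => jm; rewrite inc'e ltn_eqF.
have cases n j : (j < m n + (n == n0))%N -> (j < m n)%N \/ n = n0 /\ j = m n0.
  by have [->|_] := eqVneq n n0; rewrite ?addn0 ?addn1 ?ltnS; [rewrite leq_eqVlt => /orP[/eqP|]; auto | auto].
exists (@addm _ Dm _ _ (@cmp _ Dm _ _ _ (g n0 (m n0)) p1) (@cmp _ Dm _ _ _ u p2)); split.
- move=> n j /cases[jm|[-> ->]].
  + rewrite inc'2//; apply: eqm_trans (u1 n j jm); apply: eqm_trans (cmpA _ _ _) _.
    apply: cmp_eqml; apply: eqm_trans (cmpDl _ _ _) _.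
    apply: eqm_trans (add0m u); apply: addm_eqm.
      apply: eqm_trans (eqm_sym (cmpA _ _ _)) _.
      apply: eqm_trans (cmp_eqmr _ (e12 : @eqm _ Dm _ _ _ _)) _; exact: cmpm0.
    apply: eqm_trans (eqm_sym (cmpA _ _ _)) _.
    apply: eqm_trans (cmp_eqmr _ (e22 : @eqm _ Dm _ _ _ _)) _; exact: cmpm1.
  + rewrite inc'1; apply: eqm_trans (cmpDl _ _ _) _.
    apply: eqm_trans (addm0 _); apply: addm_eqm.
      apply: eqm_trans (eqm_sym (cmpA _ _ _)) _.
      apply: eqm_trans (cmp_eqmr _ (e11 : @eqm _ Dm _ _ _ _)) _; exact: cmpm1.
    apply: eqm_trans (eqm_sym (cmpA _ _ _)) _.
    apply: eqm_trans (cmp_eqmr _ (e21 : @eqm _ Dm _ _ _ _)) _; exact: cmpm0.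
- move=> u' Hu'.
  apply: eqm_trans (eqm_sym (cmpm1 u')) _.
  apply: eqm_trans (cmp_eqmr u' (eqm_sym (eid : @eqm _ Dm _ _ _ _))) _.
  apply: eqm_trans (cmpDr _ _ _) _; apply: addm_eqm; apply: eqm_trans (cmpA _ _ _) _; apply: cmp_eqml.
  + have := Hu' n0 (m n0); rewrite inc'1; apply; by rewrite eqxx addn1.
  + apply: u2 => n j jm; have jm' : (j < m n + (n == n0))%N by apply: ltn_addr.
    apply: eqm_trans (Hu' n j jm'); rewrite inc'2//.
    exact: eqm_sym (cmpA _ _ _).
Qed.

Lemma eq_coproduct m m' (P : Dm) inc : m =1 m' ->
  @coproduct_on m P inc -> @coproduct_on m' P inc.
Proof.
move=> e H Y g; have [u [h1 h2]] := H Y g; exists u.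
by split=> [n j|u' Hu']; rewrite -?e; [exact: h1 | apply: h2 => n j; rewrite e; exact: Hu'].
Qed.

Section Invariant.
Variables (V : zmodType) (F : Dm -> V).
Hypothesis FK : K_hom F.

(** A concrete model, built one summand at a time by induction on the total multiplicity t, so that
    the class is known by additivity. [coproduct_isom] carries it over to any other coproduct. *)
Lemma coproduct_exists (t N : nat) (m : int -> nat) :
  (forall n : int, (N < `|n|)%N -> m n = 0%N) ->
  (\sum_(k < N.*2.+1) m (k%:Z - N%:Z)%R)%N = t ->
  exists (P : Dm) inc, @coproduct_on m P inc /\
    F P = \sum_(k < N.*2.+1) F (OX O (- (k%:Z - N%:Z))) *+ m (k%:Z - N%:Z).
Proof.
elim: t m => [|t IH] m mN mt.
  have m0 n : m n = 0%N.
    have [nN|nN] := ltnP N `|n|%N; first exact: mN.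
    have k0 : (`|(n + N%:Z)%R|%N < N.*2.+1)%N by lia.
    have kE : (`|(n + N%:Z)%R|%N)%:Z - N%:Z = n by lia.
    move: mt => /eqP; rewrite sum_nat_eq0 => /forallP/(_ (Ordinal k0)) /=.
    by rewrite kE => /eqP.
  exists (zero_cpx _), (fun n _ => zrm _ _); split.
    by apply: eq_coproduct coproduct_zero => n; rewrite m0.
  by rewrite (K_hom_zero FK) big1// => k _; rewrite m0.
have [k0 k0P] : exists k : 'I_(N.*2.+1), m (k%:Z - N%:Z) != 0%N.
  apply/existsP; apply: contraT; rewrite negb_exists => /forallP H.
  by move: mt; rewrite big1// => k _; apply/eqP; have := H k; rewrite negbK.
pose n0 := k0%:Z - N%:Z; pose m' n := if n == n0 then (m n).-1 else m n.
have mE n : (m' n + (n == n0))%N = m n.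
  by rewrite /m'; case: eqP => [->|_]; rewrite ?addn0// addn1 prednK// lt0n.
have inj (k : 'I_(N.*2.+1)) : (k%:Z - N%:Z == n0) = (k == k0).
  by rewrite /n0 (inj_eq (addIr _)) -val_eqE /=; apply/eqP/eqP => [[]|->].
have [|| P [inc [cop FP]]] := IH m'.
- by move=> n nN; have := mE n; rewrite mN//; lia.
- move: mt; rewrite (bigD1 k0)// [in X in _ -> X](bigD1 k0)//=.
  rewrite /m' -/n0 eqxx; have := k0P; rewrite -/n0; case: (m n0) => //= a _ [<-].
  congr (_ + _)%N; apply: eq_bigr => k kk0.
  by rewrite inj (negPf kk0).
have [inc' cop'] := coproduct_succ n0 cop.
exists (csumX (OX O (- n0)) P), inc'; split; first exact: eq_coproduct mE cop'.
rewrite (K_hom_sum _ FK) FP (bigD1 k0)// [in RHS](bigD1 k0)//= addrA; congr (_ + _).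
  by rewrite /m' -/n0 eqxx -mulrS prednK// lt0n.
by apply: eq_bigr => k kk0; rewrite /m' inj (negPf kk0).
Qed.

Lemma coproduct_isom m (P P' : Dm) (inc : forall n, 'I_(m n) -> mor (OX O (- n)) P)
    (inc' : forall n, nat -> mor (OX O (- n)) P') :
  is_coproduct inc -> coproduct_on m inc' -> isom P P'.
Proof.
move=> cop cop'.
pose g n (j : nat) : mor (OX O (- n)) P := if insub j is Some k then inc n k else zrm _ _.
have gE n (j : 'I_(m n)) : g n j = inc n j.
  by rewrite /g; case: insubP => [k _ /val_inj ->|]//; rewrite ltn_ord.
have [u [u1 _]] := cop P' (fun n j => inc' n (j : nat)).
have [w [w1 _]] := cop' P g.
exists u, w; split.
- have [z [_ zu]] := cop P inc; apply: eqm_trans (zu _ _) (eqm_sym (zu _ _)).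
    move=> n j; apply: eqm_trans (eqm_sym (cmpA _ _ _)) _.
    apply: eqm_trans (cmp_eqmr w (u1 n j)) _.
    by apply: eqm_trans (w1 n j (ltn_ord j)) _; rewrite gE; exact: eqm_refl.
  by move=> n j; exact: cmp1m.
- have [z [_ zu]] := cop' P' inc'; apply: eqm_trans (zu _ _) (eqm_sym (zu _ _)).
    move=> n j jm; apply: eqm_trans (eqm_sym (cmpA _ _ _)) _.
    apply: eqm_trans (cmp_eqmr u (w1 n j jm)) _.
    have /= -> := gE n (Ordinal jm); exact: (u1 n (Ordinal jm)).
  by move=> n j _; exact: cmp1m.
Qed.

Lemma K_hom_coproduct (N : nat) (m : int -> nat) (P : Dm) inc :
  (forall n : int, (N < `|n|)%N -> m n = 0%N) -> @is_coproduct _ O m P inc ->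
  F P = \sum_(k < N.*2.+1) F (OX O (- (k%:Z - N%:Z))) *+ m (k%:Z - N%:Z).
Proof.
move=> mN cop; have [P' [inc' [cop' <-]]] := coproduct_exists mN (erefl _).
exact: (K_hom_isom FK (coproduct_isom cop cop')).
Qed.

End Invariant.
End CoherentSums.

(** * Cohomology as an invariant of formal morphisms *)

Section Cohomology.
Variables (K : fieldType) (C : repcat K).
Hypothesis largeI : forall A B : vtx (cquiv C) -> Prop,
  large A -> large B -> large (fun v => A v /\ B v).
Implicit Types X Y Z : cpx C.

(* The cohomology of X in degree i at v, as a complement of the coboundaries *)
(* in the cocycles, is the image of this projector.                          *)
Definition hproj X v (i : int) : 'End(rv (X i) v) :=
  let B := limg (rf (cd X (i - 1) i) v) in
  daddv_pi (lker (rf (cd X i (i + 1)) v) :\: B) B.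

Lemma coboundary_cocycle X v i : (limg (rf (cd X (i - 1) i) v) <= lker (rf (cd X i (i + 1)) v))%VS.
Proof.
by apply/subvP => u /memv_imgP[y _ ->]; rewrite memv_ker cd_cdE.
Qed.

Lemma hproj_mem X v i x : hproj X v i x \in lker (rf (cd X i (i + 1)) v).
Proof. by apply: (subvP (diffvSl _ _)); exact: memv_pi. Qed.

Lemma hproj_cocycle X v i x : cocycle (hproj X v i x).
Proof.
move=> k; have [->|ki] := eqVneq k (i + 1); last by rewrite cd_shapeE.
by apply/eqP; rewrite -memv_ker hproj_mem.
Qed.

Lemma hproj_id X v i x : hproj X v i (hproj X v i x) = hproj X v i x.
Proof. by apply: daddv_pi_id; [exact: capv_diff | exact: memv_pi]. Qed.

Lemma hproj_sub X v i (z : rv (X i) v) : cocycle z ->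
  exists y, z - hproj X v i z = rf (cd X (i - 1) i) v y.
Proof.
move=> Hz; set B := limg (rf (cd X (i - 1) i) v).
have zA : z \in (lker (rf (cd X i (i + 1)) v) :\: B + B)%VS.
  by rewrite addv_diff (addv_idPl (coboundary_cocycle X v i)) memv_ker Hz.
have /memv_imgP[y _ yE] := memv_pi B (lker (rf (cd X i (i + 1)) v) :\: B)%VS z.
exists y; rewrite -yE -[X in X - _](daddv_pi_add (capv_diff _ _) zA) addrAC subrr.
exact: add0r.
Qed.

Lemma hproj_coboundary X v i k y : hproj X v i (rf (cd X k i) v y) = 0.
Proof.
have [ik|ik] := eqVneq i (k + 1); last by rewrite cd_shapeE// linear0.
move: y; have {ik} -> : k = i - 1 by rewrite ik addrK.
move=> y; rewrite /hproj; set B := limg _; set z := rf _ _ _.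
have zB : z \in B by exact/memv_img/memvf.
have zA : z \in (lker (rf (cd X i (i + 1)) v) :\: B + B)%VS.
  by rewrite (subvP (addvSr _ _)).
have := daddv_pi_add (capv_diff _ _) zA; rewrite [X in _ + X]daddv_pi_id//.
  by move=> /(canRL (addrK _)); rewrite subrr.
by rewrite capvC; exact: capv_diff.
Qed.

Lemma hproj_eq0P X v i : hproj X v i = 0 <->
  forall x : rv (X i) v, cocycle x -> exists y, x = rf (cd X (i - 1) i) v y.
Proof.
split=> [H x /hproj_sub[y]|H]; first by rewrite H zero_lfunE subr0 => ->; exists y.
apply/lfunP => x; rewrite zero_lfunE -hproj_id.
by have [y ->] := H _ (hproj_cocycle x); rewrite hproj_coboundary.
Qed.

Lemma cfE X Y (f : cmap X Y) i j v u :
  rf (cd Y i j) v (rf (cf f i) v u) = rf (cf f j) v (rf (cd X i j) v u).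
Proof. by have /= := cfP f i j v; rewrite -!comp_lfunE => ->. Qed.

Lemma cf_cocycle X Y (f : cmap X Y) i v (u : rv (X i) v) :
  cocycle u -> cocycle (rf (cf f i) v u).
Proof. by move=> Hu k; rewrite cfE Hu linear0. Qed.

Definition hmap X Y (f : cmap X Y) v i : 'Hom(rv (X i) v, rv (Y i) v) :=
  (hproj Y v i \o (rf (cf f i) v \o hproj X v i))%VF.

Lemma hmapE X Y (f : cmap X Y) v i x : cocycle x ->
  hmap f v i x = hproj Y v i (rf (cf f i) v x).
Proof.
move=> /hproj_sub[y xy]; rewrite !comp_lfunE.
have -> : hproj X v i x = x - rf (cd X (i - 1) i) v y by rewrite -xy subKr.
by rewrite !linearB /= -cfE hproj_coboundary subr0.
Qed.

(** The inverse of [hmap] between the images of the two projectors; the last two equations say that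
    h factors through these images. *)
Definition hinv_spec X Y (f : cmap X Y) v i (h : 'Hom(rv (Y i) v, rv (X i) v)) : Prop :=
  [/\ (h \o hmap f v i)%VF = hproj X v i, (hmap f v i \o h)%VF = hproj Y v i,
      (hproj X v i \o h)%VF = h & (h \o hproj Y v i)%VF = h].

(** A quasi-isomorphism is one only on a large set of vertices, while [hact] must be defined at
    every vertex; hence the default 0. *)
Definition hinv X Y (f : cmap X Y) v i : 'Hom(rv (Y i) v, rv (X i) v) :=
  match pselect (exists h, hinv_spec f h) with
  | left e => projT1 (boolp.cid e)
  | right _ => 0
  end.

Lemma hprojK X v i : (hproj X v i \o hproj X v i)%VF = hproj X v i.
Proof. by apply/lfunP => x; rewrite comp_lfunE hproj_id. Qed.

Lemma hproj_hmap X Y (f : cmap X Y) v i : (hproj Y v i \o hmap f v i)%VF = hmap f v i.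
Proof. by rewrite /hmap comp_lfunA hprojK. Qed.

Lemma hmap_hproj X Y (f : cmap X Y) v i : (hmap f v i \o hproj X v i)%VF = hmap f v i.
Proof. by rewrite /hmap -!comp_lfunA hprojK. Qed.

Lemma hinv_exists X Y (f : cmap X Y) v i : qis_at v f -> exists h, hinv_spec f (v := v) (i := i) h.
Proof.
move=> Hf; have [G GE] : exists G, G = hmap f v i by eexists.
have GhX x : G (hproj X v i x) = G x.
  by have := congr1 (fun h => fun_of_lfun h x) (hmap_hproj f v i); rewrite -GE comp_lfunE.
have GhY x : hproj Y v i (G x) = G x.
  by have := congr1 (fun h => fun_of_lfun h x) (hproj_hmap f v i); rewrite -GE comp_lfunE.
rewrite /hinv_spec -GE.
have [inj sur] := Hf (i - 1) i (esym (subrK 1 i)).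
have Ginj x : G (hproj X v i x) = 0 -> hproj X v i x = 0.
  rewrite GE hmapE; last exact: hproj_cocycle.
  move=> H; have /hproj_sub[y] := cf_cocycle f (hproj_cocycle x).
  rewrite H subr0 => yE.
  have [|x' e] := inj (hproj X v i x) (hproj_cocycle x); first by exists y.
  by rewrite -hproj_id e hproj_coboundary.
have Gsur y : hproj Y v i y \in limg G.
  have [x [xc [y' e]]] := sur _ (hproj_cocycle y).
  rewrite -hproj_id e linearD /= hproj_coboundary addr0 -(hmapE f xc) -GE.
  exact/memv_img/memvf.
have GinvE y : G (hproj X v i (G^-1%VF (hproj Y v i y))) = hproj Y v i y.
  by rewrite GhX limg_lfunVK.
exists (hproj X v i \o (G^-1 \o hproj Y v i))%VF; split.
- apply/lfunP => x; rewrite !comp_lfunE; apply/eqP; rewrite -subr_eq0.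
  rewrite -[hproj X v i x]hproj_id -linearB; apply/eqP/Ginj.
  rewrite GhX linearB /= GhX GhY limg_lfunVK ?subrr//.
  exact/memv_img/memvf.
- by apply/lfunP => y; rewrite !comp_lfunE GinvE.
- by rewrite comp_lfunA hprojK.
- by rewrite -!comp_lfunA hprojK.
Qed.

Lemma hinvP X Y (f : cmap X Y) v i : qis_at v f -> hinv_spec f (hinv f v i).
Proof.
move=> /(hinv_exists i) H; rewrite /hinv; case: pselect => // e.
exact: (projT2 (boolp.cid e)).
Qed.

Lemma hinv_proj X Y (f : cmap X Y) v i :
  (hproj X v i \o hinv f v i)%VF = hinv f v i /\
  (hinv f v i \o hproj Y v i)%VF = hinv f v i.
Proof.
rewrite /hinv; case: pselect => [e|_]; last by rewrite comp_lfun0r comp_lfun0l.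
by case: (projT2 (boolp.cid e)).
Qed.

(** The cohomology functor on formal expressions. It does not respect [Deq] at every vertex, only on
    a large set depending on the derivation ([hact_eq]). *)
Fixpoint hact X Y (f : Dmor X Y) v i : 'Hom(rv (X i) v, rv (Y i) v) :=
  match f in Dmor X Y return 'Hom(rv (X i) v, rv (Y i) v) with
  | Dmap _ _ f => hmap f v i
  | Dinv _ _ f _ => hinv f v i
  | Dcomp _ _ _ g f => (hact g v i \o hact f v i)%VF
  | Dadd _ _ f g => hact f v i + hact g v i
  | Dscale _ _ a f => a *: hact f v i
  end.

Lemma hact_proj X Y (f : Dmor X Y) v i :
  (hproj Y v i \o hact f v i)%VF = hact f v i /\
  (hact f v i \o hproj X v i)%VF = hact f v i.
Proof.
elim: f => {X Y} [X Y f|X Y f Hf|X Y Z g [g1 g2] f [f1 f2]|X Y f [f1 f2] g [g1 g2]|X Y a f [f1 f2]] /=.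
- by rewrite hproj_hmap hmap_hproj.
- exact: hinv_proj.
- by rewrite comp_lfunA g1 -comp_lfunA f2.
- by rewrite comp_lfunDr comp_lfunDl f1 f2 g1 g2.
- by rewrite -comp_lfunZr -comp_lfunZl f1 f2.
Qed.

Lemma hmap_id X v i : hmap (cid X) v i = hproj X v i.
Proof. by rewrite /hmap /= comp_lfun1l hprojK. Qed.

Lemma hmap0 X Y v i : hmap (c0 X Y) v i = 0.
Proof. by rewrite /hmap /= comp_lfun0l comp_lfun0r. Qed.

Lemma hmapM X Y Z (g : cmap Y Z) (f : cmap X Y) v i :
  hmap (ccomp g f) v i = (hmap g v i \o hmap f v i)%VF.
Proof.
apply/lfunP => x; rewrite /hmap /= !comp_lfunE hproj_id.
set w := rf (cf f i) v _.
have wc : cocycle w by exact/cf_cocycle/hproj_cocycle.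
have [y e] := hproj_sub wc.
have -> : hproj Y v i w = w - rf (cd Y (i - 1) i) v y by rewrite -e subKr.
by rewrite !linearB /= -cfE hproj_coboundary subr0.
Qed.

Lemma hact_eq X Y (f g : Dmor X Y) : Deq f g ->
  large (fun v => forall i, hact f v i = hact g v i).
Proof.
have all (A : vtx (cquiv C) -> Prop) : (forall v, A v) -> large A.
  by move=> HA; apply: largeW (largeT C) _.
elim=> {X Y f g}.
- by move=> X Y f; apply: all.
- by move=> X Y f g _ H; apply: largeW H _ => v H i; rewrite H.
- move=> X Y f g h _ H1 _ H2; apply: largeW (largeI H1 H2) _ => v [h1 h2] i.
  by rewrite h1 h2.
- move=> X Y Z g g' f f' _ H1 _ H2; apply: largeW (largeI H1 H2) _ => v [h1 h2] i /=.
  by rewrite h1 h2.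
- move=> X Y f f' g g' _ H1 _ H2; apply: largeW (largeI H1 H2) _ => v [h1 h2] i /=.
  by rewrite h1 h2.
- by move=> X Y a f f' _ H; apply: largeW H _ => v H i /=; rewrite H.
- by move=> *; apply: all => v i /=; rewrite comp_lfunA.
- move=> X Y f; apply: all => v i /=; rewrite hmap_id; exact: (hact_proj f v i).1.
- move=> X Y f; apply: all => v i /=; rewrite hmap_id; exact: (hact_proj f v i).2.
- by move=> *; apply: all => v i /=; rewrite addrC.
- by move=> *; apply: all => v i /=; rewrite addrA.
- by move=> *; apply: all => v i /=; rewrite hmap0 add0r.
- by move=> *; apply: all => v i /=; rewrite hmap0 scale0r.
- by move=> *; apply: all => v i /=; rewrite scale1r.
- by move=> *; apply: all => v i /=; rewrite scalerA.
- by move=> *; apply: all => v i /=; rewrite scalerDl.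
- by move=> *; apply: all => v i /=; rewrite scalerDr.
- by move=> *; apply: all => v i /=; rewrite comp_lfunDl.
- by move=> *; apply: all => v i /=; rewrite comp_lfunDr.
- by move=> *; apply: all => v i /=; rewrite comp_lfunZl.
- by move=> *; apply: all => v i /=; rewrite comp_lfunZr.
- by move=> X Y f g fg; apply: all => v i /=; rewrite /hmap fg.
- by move=> *; apply: all => v i /=; rewrite hmapM.
- by move=> *; apply: all => v i /=; rewrite /hmap /= comp_lfunDl comp_lfunDr.
- by move=> *; apply: all => v i /=; rewrite /hmap /= -comp_lfunZl -comp_lfunZr.
- move=> X Y f Hf; apply: (largeW Hf) => v /hinvP Hv i /=.
  by rewrite hmap_id; have [] := Hv i.
- move=> X Y f Hf; apply: (largeW Hf) => v /hinvP Hv i /=.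
  by rewrite hmap_id; have [] := Hv i.
Qed.

(** On a large set of vertices the identity of the cohomology of Y factors through that of X, so it
    vanishes wherever the latter does. *)
Lemma in_heart_isom (X Y : Db C) : isom X Y -> in_heart X -> in_heart Y.
Proof.
move=> [f [g [_ fg]]] HX; apply: largeW (largeI (hact_eq fg) HX) _ => v [Hv HXv].
move=> i j -> j0; have X0 : hproj X v (i + 1) = 0.
  apply/hproj_eq0P => x Hx; apply: HXv Hx => //; by rewrite subrK.
have Y0 : hproj Y v (i + 1) = 0.
  rewrite -hmap_id -[hmap _ _ _]/(hact (Dmap (cid Y)) v (i + 1)) -Hv /=.
  by rewrite -(hact_proj g v (i + 1)).1 X0 comp_lfun0l comp_lfun0r.
move=> x Hx; have /hproj_eq0P/(_ x Hx)[y] := Y0.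
by move: y; rewrite addrK => y ->; exists y.
Qed.

End Cohomology.

Lemma eventuallyI (A B : nat -> Prop) : eventually A -> eventually B ->
  eventually (fun v => A v /\ B v).
Proof.
move=> [M HM] [N HN]; exists (M + N)%N => d Hd; split; [apply: HM | apply: HN]; lia.
Qed.

(** * Forgetting the equivariance on derived categories *)

Section ForgetFunctor.
Variables (K : fieldType) (xi : K).
Implicit Types X Y Z : cpx (CohGX xi).

Definition forget_map X Y (f : cmap X Y) :
    @cmap K (CohX K) (forget X) (forget Y) :=
  @CMap K (CohX K) (forget X) (forget Y) (fun i => forget_hom (cf f i))
    (fun i j v => cfP f i j v).

Lemma forget_qis X Y (f : cmap X Y) : qis f -> qis (forget_map f).
Proof. by move=> Hf; exact: Hf. Qed.

Fixpoint forget_mor X Y (f : Dmor X Y) :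
    @Dmor K (CohX K) (forget X) (forget Y) :=
  match f in Dmor X Y return @Dmor K (CohX K) (forget X) (forget Y) with
  | Dmap _ _ f => Dmap (forget_map f)
  | Dinv _ _ f Hf => Dinv (forget_qis Hf)
  | Dcomp _ _ _ g f => Dcomp (forget_mor g) (forget_mor f)
  | Dadd _ _ f g => Dadd (forget_mor f) (forget_mor g)
  | Dscale _ _ a f => Dscale a (forget_mor f)
  end.

Lemma forget_mor_eq X Y (f g : Dmor X Y) :
  Deq f g -> Deq (forget_mor f) (forget_mor g).
Proof.
elim=> {X Y f g} /=.
- by move=> *; exact: Deq_refl.
- by move=> *; exact: Deq_sym.
- by move=> X Y f g h _ H1 _ H2; exact: Deq_trans H1 H2.
- by move=> *; exact: Deq_comp.
- by move=> *; exact: Deq_add.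
- by move=> *; exact: Deq_scale.
- by move=> *; exact: DcompA.
- move=> X Y f; apply: Deq_trans (Dcomp1m _).
  by apply: Deq_comp; [exact: Dmap_eq | exact: Deq_refl].
- move=> X Y f; apply: Deq_trans (Dcompm1 _).
  by apply: Deq_comp; [exact: Deq_refl | exact: Dmap_eq].
- by move=> *; exact: DaddC.
- by move=> *; exact: DaddA.
- move=> X Y f; apply: Deq_trans (Dadd0m _).
  by apply: Deq_add; [exact: Dmap_eq | exact: Deq_refl].
- by move=> X Y f; apply: Deq_trans (Dscale0 _) _; exact: Dmap_eq.
- by move=> *; exact: Dscale1.
- by move=> *; exact: DscaleA.
- by move=> *; exact: DscaleDl.
- by move=> *; exact: DscaleDr.
- by move=> *; exact: DcompDl.
- by move=> *; exact: DcompDr.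
- by move=> *; exact: DcompZl.
- by move=> *; exact: DcompZr.
- by move=> X Y f g fg; apply: Dmap_eq => i; exact: fg.
- by move=> X Y Z g f; apply: Deq_trans (DmapM _ _); exact: Dmap_eq.
- by move=> X Y f g; apply: Deq_trans (DmapD _ _); exact: Dmap_eq.
- by move=> X Y a f; apply: Deq_trans (DmapZ _ _); exact: Dmap_eq.
- by move=> X Y f Hf; apply: Deq_trans (DinvL _) _; exact: Dmap_eq.
- by move=> X Y f Hf; apply: Deq_trans (DinvR _) _; exact: Dmap_eq.
Qed.

Lemma forget_isom (X Y : Db (CohGX xi)) : isom X Y -> isom (forget X) (forget Y).
Proof.
move=> [f [g [h1 h2]]]; exists (forget_mor f), (forget_mor g); split.
- by apply: Deq_trans (forget_mor_eq h1) _; exact: Dmap_eq.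
- by apply: Deq_trans (forget_mor_eq h2) _; exact: Dmap_eq.
Qed.

(** Both complexes have the same components and differentials and differ only in their packaging, so
    identity maps give the isomorphism. *)
Lemma forget_shift n X : isom (forget (cshift n X)) (cshift n (forget X)).
Proof.
have P i j : rheq (rcomp (@cd K (CohX K) (cshift n (forget X)) i j) (rid _))
  (rcomp (rid _) (@cd K (CohX K) (forget (cshift n X)) i j)).
  by move=> v; exact: etrans (comp_lfun1r _) (esym (comp_lfun1l _)).
have P' i j : rheq (rcomp (@cd K (CohX K) (forget (cshift n X)) i j) (rid _))
  (rcomp (rid _) (@cd K (CohX K) (cshift n (forget X)) i j)).
  by move=> v; exact: etrans (comp_lfun1r _) (esym (comp_lfun1l _)).
by apply: (@isom_cmap K (CohX K) _ _ (@CMap K (CohX K) (forget (cshift n X)) (cshift n (forget X)) _ P)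
  (@CMap K (CohX K) (cshift n (forget X)) (forget (cshift n X)) _ P')) => i v; exact: comp_lfun1l.
Qed.

Lemma forget_K_hom (V : zmodType) (F : Db (CohX K) -> V) :
  K_hom F -> K_hom (fun E : Db (CohGX xi) => F (forget E)).
Proof.
move=> FK X Y W f g h [X' [Y' [W' [f' [g' [h' [a [b [c [fgh [[a' ia] [[b' ib] [c' ic]]] _ _ _]]]]]]]]]].
have iso (A B : Db (CohGX xi)) (u : Dmor A B) u' : Disom_pair u u' -> F (forget A) = F (forget B).
  by move=> uu'; apply: (K_hom_isom FK); apply: forget_isom; exists u, u'.
rewrite (iso _ _ _ _ ia) (iso _ _ _ _ ib) (iso _ _ _ _ ic).
(* The components of the connecting map are reread as a chain map into the shift of the forgotten
   complex; the degreewise splittings survive forgetting. *)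
have P i j : rheq (rcomp (@cd K (CohX K) (cshift 1 (forget X')) i j) (forget_hom (cf h' i)))
  (rcomp (forget_hom (cf h' j)) (@cd K (CohX K) (forget W') i j)).
  by move=> v; exact: (cfP h' i j v).
apply: (@K_hom_split K (CohX K) V F FK (forget X') (forget Y') (forget W')
  (forget_map f') (forget_map g') (@CMap K (CohX K) (forget W') (cshift 1 (forget X')) _ P)).
have [s [r H]] := fgh.
exists (fun i => forget_hom (s i)), (fun i => forget_hom (r i)) => i.
have [h1 h2 h3 h4] := H i.
by split=> v; [exact: h1 | exact: h2 | exact: h3 | exact: h4].
Qed.

End ForgetFunctor.

Lemma functor_K_hom (K : fieldType) (S T : tricat K) (Phi : exact_functor S T)
    (V : zmodType) (F : T -> V) : K_hom F -> K_hom (fun E : S => F (Phi E)).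
Proof. by move=> FK X Y W f g h /(fdist Phi) /FK. Qed.

Section Stalks.
Variables (K : fieldType) (C : repcat K).
Implicit Types U V W : cobj C.

(** The return clause makes source and target reduce together in both cases of the degree test. *)
Definition stalk_cf V W (f : rhom V W) (i : int) : rhom (cX (stalk V) i) (cX (stalk W) i) :=
  match (i == 0) as b return
    rhom (crep (if b then V else czero C)) (crep (if b then W else czero C)) with
  | true => f
  | false => rzero _ _
  end.

Lemma stalk_map_proof V W (f : rhom V W) i j :
  rheq (rcomp (cd (stalk W) i j) (stalk_cf f i)) (rcomp (stalk_cf f j) (cd (stalk V) i j)).
Proof. by move=> v /=; rewrite comp_lfun0l comp_lfun0r. Qed.

Definition stalk_map V W (f : rhom V W) : cmap (stalk V) (stalk W) :=
  @CMap K C (stalk V) (stalk W) (stalk_cf f) (stalk_map_proof f).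

Lemma stalk_cf_comp U V W (g : rhom V W) (f : rhom U V) (h : rhom U W) i :
  rheq (rcomp g f) h -> rheq (rcomp (stalk_cf g i) (stalk_cf f i)) (stalk_cf h i).
Proof.
by rewrite /stalk_cf /= => H; case: (i == 0) => v; [exact: H | exact: comp_lfun0l].
Qed.

Lemma stalk_cf_id V i : rheq (stalk_cf (rid V) i) (rid (cX (stalk V) i)).
Proof.
rewrite /stalk_cf /=; case: (i == 0) => v //.
by apply/lfunP => u; apply/rowP => -[].
Qed.

Lemma stalk_isom V W : rep_isom V W -> isom (stalk V) (stalk W).
Proof.
move=> [f [g [gf fg]]]; apply: (@isom_cmap _ _ _ _ (stalk_map f) (stalk_map g)) => i v.
- by rewrite (stalk_cf_comp i gf) stalk_cf_id.
- by rewrite (stalk_cf_comp i fg) stalk_cf_id.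
Qed.

Lemma stalk_split U V W (f : rhom U V) (g : rhom V W) (s : rhom W V) (r : rhom V U) :
  rheq (rcomp r f) (rid U) -> rheq (rcomp g s) (rid W) ->
  rheq (radd (rcomp f r) (rcomp s g)) (rid V) ->
  split_triangle (stalk_map f) (stalk_map g) (c0 (stalk W) (cshift 1 (stalk U))).
Proof.
move=> rf gs fr; exists (stalk_cf s), (stalk_cf r) => i; split => v.
- by rewrite (stalk_cf_comp i rf) stalk_cf_id.
- by rewrite (stalk_cf_comp i gs) stalk_cf_id.
- rewrite -stalk_cf_id /= /stalk_cf; case: (i == 0); first exact: fr.
  by rewrite /= !comp_lfun0l addr0.
- by rewrite /= comp_lfun0l comp_lfun0r.
Qed.

End Stalks.

(** * Powers of tau and equivariant Beilinson sheaves *)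

Section TauPowers.
Variables (K : fieldType) (O : cobj (CohX K)).
Implicit Types E F G : Db (CohX K).

Lemma is_tau_pow_isom k E F G : is_tau_pow O k E F -> isom F G -> is_tau_pow O k E G.
Proof.
case: k => [|k] /=; first exact: isom_trans.
move=> [E1 H1 [T HT FT]] FG; exists E1 => //; exists T => //.
exact: isom_trans (isom_sym FG) FT.
Qed.

Lemma is_tau_powD a b E F G :
  is_tau_pow O a E F -> is_tau_pow O b F G -> is_tau_pow O (a + b) E G.
Proof.
move=> aEF; elim: b G => [|b IH] G; first by rewrite addn0; exact: is_tau_pow_isom.
by rewrite addnS => -[F1 /IH H1 H2]; exists F1.
Qed.

Lemma is_tau_pow_split a b E G : is_tau_pow O (a + b) E G ->
  exists2 F, is_tau_pow O a E F & is_tau_pow O b F G.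
Proof.
elim: b G => [|b IH] G; first by rewrite addn0 => H; exists G => //; exact: isom_refl.
by rewrite addnS => -[F1 /IH[F aF bF] H]; exists F => //; exists F1.
Qed.

Hypothesis tau5 : forall E F, is_tau_pow O 5 E F -> isom F (cshift 2 E).

Lemma is_tau_pow5M k E F : is_tau_pow O (5 * k) E F -> isom F (cshift (2 * k)%N E).
Proof.
elim: k F => [|k IH] F.
  by rewrite muln0 => /isom_sym H; apply: isom_trans H (isom_sym (cshift0 _)).
rewrite mulnS addnC => /is_tau_pow_split[F1 /IH H1 /tau5 H2].
apply: isom_trans H2 _; apply: isom_trans (Dshift_isom 2 H1) _.
apply: isom_trans (cshift_add _ _ _) _.
by rewrite mulnS PoszD; exact: isom_refl.
Qed.

(** Take i < 5 with n + i = 5 k. Applying tau^(n+i) to the complex underlying E gives its shift by 2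
    k on the one hand and B0[m], with B0 a Beilinson sheaf, on the other. So E[2 k - m] has
    underlying complex B0. *)
Lemma tau_pow_beilinson (xi : K) n (E : Db (CohGX xi)) :
  (forall i : nat, (i < 5)%N -> exists B, beilinson_sheaf O i B) ->
  is_tau_pow O n (forget E) (stalk O) ->
  exists (B : Db (CohGX xi)) (p : int),
    equivariant_beilinson_sheaf O B /\ isom E (cshift p B).
Proof.
move=> beil tauE.
(* The outer remainder sends multiples of 5 to 0 rather than to 5. *)
pose i := ((5 - n %% 5) %% 5)%N; have i5 : (i < 5)%N by rewrite ltn_mod.
have [k nik] : exists k, (n + i = 5 * k)%N.
  by exists ((n + i) %/ 5)%N; rewrite /i; lia.
have [B0 [B0heart [m tauB0]]] := beil i i5.
have := is_tau_powD tauE tauB0; rewrite nik => /is_tau_pow5M H.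
pose q : int := (2 * k)%N%:Z - m.
have FB0 : isom (cshift q (forget E) : Db (CohX K)) B0.
  apply: isom_trans (isom_sym _) _; last first.
    exact: (cshift_opp B0 (addNr m)).
  apply: isom_trans (Dshift_isom (- m) H) _.
  by apply: isom_trans (cshift_add _ _ _) _; rewrite addrC; exact: isom_refl.
have fB : isom (forget (cshift q E)) B0 := isom_trans (forget_shift q E) FB0.
have hB : in_heart (forget (cshift q E)).
  exact: (@in_heart_isom K (CohX K) (@eventuallyI) _ _ (isom_sym fB) B0heart).
exists (cshift q E), (- q); split; last first.
  by apply: isom_sym; apply: cshift_opp; rewrite addNr.
(* Vertices and differentials are unchanged by forgetting, so lying in the heart means the same
   before and after. *)
split; first exact: hB.
exists i => //; split => //; exists m.
apply: is_tau_pow_isom tauB0 _; exact: Dshift_isom (isom_sym fB).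
Qed.

End TauPowers.

(** * Representations of the quiver by level *)

Definition A35_level (s : A35_vertex) : nat := \sum_(i < 5) (s i : nat).

Lemma A35_arrow_level s t : A35_arrow s t -> A35_level t = (A35_level s).+1.
Proof.
move=> /existsP[i /andP[/eqP ti /forallP H]].
rewrite /A35_level (bigD1 i)//= [in RHS](bigD1 i)//= ti addSn; congr (_.+1).
congr (_ + _)%N; apply: eq_bigr => j ji.
by have := H j; rewrite ji => /eqP ->.
Qed.

Lemma A35_level_le s : (A35_level s <= 15)%N.
Proof.
rewrite -[15%N]/(5 * 3)%N -[5%N in X in (_ <= X)%N]card_ord -sum_nat_const.
by apply: leq_sum => i _; rewrite -ltnS.
Qed.

Section A35Reps.
Variable K : fieldType.
Local Notation A := (modA35 K).
Implicit Types V W E Q : rep K A35_quiver.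

Definition on_level (n : nat) V : Prop :=
  forall t : A35_vertex, A35_level t != n -> forall u : rv V t, u = 0.

Definition above_level (k : nat) V : Prop :=
  forall t : A35_vertex, (A35_level t < k)%N -> forall u : rv V t, u = 0.

Lemma on_level_map n V (s t : A35_vertex) (a : A35_arrow s t) (u : rv V s) :
  on_level n V -> rm V (a : @arr A35_quiver s t) u = 0.
Proof.
move=> Vn; have [sn|sn] := eqVneq (A35_level s) n; last by rewrite (Vn s sn u) linear0.
by apply: (Vn t); rewrite (A35_arrow_level a) sn; lia.
Qed.

Lemma on_level_uniq n n' V : ~ is_zero_rep V -> on_level n V -> on_level n' V -> n = n'.
Proof.
move=> V0 Vn Vn'; apply: contra_notP V0 => nn' t u.
have [tn|] := eqVneq (A35_level t) n; last by move/Vn.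
by apply: Vn'; rewrite tn; apply/eqP.
Qed.

Section Restriction.
Variables (P : pred A35_vertex) (E : rep K A35_quiver).

Let U (t : A35_vertex) : {vspace rv E t} := if P t then fullv else 0%VS.
Let pr (t : A35_vertex) : 'Hom(rv E t, subvs_of (U t)) := linfun (vsproj (U t)).
Let vl (t : A35_vertex) : 'Hom(subvs_of (U t), rv E t) := linfun (@vsval _ _ (U t)).

(** One construction serves both ends of the exact sequence: on the levels above k it includes into
    E, on the lowest level k it is a quotient of E. *)
Definition restr_rep : rep K A35_quiver :=
  @Rep K A35_quiver (fun t => subvs_of (U t) : vectType K)
    (fun s t a => (pr t \o (rm E a \o vl s))%VF).

Lemma restr_vlK t u : P t -> vl t (pr t u) = u.
Proof. by move=> Pt; rewrite !lfunE /= vsprojK// /U Pt memvf. Qed.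

Lemma restr_zero (t : A35_vertex) (u : rv restr_rep t) : ~~ P t -> u = 0.
Proof.
move=> Pt; apply: subvs_inj; apply/eqP; rewrite linear0 -memv0.
by have := subvsP u; move: (vsval u) => w; rewrite /U (negPf Pt).
Qed.

Lemma restr_vl_zero t u : ~~ P t -> vl t u = 0.
Proof. by move=> Pt; rewrite (restr_zero u Pt) linear0. Qed.

Hypothesis P_level : forall s t, A35_level s = A35_level t -> P s = P t.

(** The two middle vertices of a square have the same level, so a predicate of the level keeps or
    kills both paths at once. *)
Lemma restr_rel : A35_rel E -> A35_rel restr_rep.
Proof.
move=> HE s t t' u a b a' b'; apply/lfunP => x; rewrite !comp_lfunE.
have [Ps|Ps] := boolP (P s); last by rewrite (restr_vl_zero x Ps) !linear0.
have Ptt' : P t = P t' by apply: P_level; rewrite (A35_arrow_level a) (A35_arrow_level a').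
have [Pt|Pt] := boolP (P t); last first.
  by rewrite (restr_vl_zero _ Pt) restr_vl_zero -?Ptt'// !linear0.
rewrite !restr_vlK -?Ptt'//.
by have /(congr1 (fun f => fun_of_lfun f (vl s x))) := HE s t t' u a b a' b'; rewrite !comp_lfunE => ->.
Qed.

Lemma restr_inc_proof : (forall s t, P s -> A35_arrow s t -> P t) ->
  forall s t (a : @arr A35_quiver s t), (rm E a \o vl s = vl t \o rm restr_rep a)%VF.
Proof.
move=> Pup s t a; apply/lfunP => x; rewrite !comp_lfunE.
have [Ps|Ps] := boolP (P s); last by rewrite (restr_vl_zero x Ps) !linear0.
by rewrite restr_vlK// (Pup s t).
Qed.
Definition restr_inc Pup : rhom restr_rep E :=
  @RHom K A35_quiver restr_rep E vl (restr_inc_proof Pup).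

Lemma restr_proj_proof :
  (forall s t (a : A35_arrow s t), P t -> ~~ P s ->
    forall u : rv E s, u = 0) ->
  forall s t (a : @arr A35_quiver s t), (rm restr_rep a \o pr s = pr t \o rm E a)%VF.
Proof.
move=> Pdown s t a; apply/lfunP => x; rewrite !comp_lfunE.
have [Ps|Ps] := boolP (P s); first by rewrite restr_vlK.
rewrite (restr_vl_zero _ Ps) !linear0.
have [Pt|Pt] := boolP (P t); first by rewrite (Pdown s t a Pt Ps x) !linear0.
by apply/esym; exact: (@restr_zero t _ Pt).
Qed.
Definition restr_proj Pdown : rhom E restr_rep :=
  @RHom K A35_quiver E restr_rep pr (restr_proj_proof Pdown).

End Restriction.

Definition restr_obj (P : pred A35_vertex) (E : cobj A)
    (HP : forall s t, A35_level s = A35_level t -> P s = P t) : cobj A :=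
  @CObj K A (restr_rep P E) (restr_rel HP (crelP E)).

Lemma level_ge_level k s t : A35_level s = A35_level t ->
  (fun t => k <= A35_level t)%N s = (fun t => k <= A35_level t)%N t.
Proof. by move=> /= ->. Qed.

Lemma level_eq_level k s t : A35_level s = A35_level t ->
  (fun t => A35_level t == k) s = (fun t => A35_level t == k) t.
Proof. by move=> /= ->. Qed.

Definition level_ge (k : nat) (E : cobj A) : cobj A := restr_obj E (@level_ge_level k).
Definition level_part (k : nat) (E : cobj A) : cobj A := restr_obj E (@level_eq_level k).

Lemma level_ge_above k (E : cobj A) : above_level k (level_ge k E).
Proof. by move=> t tk u; apply: restr_zero; rewrite -ltnNge. Qed.

Lemma level_part_on k (E : cobj A) : on_level k (level_part k E).
Proof. by move=> t tk u; exact: restr_zero. Qed.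

Lemma level_part_neq0 k (E : cobj A) : above_level k E -> ~ above_level k.+1 E ->
  ~ is_zero_rep (level_part k E).
Proof.
move=> Ek Ek1 H; apply: Ek1 => t; rewrite ltnS leq_eqVlt => /orP[/eqP tk u|tk]; last exact: Ek.
have Pt : (fun t => A35_level t == k) t by apply/eqP.
by rewrite -(@restr_vlK (fun t => A35_level t == k) E t u Pt) (H t (linfun _ u)) linear0.
Qed.

Lemma level_ge_exact k (E : cobj A) : above_level k E ->
  exists (f : rhom (level_ge k.+1 E) E) (g : rhom E (level_part k E)), short_exact f g.
Proof.
move=> Ek.
have Pup s t : (k.+1 <= A35_level s)%N -> A35_arrow s t -> (k.+1 <= A35_level t)%N.
  by move=> sk a; rewrite (A35_arrow_level a) ltnW.
have Pdown s t (a : A35_arrow s t) : A35_level t == k -> A35_level s != k ->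
    forall u : rv E s, u = 0.
  by rewrite (A35_arrow_level a) => /eqP tk _; apply: Ek; rewrite -tk.
exists (@restr_inc (fun t => k.+1 <= A35_level t)%N E Pup).
exists (@restr_proj (fun t => A35_level t == k) E Pdown) => t; split.
- move=> x /= Hx; apply: subvs_inj; rewrite linear0.
  by move: Hx; rewrite lfunE.
- by move=> z; exists (vsval z); rewrite /= lfunE /= vsvalK.
- move=> y; have [tk|tk] := ltnP k (A35_level t).
  + split=> _; last by apply: restr_zero; rewrite gt_eqF.
    exists (linfun (vsproj _) y).
    exact/esym/(@restr_vlK (fun t => k.+1 <= A35_level t)%N E t y).
  + have nP : ~~ (k.+1 <= A35_level t)%N by rewrite -leqNgt.
    split; last first.
      by move=> [x ->]; rewrite (@restr_zero (fun t => k.+1 <= A35_level t)%N E t x nP) !linear0.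
    move: tk; rewrite leq_eqVlt => /orP[tk Hy|tk _]; last first.
      by exists 0; rewrite linear0; exact: Ek.
    exists 0; rewrite linear0.
    by rewrite -(@restr_vlK (fun t => A35_level t == k) E t y tk) [X in linfun _ X]Hy linear0.
Qed.

(** Any vertexwise linear section is a morphism: an arrow applied to a lift from level n lands at
    level n + 1, where Q is 0, hence in the image of Q', which is 0 there unless n' = n + 1. *)
Lemma extension_splits n n' (Q Q' E : cobj A) (f : rhom Q' E) (g : rhom E Q) :
  on_level n Q -> on_level n' Q' -> n' != n.+1 -> short_exact f g ->
  exists s : rhom Q E, rheq (rcomp g s) (rid Q).
Proof.
move=> Qn Q'n nn fg.
have P s t (a : @arr A35_quiver s t) :
    (rm E a \o (rf g s)^-1 = (rf g t)^-1 \o rm Q a)%VF.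
  apply/lfunP => x; rewrite !comp_lfunE (on_level_map a x Qn) linear0.
  have [sn|sn] := eqVneq (A35_level s) n; last by rewrite (Qn s sn x) !linear0.
  have tn : A35_level t = n.+1 by rewrite (A35_arrow_level a) sn.
  have [_ _ H] := fg t; set y := rm E a _.
  have [|z ->] := (H y).1; first by apply: Qn; rewrite tn; lia.
  by rewrite (Q'n t _ z) ?linear0// tn eq_sym.
exists (@RHom K A35_quiver Q E _ P) => t; apply/lfunP => x.
rewrite comp_lfunE id_lfunE limg_lfunVK//.
by have [_ /(_ x)[y <-] _] := fg t; exact/memv_img/memvf.
Qed.

End A35Reps.

Section LevelFiltration.
Variables (K : fieldType) (R : realType) (phi : nat -> R).
Hypothesis phi_lt : forall n, phi n < phi n.+1.
Local Notation A := (modA35 K).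
Implicit Types E Q : cobj A.

Definition single_level Q : Prop := ~ is_zero_rep Q /\ exists n, on_level n Q.

(** A choice with default 0; it is determined by Q when Q is nonzero and lies on one level. *)
Definition rep_level Q : nat := xget 0%N [set n | on_level n Q]%classic.

Lemma rep_levelE n Q : ~ is_zero_rep Q -> on_level n Q -> rep_level Q = n.
Proof.
move=> Q0 Qn; apply: (on_level_uniq Q0 _ Qn).
exact: (@xgetI _ 0%N [set n | on_level n Q]%classic n Qn).
Qed.

Lemma phi_mono : {homo phi : m n / (m < n)%N >-> m < n}.
Proof.
move=> m; elim=> // n IH; rewrite ltnS leq_eqVlt => /orP[/eqP -> //|/IH H].
exact: lt_trans H (phi_lt n).
Qed.

(** The Harder-Narasimhan filtration strengthened by a lower bound k for the first level, so that a
    quotient of smaller level can be prepended in the induction. *)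
Definition level_filtration E (k : nat) : Prop :=
  exists (n : nat) (F Q : nat -> cobj A),
    [/\ F 0%N = E, is_zero_rep (F n),
        forall i, (i < n)%N -> single_level (Q i) /\
          exists (f : rhom (F i.+1) (F i)) (g : rhom (F i) (Q i)), short_exact f g,
        forall i, (i.+1 < n)%N -> phi (rep_level (Q i)) < phi (rep_level (Q i.+1))
      & (0 < n)%N /\ (k <= rep_level (Q 0%N))%N].

(** Induction from k = 16 downwards, one more than the top level 15 = 5 * 3. Levels where E vanishes
    are skipped, as semistable quotients must be nonzero. *)
Lemma level_filtration_exists d k E : (k + d = 16)%N -> above_level k E ->
  ~ is_zero_rep E -> level_filtration E k.
Proof.
elim: d k E => [|d IH] k E kd Ek E0.
  by case: E0 => t u; apply: (Ek t); have := A35_level_le t; lia.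
have [Ek1|Ek1] := pselect (above_level k.+1 E).
  have [|n [F [Q [h1 h2 h3 h4 [h5 h6]]]]] := IH k.+1 E _ Ek1 E0; first by lia.
  by exists n, F, Q; split => //; split => //; exact: ltnW.
have Q0 := level_part_neq0 Ek Ek1; have Qk := @level_part_on K k E.
have [f [g fg]] := level_ge_exact Ek.
have [Z|Z] := pselect (is_zero_rep (level_ge k.+1 E)).
  exists 1%N, (fun i => if i is 0%N then E else level_ge k.+1 E), (fun=> level_part k E).
  split => //; last by rewrite (rep_levelE Q0 Qk).
  by move=> [|//] _; split; [split => //; exists k | exists f, g].
have [|n [F [Q [h1 h2 h3 h4 [h5 h6]]]]] := IH k.+1 _ _ (@level_ge_above K k.+1 E) Z; first by lia.
exists n.+1, (fun i => if i is j.+1 then F j else E),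
  (fun i => if i is j.+1 then Q j else level_part k E).
split => //; last by rewrite (rep_levelE Q0 Qk).
- move=> [_|i]; last exact: h3.
  by split; [split => //; exists k | rewrite h1; exists f, g].
- move=> [_|i]; last exact: h4.
  by rewrite (rep_levelE Q0 Qk); apply: phi_mono; exact: h6.
Qed.

End LevelFiltration.

(** * Direct sums of simple representations *)

Section DiagonalReps.
Import VectorInternalTheory.
Variable K : fieldType.
Local Notation A := (modA35 K).
Implicit Types d e : A35_vertex -> nat.

(** The sum of [d t] copies of each simple t; by [diag_isom] every representation on one level has
    this form. *)
Definition diag_rep d : rep K A35_quiver :=
  @Rep K A35_quiver (fun t => 'rV[K]_(d t) : vectType K) (fun _ _ _ => 0).

Lemma diag_rel d : A35_rel (diag_rep d).
Proof. by move=> s t t' u a b a' b'; rewrite !comp_lfun0l. Qed.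

Definition diag d : cobj A := @CObj K A (diag_rep d) (diag_rel d).

Lemma diag_hom_proof d e (M : forall t, 'M[K]_(d t, e t)) s t (a : @arr A35_quiver s t) :
  (rm (diag_rep e) a \o linfun (mulmxr (M s)) =
   linfun (mulmxr (M t)) \o rm (diag_rep d) a)%VF.
Proof. by rewrite comp_lfun0l comp_lfun0r. Qed.
Definition diag_hom d e (M : forall t, 'M[K]_(d t, e t)) : rhom (diag d) (diag e) :=
  @RHom K A35_quiver (diag_rep d) (diag_rep e)
    (fun t => linfun (mulmxr (M t))) (diag_hom_proof M).

Lemma diag_homE d e (M : forall t, 'M[K]_(d t, e t)) t u :
  rf (diag_hom M) t u = u *m M t.
Proof. by rewrite /= lfunE. Qed.

(** Matrices act on row vectors from the right, so inclusions are block rows and projections block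
    columns. *)
Definition diag_inl d e := @diag_hom d (fun t => d t + e t)%N (fun t => row_mx 1%:M 0).
Definition diag_inr d e := @diag_hom e (fun t => d t + e t)%N (fun t => row_mx 0 1%:M).
Definition diag_fst d e := @diag_hom (fun t => d t + e t)%N d (fun t => col_mx 1%:M 0).
Definition diag_snd d e := @diag_hom (fun t => d t + e t)%N e (fun t => col_mx 0 1%:M).

Lemma diag_fst_inl d e : rheq (rcomp (diag_fst d e) (diag_inl d e)) (rid (diag d)).
Proof.
move=> t; apply/lfunP => u; rewrite comp_lfunE !diag_homE id_lfunE -mulmxA.
by rewrite mul_row_col mulmx1 mul0mx addr0 mulmx1.
Qed.

Lemma diag_snd_inr d e : rheq (rcomp (diag_snd d e) (diag_inr d e)) (rid (diag e)).
Proof.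
move=> t; apply/lfunP => u; rewrite comp_lfunE !diag_homE id_lfunE -mulmxA.
by rewrite mul_row_col mulmx1 mul0mx add0r mulmx1.
Qed.

Lemma diag_snd_inl d e : rheq (rcomp (diag_snd d e) (diag_inl d e)) (rzero _ _).
Proof.
move=> t; apply/lfunP => u; rewrite comp_lfunE !diag_homE zero_lfunE -mulmxA.
by rewrite mul_row_col mul0mx mulmx0 addr0 mulmx0.
Qed.

Lemma diag_sum_id d e : rheq (radd (rcomp (diag_inl d e) (diag_fst d e))
  (rcomp (diag_inr d e) (diag_snd d e))) (rid (diag (fun t => d t + e t)%N)).
Proof.
move=> t; apply/lfunP => u; rewrite add_lfunE !comp_lfunE !diag_homE id_lfunE.
rewrite -!mulmxA -mulmxDr !mul_col_row !mulmx1 !mul1mx !mul0mx ?mulmx0.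
by rewrite add_block_mx !addr0 !add0r -scalar_mx_block mulmx1.
Qed.

Lemma diag_zero d : (forall t, d t = 0%N) -> is_zero_rep (diag d).
Proof. by move=> d0 t u; move: u; rewrite /= d0 => u; apply/rowP => -[]. Qed.

Lemma diag_neq0 d t : (0 < d t)%N -> ~ is_zero_rep (diag d).
Proof.
move=> dt H; have := H t (const_mx 1); move=> /rowP/(_ (Ordinal dt)).
by rewrite !mxE => /eqP; rewrite oner_eq0.
Qed.

Lemma diag_isom n (Q : cobj A) : on_level n Q -> exists d, rep_isom Q (diag d).
Proof.
move=> Qn; exists (fun t => dim (rv Q t)).
have P s t (a : @arr A35_quiver s t) :
    ((0 : 'Hom('rV[K]_(dim (rv Q s)), 'rV[K]_(dim (rv Q t)))) \o linfun (@v2r K (rv Q s)) =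
     linfun (@v2r K (rv Q t)) \o rm Q a)%VF.
  by apply/lfunP => u; rewrite comp_lfun0l zero_lfunE comp_lfunE (on_level_map a u Qn) linear0.
have P' s t (a : @arr A35_quiver s t) :
    (rm Q a \o linfun (@r2v K (rv Q s)) = linfun (@r2v K (rv Q t)) \o
     (0 : 'Hom('rV[K]_(dim (rv Q s)), 'rV[K]_(dim (rv Q t)))))%VF.
  by apply/lfunP => u; rewrite comp_lfun0r zero_lfunE comp_lfunE (on_level_map a _ Qn).
exists (@RHom K A35_quiver Q (diag_rep _) (fun t => linfun (@v2r K (rv Q t))) P).
exists (@RHom K A35_quiver (diag_rep _) Q (fun t => linfun (@r2v K (rv Q t))) P').
split=> t; apply/lfunP => u; rewrite /= comp_lfunE id_lfunE !lfunE /=.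
- exact: v2rK.
- exact: r2vK.
Qed.

Lemma rep_isom_sym (V W : rep K A35_quiver) : rep_isom V W -> rep_isom W V.
Proof. by move=> [f [g [h1 h2]]]; exists g, f. Qed.

Lemma rep_isom_zero (V W : rep K A35_quiver) : rep_isom V W -> is_zero_rep V -> is_zero_rep W.
Proof.
move=> [f [g [_ fg]]] V0 t u.
by have := congr1 (fun h => fun_of_lfun h u) (fg t); rewrite comp_lfunE id_lfunE (V0 t (rf g t u)) linear0.
Qed.

Lemma rep_isom_level n (V W : rep K A35_quiver) : rep_isom V W -> on_level n V -> on_level n W.
Proof.
move=> [f [g [_ fg]]] Vn t tn u.
by have := congr1 (fun h => fun_of_lfun h u) (fg t); rewrite comp_lfunE id_lfunE (Vn t tn (rf g t u)) linear0.
Qed.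

Lemma diag_level n d : on_level n (diag d) <-> forall t, A35_level t != n -> d t = 0%N.
Proof.
split=> H t tn; last by move: (H t tn) => dt u; move: u; rewrite /= dt => u; apply/rowP => -[].
apply/eqP; rewrite -leqn0 leqNgt; apply/negP => dt.
have /rowP/(_ (Ordinal dt)) := H t tn (const_mx 1).
by rewrite !mxE => /eqP; rewrite oner_eq0.
Qed.

Lemma diag_simple s : rep_isom (diag (fun t => (t == s) : nat)) (simple K s).
Proof.
have P : forall u v (a : @arr A35_quiver u v),
    (rm (simple K s) a \o \1 = \1 \o rm (diag (fun t => (t == s) : nat)) a)%VF.
  by move=> u v a; rewrite comp_lfun0l comp_lfun0r.
have P' : forall u v (a : @arr A35_quiver u v),
    (rm (diag (fun t => (t == s) : nat)) a \o \1 = \1 \o rm (simple K s) a)%VF.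
  by move=> u v a; rewrite comp_lfun0l comp_lfun0r.
exists (@RHom K A35_quiver (diag _) (simple K s) (fun t => \1%VF) P).
exists (@RHom K A35_quiver (simple K s) (diag _) (fun t => \1%VF) P').
by split=> t; exact: comp_lfun1l.
Qed.

Lemma dimension_split d t : (0 < d t)%N ->
  d = (fun u => ((u == t) : nat) + (d u - ((u == t) : nat)))%N.
Proof.
move=> dt; apply/funext => u; rewrite subnKC//.
by case: eqP => [->|].
Qed.

Lemma rep_isom_trans (U V W : rep K A35_quiver) : rep_isom U V -> rep_isom V W -> rep_isom U W.
Proof.
move=> [f [g [h1 h2]]] [f' [g' [h1' h2']]]; exists (rcomp f' f), (rcomp g g').
split=> t; apply/lfunP => u; rewrite /= !comp_lfunE id_lfunE.
- have := congr1 (fun h => fun_of_lfun h (rf f t u)) (h1' t).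
  rewrite comp_lfunE id_lfunE => ->.
  by have := congr1 (fun h => fun_of_lfun h u) (h1 t); rewrite comp_lfunE id_lfunE.
- have := congr1 (fun h => fun_of_lfun h (rf g' t u)) (h2 t).
  rewrite comp_lfunE id_lfunE => ->.
  by have := congr1 (fun h => fun_of_lfun h u) (h2' t); rewrite comp_lfunE id_lfunE.
Qed.

Lemma diag_exact d e (Q : cobj A) : rep_isom Q (diag (fun t => d t + e t)%N) ->
  exists (f : rhom (diag d) Q) (g : rhom Q (diag e)), short_exact f g.
Proof.
move=> [p [q [qp pq]]].
have qpE t u : rf q t (rf p t u) = u.
  by have := congr1 (fun h => fun_of_lfun h u) (qp t); rewrite comp_lfunE id_lfunE.
have pqE t u : rf p t (rf q t u) = u.
  by have := congr1 (fun h => fun_of_lfun h u) (pq t); rewrite comp_lfunE id_lfunE.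
have fiE t u : rf (diag_fst d e) t (rf (diag_inl d e) t u) = u.
  by have := congr1 (fun h => fun_of_lfun h u) (diag_fst_inl d e t); rewrite comp_lfunE id_lfunE.
have sjE t u : rf (diag_snd d e) t (rf (diag_inr d e) t u) = u.
  by have := congr1 (fun h => fun_of_lfun h u) (diag_snd_inr d e t); rewrite comp_lfunE id_lfunE.
have siE t u : rf (diag_snd d e) t (rf (diag_inl d e) t u) = 0.
  by have := congr1 (fun h => fun_of_lfun h u) (diag_snd_inl d e t); rewrite comp_lfunE zero_lfunE.
have idE t u : rf (diag_inl d e) t (rf (diag_fst d e) t u) + rf (diag_inr d e) t (rf (diag_snd d e) t u) = u.
  by have := congr1 (fun h => fun_of_lfun h u) (diag_sum_id d e t); rewrite add_lfunE !comp_lfunE id_lfunE.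
exists (rcomp q (diag_inl d e)), (rcomp (diag_snd d e) p) => t; split.
- move=> x; rewrite comp_lfunE => H.
  by rewrite -(fiE t x) -(pqE t (rf (diag_inl d e) t x)) H !linear0.
- by move=> z; exists (rf q t (rf (diag_inr d e) t z)); rewrite comp_lfunE pqE sjE.
- move=> y; rewrite comp_lfunE; split=> [H|[x ->]]; last by rewrite comp_lfunE pqE siE.
  exists (rf (diag_fst d e) t (rf p t y)).
  by rewrite comp_lfunE -[in LHS](qpE t y) -[in LHS](idE t (rf p t y)) H linear0 addr0.
Qed.

Section AdditiveInvariant.
Variables (V : zmodType) (F : Db A -> V).
Hypothesis FK : K_hom F.

Lemma K_hom_stalk_zero (Q : cobj A) : is_zero_rep Q -> F (stalk Q) = 0.
Proof.
move=> Q0; rewrite -(K_hom_zero FK); apply: (K_hom_isom FK); apply: stalk_isom.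
exists (rzero Q _), (rzero _ Q); split=> t; apply/lfunP => u.
- by rewrite (Q0 t u) !linear0.
- by rewrite /= comp_lfun0l zero_lfunE id_lfunE; apply/rowP => -[].
Qed.

Lemma K_hom_diag_add d e :
  F (stalk (diag (fun t => d t + e t)%N)) = F (stalk (diag d)) + F (stalk (diag e)).
Proof.
exact: (K_hom_split FK (stalk_split (diag_fst_inl d e) (diag_snd_inr d e) (diag_sum_id d e))).
Qed.

Lemma K_hom_diag (z : V) d :
  (forall s, d s != 0%N -> F (stalk (simple K s)) = z) ->
  F (stalk (diag d)) = z *+ (\sum_t d t).
Proof.
elim: {d}(\sum_t d t)%N {-2}d (erefl (\sum_t d t)%N) => [|N IH] d dN Hd.
  have d0 t : d t = 0%N by move: dN => /eqP; rewrite sum_nat_eq0 => /forallP/(_ t)/eqP.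
  by rewrite K_hom_stalk_zero ?dN//; exact: diag_zero.
have [t0 t0P] : exists t, d t != 0%N.
  apply/existsP; apply: contraT; rewrite negb_exists => /forallP H.
  by move: dN; rewrite big1// => t _; apply/eqP; have := H t; rewrite negbK.
have dt : (0 < d t0)%N by rewrite lt0n.
have dE := dimension_split dt.
have sE : (\sum_t (d t - ((t == t0) : nat)) = N)%N.
  have : (\sum_t d t = \sum_t ((t == t0) : nat) + \sum_t (d t - ((t == t0) : nat)))%N.
    by rewrite -big_split {1}dE.
  rewrite dN (bigD1 t0)//= eqxx big1 ?addn0 ?add1n => [[->]//|t /negPf -> //].
rewrite {1}dE K_hom_diag_add (K_hom_isom FK (stalk_isom (diag_simple t0))) (Hd t0 t0P).
rewrite IH// ?sE ?dN ?mulrS// => s ds; apply: Hd; apply: contra_neq ds => ->.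
exact: sub0n.
Qed.

End AdditiveInvariant.
End DiagonalReps.

(** * The central charge and its stability condition *)

Section StableSimple.
Variable K : fieldType.
Implicit Types Q U V : cobj (modA35 K).

(** Q is a sum of simples on one level. Splitting off one copy of a simple t0 leaves a complement on
    the same level, which must be zero by the hypothesis. *)
Lemma indecomposable_simple Q : single_level Q ->
  (forall U V (f : rhom U Q) (g : rhom Q V), single_level U -> single_level V ->
    rep_level U = rep_level Q -> rep_level V = rep_level Q ->
    ~ short_exact f g) ->
  exists s, rep_isom Q (simple K s).
Proof.
move=> [Q0 [n Qn]] indec; have [d Qd] := diag_isom Qn.
have dn := (diag_level K n d).1 (rep_isom_level Qd Qn).
have [t0 dt0] : exists t, d t != 0%N.
  apply/existsP; apply: contraT; rewrite negb_exists => /forallP H; case: Q0.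
  apply: (rep_isom_zero (rep_isom_sym Qd)); apply: diag_zero => t.
  by apply/eqP; have := H t; rewrite negbK.
have t0n : A35_level t0 = n by apply/eqP; apply: contra_neqT dt0 => /dn.
have dE := dimension_split (etrans (lt0n _) dt0).
pose e t := (d t - ((t == t0) : nat))%N.
have [[t1 et1]|e0] := pselect (exists t, e t != 0%N); last first.
  exists t0; apply: rep_isom_trans Qd _; rewrite dE.
  have -> : (fun t => ((t == t0) : nat) + (d t - ((t == t0) : nat)))%N = (fun t => (t == t0) : nat).
    apply/funext => t; rewrite -/(e t); have -> : e t = 0%N; last by rewrite addn0.
    by apply/eqP; apply: contra_notT e0 => et; exists t.
  exact: diag_simple.
have Qd' := Qd; rewrite dE in Qd'; have [f [g fg]] := diag_exact Qd'.
have Un : on_level n (diag K (fun t => (t == t0) : nat)).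
  by apply/diag_level => t tn; case: (t =P t0) tn => // ->; rewrite t0n eqxx.
have Vn : on_level n (diag K e).
  by apply/diag_level => t /dn dt; rewrite /e dt sub0n.
have U0 : ~ is_zero_rep (diag K (fun t => (t == t0) : nat)).
  by apply: (@diag_neq0 _ _ t0); rewrite eqxx.
have V0 : ~ is_zero_rep (diag K e) by apply: (@diag_neq0 _ _ t1); rewrite lt0n.
case: (indec _ _ f g _ _ _ _ fg).
- by split => //; exists n.
- by split => //; exists n.
- by rewrite (rep_levelE U0 Un) (rep_levelE Q0 Qn).
- by rewrite (rep_levelE V0 Vn) (rep_levelE Q0 Qn).
Qed.

End StableSimple.

Section CentralCharge.
Variable R : realType.
Local Notation C := R[i].
Local Notation Re := complex.Re.
Local Notation Im := complex.Im.

Lemma sign_scale (z : int) (v : Hev R) :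
  (if odd `|z|%N then - v else v) = ((-1) ^ z : C) *: v.
Proof.
have e (n : nat) : (if odd n then - v else v) = ((-1) ^+ n : C) *: v.
  by rewrite -signr_odd; case: (odd n); rewrite ?expr1 ?scaleN1r ?expr0 ?scale1r.
case: z => n; first exact: e.
rewrite [absz _]/= e; congr (_ *: _).
by rewrite -[RHS]/(((-1) ^+ n.+1)^-1 : C) invr_sign.
Qed.

Lemma quintic_periodD l : {morph @quintic_period R l : u v / u + v}.
Proof. by move=> u v; rewrite !quintic_periodE !hcoefD; ring. Qed.

Section ChernCharacter.
Variables (sO : cobj (CohX C)) (ch : Db (CohX C) -> Hev R).
Hypothesis hch : chern_character sO ch.

Lemma ch_OX (n : int) : ch (OX sO (- n)) = ((-1) ^ n : C) *: 1.
Proof.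
have [chK ch1 _ _] := hch.
rewrite /OX (@K_hom_shift C (CohX C) (@gr_rel_sum C) _ ch chK) ch1 -sign_scale.
by rewrite abszN.
Qed.

(** The multiplicities that define P are those of the Riemann-Roch formula, and O[-n] has class
    (-1)^n; hence ch P is the Euler characteristic of E times ch(O_X) = 1, and the cone subtracts
    it. *)
Lemma ch_tau E E' : is_tau sO E E' ->
  ch E' = hexp (J R) * (ch E - integral_X (ch E * todd_X R) *: 1).
Proof.
have [chK ch1 chT chRR] := hch.
move=> [T [m [P [inc [ev [b [c [[N mN] cop basis dist_ev]]]]]]] E'T].
rewrite (K_hom_isom chK E'T) chT; congr (_ * _).
have RR : integral_X (ch E * todd_X R) *: 1 = ch P.
  rewrite (chRR E N m mN); last by move=> n; eexists; exact: basis.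
  rewrite (K_hom_coproduct chK mN cop) scaler_suml; apply: eq_bigr => k _.
  by rewrite ch_OX mulr_natr scalerMnl.
by rewrite RR (chK _ _ _ _ _ _ dist_ev) addrC addKr.
Qed.

(** Classes are traced backwards: each tau lowers the index in [tau_lattice] by one, and
    [tau_lattice_step] inverts it. *)
Lemma ch_tau_pow n m E F : is_tau_pow sO n E F ->
  (forall j, (j < 4)%N -> hcoef (ch F) j = tau_lattice C m j) ->
  forall j, (j < 4)%N -> hcoef (ch E) j = tau_lattice C (m + n) j.
Proof.
have [chK _ _ _] := hch.
elim: n m F => [|n IH] m F; first by move=> /(K_hom_isom chK) ->; rewrite addn0.
move=> [F1 /IH H /ch_tau e] HF; rewrite addnS -addSn; apply: H.
by apply: tau_lattice_step => j j4; rewrite -e HF.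
Qed.

Lemma ch_tau_pow_OX n E : is_tau_pow sO n E (stalk sO) ->
  forall j, (j < 4)%N -> hcoef (ch E) j = tau_lattice C n j.
Proof.
have [_ ch1 _ _] := hch.
move=> /ch_tau_pow H; apply: (H 0%N) => j j4; rewrite ch1 hcoef1 /tau_lattice /=.
by case: j j4 => [|[|[|[|]]]].
Qed.

End ChernCharacter.

Lemma normc_cexp (z : C) : `|cexp z| = (expR (Re z))%:C%C.
Proof.
rewrite normc_def /cexp /= !exprMn -mulrDr cos2Dsin2 mulr1 sqrtr_sqr.
by rewrite ger0_norm// expR_ge0.
Qed.

Lemma level_vertex Q n : @single_level C Q -> on_level n Q ->
  exists2 k : nat, (0 < k)%N & forall (V : zmodType) (F : Db (modA35 C) -> V) (z : V),
    K_hom F -> (forall s, A35_level s = n -> F (stalk (simple C s)) = z) ->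
    F (stalk Q) = z *+ k.
Proof.
move=> [Q0 _] Qn; have [d Qd] := diag_isom Qn.
have dn := (diag_level C n d).1 (rep_isom_level Qd Qn).
exists (\sum_t d t)%N.
  rewrite lt0n; apply/eqP => /eqP; rewrite sum_nat_eq0 => /forallP H; case: Q0.
  apply: (rep_isom_zero (rep_isom_sym Qd)); apply: diag_zero => t.
  by have /eqP := H t.
move=> V F z FK Fz; rewrite (K_hom_isom FK (stalk_isom Qd)) (K_hom_diag FK (z := z))//.
by move=> s ds; apply: Fz; apply/eqP; apply: contra_neqT ds => /dn.
Qed.

Lemma is_phaseMn (z : C) (phi : R) k : (0 < k)%N -> is_phase z phi -> is_phase (z *+ k) phi.
Proof.
move=> k0 [m m0 ->]; exists (m *+ k); first by rewrite mulrn_wgt0.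
by rewrite -mulrnAl -[X in X * _](rmorphMn (real_complex R)).
Qed.

Section LevelStability.
Variables (Z : Db (modA35 C) -> C) (phi : nat -> R) (z : nat -> C).
Hypothesis ZK : K_hom Z.
Hypothesis Z_simple : forall s, Z (stalk (simple C s)) = z (A35_level s).
Hypothesis z_phase : forall n, is_phase (z n) (phi n).
Hypothesis phi_turn : forall n, 0 < phi n.+1 - phi n < pi.

Definition level_phase (Q : cobj (modA35 C)) : R := phi (rep_level Q).

Lemma phi_turn_lt n : phi n < phi n.+1.
Proof. by have /andP[] := phi_turn n; rewrite subr_gt0. Qed.

Lemma level_stability : exists sigma : stability_condition Z,
  semistable sigma = @single_level C /\ phase sigma = level_phase.
Proof.
have iso (Q Q' : cobj (modA35 C)) : rep_isom Q Q' -> single_level Q -> single_level Q'.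
  move=> QQ' [Q0 [n Qn]]; split.
    by move=> /(rep_isom_zero (rep_isom_sym QQ')).
  by exists n; exact: rep_isom_level Qn.
have mass Q : single_level Q -> exists2 m : R, 0 < m &
    Z (stalk Q) = m%:C%C * cexp (0 +i* level_phase Q)%C.
  move=> HQ; have [Q0 [n Qn]] := HQ; have [k k0 Hk] := level_vertex HQ Qn.
  rewrite (Hk _ _ (z n) ZK); last by move=> s <-; exact: Z_simple.
  rewrite /level_phase (rep_levelE Q0 Qn); exact: is_phaseMn k0 (z_phase n).
have ext Q Q' : single_level Q -> single_level Q' -> Ext1_nonzero Q Q' ->
    `|level_phase Q - level_phase Q'| < pi.
  move=> [Q0 [n Qn]] [Q'0 [n' Q'n]] [E [f [g [fg nsplit]]]].
  rewrite /level_phase (rep_levelE Q0 Qn) (rep_levelE Q'0 Q'n).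
  have -> : n' = n.+1.
    by apply: contra_notP nsplit => /eqP nn; exact: extension_splits Qn Q'n nn fg.
  by have /andP[h1 h2] := phi_turn n; rewrite distrC gtr0_norm.
have hom Q Q' : single_level Q -> single_level Q' -> level_phase Q < level_phase Q' ->
    forall f : rhom Q' Q, rheq f (rzero Q' Q).
  move=> [Q0 [n Qn]] [Q'0 [n' Q'n]] lt f t; apply/lfunP => u; rewrite zero_lfunE.
  have [tn|tn] := eqVneq (A35_level t) n; last by rewrite (Qn t tn (rf f t u)).
  rewrite (Q'n t _ u) ?linear0// tn; apply: contra_ltN lt => /eqP nn.
  by rewrite /level_phase (rep_levelE Q0 Qn) (rep_levelE Q'0 Q'n) nn.
have fil (E : cobj (modA35 C)) : ~ is_zero_rep E -> exists (n : nat) (F Q : nat -> cobj (modA35 C)),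
      [/\ F 0%N = E, is_zero_rep (F n),
          forall i, (i < n)%N -> single_level (Q i) /\
            exists (f : rhom (F i.+1) (F i)) (g : rhom (F i) (Q i)),
              short_exact f g
        & forall i, (i.+1 < n)%N -> level_phase (Q i) < level_phase (Q i.+1)].
  move=> E0; have E_above : above_level 0 E by move=> t; rewrite ltn0.
  have [n [F [Q [h1 h2 h3 h4 _]]]] := level_filtration_exists phi_turn_lt (add0n 16%N) E_above E0.
  by exists n, F, Q.
by exists (@StabilityCondition R Z (@single_level C) level_phase ZK (fun Q H => H.1)
  iso mass ext hom fil).
Qed.

Lemma level_stable_simple (sigma : stability_condition Z) Q :
  semistable sigma = @single_level C -> phase sigma = level_phase ->
  stable sigma Q -> exists s, rep_isom Q (simple C s).
Proof.
move=> ss ph [HQ ind]; rewrite ss in HQ; apply: indecomposable_simple HQ _.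
move=> U V f g HU HV lU lV fg; apply: ind; exists U, V, f, g.
by rewrite ss ph /level_phase lU lV; split.
Qed.

End LevelStability.
End CentralCharge.

Theorem theorem1p1 (R : realType)
  (* O_X and the Chern character of D^b(Coh X) *)
  (sO : cobj (CohX R[i])) (hO : structure_sheaf sO)
  (ch : Db (CohX R[i]) -> Hev R) (hch : chern_character sO ch)
  (* tau^5 = [2], and tau^i(O_X), i = 0..4, are shifts of coherent sheaves *)
  (htau5 : forall E E' : Db (CohX R[i]),
     is_tau_pow sO 5 E E' -> isom E' (cshift 2 E))
  (hbeilinson : forall i : nat, (i < 5)%N ->
     exists B : Db (CohX R[i]), beilinson_sheaf sO i B)
  (* D^b(mod A_3^{(x)5}) = D^b_G(Coh X), the simple s becoming
     tau^(- sum s_i)(O_X) after forgetting the equivariance *)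
  (Phi : exact_functor (Db (modA35 R[i])) (Db (CohGX (xi5 R))))
  (hPhi : is_equivalence Phi)
  (hPhi_simple : forall s : A35_vertex,
     is_tau_pow sO (\sum_(i < 5) (s i : nat))%N
       (forget (Phi (stalk (simple R[i] s)))) (stalk sO))
  (* D^b(mod A_3^{(x)5}) = FS(F), the simples becoming vanishing cycles *)
  (FS : tricat R[i]) (vanishing_cycle : FS -> Prop)
  (Psi : exact_functor (Db (modA35 R[i])) FS) (hPsi : is_equivalence Psi)
  (hPsi_simple : forall s : A35_vertex,
     exists2 L : FS, vanishing_cycle L & isom (Psi (stalk (simple R[i] s))) L) :
  (* the branch of log x with imaginary part in [theta, theta + 2 pi[ *)
  forall theta : R, exists2 eps : R, 0 < eps &
  forall x l : R[i], x != 0 -> `|x| < (eps%:C)%C ->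
    cexp l = x -> theta <= complex.Im l < theta + pi *+ 2 ->
  exists sigma : stability_condition
      (fun E : Db (modA35 R[i]) => quintic_period l (ch (forget (Phi E)))),
  forall Q : cobj (modA35 R[i]), stable sigma Q ->
    (exists2 L : FS, vanishing_cycle L & isom (Psi (stalk Q)) L) /\
    (exists (B : Db (CohGX (xi5 R))) (n : int),
       equivariant_beilinson_sheaf sO B /\ isom (Phi (stalk Q)) (cshift n B)).
Proof.
move=> theta; have [Y HY] := quintic_period_turn theta.
(* As |x| = exp(Re l), the bound |x| < eps says that y = - Re l / (2 pi) exceeds Y. *)
exists (expR (- (Y * (pi *+ 2)))); first exact: expR_gt0.
move=> x l _ xeps lx th.
have p0 : 0 < pi *+ 2 :> R by rewrite mulrn_wgt0 ?pi_gt0.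
have Yl : Y <= - (complex.Re l / (pi *+ 2)).
  move: xeps; rewrite -lx normc_cexp ltcR ltr_expR => H.
  by rewrite -mulNr ler_pdivlMr//; move: H; rewrite ltrNr => /ltW.
(* Classes are written down for all n, beyond the levels 0, ..., 15 of the quiver, so that the
   phases form an infinite sequence. *)
pose v n : Hev R := \sum_(j < 4) tau_lattice R[i] n j *: J R ^+ j.
have hv n j : (j < 4)%N -> hcoef (v n) j = tau_lattice R[i] n j.
  move=> j4; rewrite hcoef_sum (bigD1 (Ordinal j4))//= hcoefZ hcoefJX// eqxx mulr1.
  rewrite big1 ?addr0// => k /eqP kj; rewrite hcoefZ hcoefJX//.
  by case: eqP => [e|_]; [case: kj; apply: val_inj | rewrite mulr0].
have [phi [phi_phase phi_turn]] := turning_phases (fun n => HY l Yl th n (v n) (v n.+1) (hv n) (hv n.+1)).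
set Z := fun E => _.
have ZK : K_hom Z.
  have [chK _ _ _] := hch.
  have := functor_K_hom Phi (forget_K_hom (xi := xi5 R) chK) => FK A B W f g h d.
  by rewrite /Z (FK _ _ _ _ _ _ d) quintic_periodD.
have Z_simple s : Z (stalk (simple R[i] s)) = quintic_period l (v (A35_level s)).
  rewrite /Z; congr quintic_period; apply: hcoefP => j j4.
  by rewrite (ch_tau_pow_OX hch (hPhi_simple s) j4) hv.
have [sigma [ss ph]] := level_stability ZK Z_simple phi_phase phi_turn.
exists sigma => Q /(level_stable_simple ss ph)[s Qs].
have Qs' := stalk_isom Qs; split.
- have [L HL Ls] := hPsi_simple s; exists L => //.
  exact: isom_trans (functor_isom Psi Qs') Ls.
- have [B [p [HB Bp]]] := tau_pow_beilinson htau5 hbeilinson (hPhi_simple s).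
  exists B, p; split => //; exact: isom_trans (functor_isom Phi Qs') Bp.
Qed.
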